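(* Let $f$ be distributionally integrable over $[a,c]$ for any $c<b$ (with $a<c$). Let $F(x)=(\mathfrak{dist})\int_a^xf(t)\,dt$, $x<b$, be its indefinite integral, and let $\mathsf F$ be the corresponding Łojasiewicz distribution defined for $x<b$, $F\leftrightarrow\mathsf F$. Suppose that the distributional limit $$\lim_{c\to b^-}\mathsf F(c)=L$$ exists. Then $f$ is distributionally integrable over $[a,b]$ and $$(\mathfrak{dist})\int_a^bf(x)\,dx=L .$$
   Context: Distributions are real. Notation: $\overline{\mathbb R}=\mathbb R\cup\{-\infty,\infty\}$; $\mathcal E'[a,b]$ is the space of distributions on $\mathbb R$ with support contained in $[a,b]$; $\langle \mathsf g(x+ty),\phi(y)\rangle:=|t|^{-1}\langle \mathsf g(y),\phi((y-x)/t)\rangle$ for $t\ne0$. Point values. For a distribution $\mathsf g$ defined near $x_0$, the distributional (Łojasiewicz) point value $\mathsf g(x_0)$ exists and equals $\gamma\in\mathbb R$ if $\lim_{\varepsilon\to0}\langle \mathsf g(x_0+\varepsilon y),\phi(y)\rangle=\gamma\int_{-\infty}^\infty\phi(y)\,dy$ for every $\phi\in\mathcal D(\mathbb R)$. A Łojasiewicz distribution (on $\mathbb R$, or on an open interval) is one having a point value at every point (of $\mathbb R$, resp. the interval); the associated Łojasiewicz function $G$ is the function of its point values, and the correspondence $G\leftrightarrow\mathsf G$ is one-to-one. Indefinite integral: $F$ is extended by $F(x)=0$ for $x<a$; $F$ is a Łojasiewicz function on $(-\infty,b)$ and $\mathsf F\in\mathcal D'(-\infty,b)$ is its associated Łojasiewicz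 distribution. The distributional limit $\lim_{c\to b^-}\mathsf F(c)$ exists and equals $L\in\mathbb R$ if $\lim_{\varepsilon\to0^+}\langle\mathsf F(b+\varepsilon y),\psi(y)\rangle=L\int_{-\infty}^{\infty}\psi(y)\,dy$ for every $\psi\in\mathcal D(\mathbb R)$ with $\operatorname{supp}\psi\subset(-\infty,0)$. Test classes. $\mathcal T_0$: functions $\phi\in C^\infty(\mathbb R)$, $\phi\ge0$, $\int\phi=1$, such that for some $\alpha<-1$, $\phi^{(m)}(x)=O(|x|^{\alpha-m})$ as $|x|\to\infty$ for all $m\ge0$. $\mathcal T_1$: those $\phi\in\mathcal T_0$ with $x\phi'(x)\le0$ for all $x$. For $\mathsf g\in\mathcal E'(\mathbb R)$, $\phi\in\mathcal T_0$: $\mathsf g^{+}_{\phi,0}(x)=\limsup_{t\to0^+}\langle \mathsf g(x+ty),\phi(y)\rangle$ and $\mathsf g^{-}_{\phi,0}(x)=\liminf_{t\to0^+}\langle \mathsf g(x+ty),\phi(y)\rangle$. Integral. Let $f:[a,b]\to\overline{\mathbb R}$. A major distributional pair $(\mathsf u,\mathsf U)$ for $f$ consists of $\mathsf u\in\mathcal E'[a,b]$ and a Łojasiewicz distribution $\mathsf U$ on $\mathbb R$ with $\mathsf U'=\mathsf u$, $\mathsf U(a)=0$, such that there exist a countable set $E$ and a Lebesgue null set $Z$ with $\mathsf u^-_{\phi,0}(x)\ge f(x)$ for all $x\in[a,b]\setminus Z$, $\phi\in\mathcal T_0$, and $\mathsf u^-_{\phi,0}(x)>-\infty$ for all $x\in[a,b]\setminus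 E$, $\phi\in\mathcal T_1$. A minor distributional pair $(\mathsf v,\mathsf V)$ for $f$ consists of $\mathsf v\in\mathcal E'[a,b]$ and a Łojasiewicz distribution $\mathsf V$ on $\mathbb R$ with $\mathsf V'=\mathsf v$, $\mathsf V(a)=0$, such that there exist a countable set $E$ and a null set $Z$ with $\mathsf v^+_{\phi,0}(x)\le f(x)$ for all $x\in[a,b]\setminus Z$, $\phi\in\mathcal T_0$, and $\mathsf v^+_{\phi,0}(x)<\infty$ for all $x\in[a,b]\setminus E$, $\phi\in\mathcal T_1$. The function $f$ is distributionally integrable over $[a,b]$ if it has both major and minor pairs and $\sup\mathsf V(b)=\inf\mathsf U(b)$ (sup over minor pairs, inf over major pairs); the common value is $(\mathfrak{dist})\int_a^bf(x)\,dx$. The value of $f$ at $b$ is irrelevant. *)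

(* Defs.v *)
From HB Require Import structures.
From mathcomp Require Import all_boot all_order all_algebra.
From mathcomp Require Import all_classical all_reals all_analysis.

Set Implicit Arguments.
Unset Strict Implicit.
Unset Printing Implicit Defensive.

Import Order.TTheory GRing.Theory Num.Theory.
Import numFieldNormedType.Exports.

Local Open Scope ring_scope.
Local Open Scope classical_set_scope.

Definition smooth (R : realType) (phi : R -> R) : Prop :=
  forall (n : nat) (x : R), derivable (derive1n n phi) x 1.

Definition fsupp (R : realType) (phi : R -> R) : set R :=
  closure [set x | phi x != 0].

Definition test_function (R : realType) (Omega : set R) (phi : R -> R) : Prop :=
  [/\ smooth phi, compact (fsupp phi) & fsupp phi `<=` Omega].

Definition linear_on (R : realType) (S : set (R -> R)) (g : (R -> R) -> R) :
    Prop :=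
  forall (k : R) (phi psi : R -> R), S phi -> S psi ->
    g (fun x => k * phi x + psi x) = k * g phi + g psi.

(* Elements of D'(Omega) are functionals on all of R -> R of which only the
   values on D(Omega) matter.  The last clause is the seminorm estimate
   |<g, phi>| <= C max_(n <= N) sup_K |phi^(n)| on test functions supported
   in K. *)
Definition distribution (R : realType) (Omega : set R) (g : (R -> R) -> R) :
    Prop :=
  linear_on (test_function Omega) g /\
  forall K : set R, compact K -> K `<=` Omega ->
    exists (C : R) (N : nat), forall (phi : R -> R) (M : R),
      test_function Omega phi -> fsupp phi `<=` K -> 0 <= M ->
      (forall (n : nat) (x : R), (n <= N)%N -> K x -> `|derive1n n phi x| <= M) ->
      `|g phi| <= C * M.

(* E'(R) as the dual of C^oo(R): a compactly supported distribution is
   identified with its unique continuous extension to C^oo(R), so that it can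
   be paired with test functions that do not have compact support. *)
Definition compact_distribution (R : realType) (g : (R -> R) -> R) : Prop :=
  linear_on (@smooth R) g /\
  exists (K : set R) (C : R) (N : nat), compact K /\
    forall (phi : R -> R) (M : R), smooth phi -> 0 <= M ->
      (forall (n : nat) (x : R), (n <= N)%N -> K x -> `|derive1n n phi x| <= M) ->
      `|g phi| <= C * M.

(* E'[a,b]; the second clause says that g vanishes on the complement of
   [a,b], i.e. that the support of g lies in [a,b]. *)
Definition distribution_on_itv (R : realType) (a b : R) (g : (R -> R) -> R) :
    Prop :=
  compact_distribution g /\
  forall phi : R -> R, test_function (~` `[a, b]) phi -> g phi = 0.

(* <g(x + t y), phi(y)> *)
Definition rescaled (R : realType) (g : (R -> R) -> R) (x t : R)
    (phi : R -> R) : R :=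
  `|t|^-1 * g (fun y => phi ((y - x) / t)).

Definition has_point_value (R : realType) (g : (R -> R) -> R) (x0 gamma : R) :
    Prop :=
  forall phi : R -> R, test_function setT phi ->
    rescaled g x0 e phi @[e --> (0 : R)^'] -->
      gamma * \int[lebesgue_measure]_y phi y.

Definition lojasiewicz (R : realType) (Omega : set R) (g : (R -> R) -> R) :
    Prop :=
  distribution Omega g /\
  forall x : R, Omega x -> exists gamma : R, has_point_value g x gamma.

(* The correspondence G <-> g on Omega. *)
Definition lojasiewicz_assoc (R : realType) (Omega : set R) (G : R -> R)
    (g : (R -> R) -> R) : Prop :=
  distribution Omega g /\
  forall x : R, Omega x -> has_point_value g x (G x).

Definition left_dist_limit (R : realType) (g : (R -> R) -> R) (b L : R) :
    Prop :=
  forall psi : R -> R, test_function `]-oo, 0[ psi ->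
    rescaled g b e psi @[e --> (0 : R)^'+] -->
      L * \int[lebesgue_measure]_y psi y.

(* U' = u in D'(R) *)
Definition dist_derivative (R : realType) (U u : (R -> R) -> R) : Prop :=
  forall phi : R -> R, test_function setT phi -> u phi = - U (derive1 phi).

Definition T0 (R : realType) (phi : R -> R) : Prop :=
  [/\ smooth phi, (forall x : R, 0 <= phi x),
      (\int[lebesgue_measure]_x (phi x)%:E = 1)%E &
      exists2 alpha : R, alpha < -1 &
        forall m : nat, exists C A : R, forall x : R, A <= `|x| ->
          `|derive1n m phi x| <= C * `|x| `^ (alpha - m%:R)].

Definition T1 (R : realType) (phi : R -> R) : Prop :=
  T0 phi /\ forall x : R, x * derive1 phi x <= 0.

Definition upper_phi (R : realType) (g : (R -> R) -> R) (phi : R -> R)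
    (x : R) : \bar R :=
  limf_esup (fun t : R => (rescaled g x t phi)%:E) (0 : R)^'+.

Definition lower_phi (R : realType) (g : (R -> R) -> R) (phi : R -> R)
    (x : R) : \bar R :=
  limf_einf (fun t : R => (rescaled g x t phi)%:E) (0 : R)^'+.

(* Functions on [a,b] are restrictions of functions on R: only the values of
   f on [a,b] are used. *)
Definition major_pair (R : realType) (a b : R) (f : R -> \bar R)
    (u U : (R -> R) -> R) : Prop :=
  [/\ distribution_on_itv a b u, lojasiewicz setT U, dist_derivative U u,
      has_point_value U a 0 &
      exists E Z : set R,
        [/\ countable E, (@lebesgue_measure R).-negligible Z,
            (forall (x : R) (phi : R -> R), (`[a, b] `\` Z) x -> T0 phi ->
               (f x <= lower_phi u phi x)%E) &
            (forall (x : R) (phi : R -> R), (`[a, b] `\` E) x -> T1 phi ->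
               (-oo < lower_phi u phi x)%E)]].

Definition minor_pair (R : realType) (a b : R) (f : R -> \bar R)
    (v V : (R -> R) -> R) : Prop :=
  [/\ distribution_on_itv a b v, lojasiewicz setT V, dist_derivative V v,
      has_point_value V a 0 &
      exists E Z : set R,
        [/\ countable E, (@lebesgue_measure R).-negligible Z,
            (forall (x : R) (phi : R -> R), (`[a, b] `\` Z) x -> T0 phi ->
               (upper_phi v phi x <= f x)%E) &
            (forall (x : R) (phi : R -> R), (`[a, b] `\` E) x -> T1 phi ->
               (upper_phi v phi x < +oo)%E)]].

(* The values U(b), resp. V(b), over all major, resp. minor, pairs. *)
Definition major_values (R : realType) (a b : R) (f : R -> \bar R) :
    set (\bar R) :=
  [set gamma%:E | gamma in [set gamma : R |
     exists u U : (R -> R) -> R,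
       major_pair a b f u U /\ has_point_value U b gamma]]%E.

Definition minor_values (R : realType) (a b : R) (f : R -> \bar R) :
    set (\bar R) :=
  [set gamma%:E | gamma in [set gamma : R |
     exists v V : (R -> R) -> R,
       minor_pair a b f v V /\ has_point_value V b gamma]]%E.

Definition dist_integrable (R : realType) (a b : R) (f : R -> \bar R) : Prop :=
  [/\ exists u U : (R -> R) -> R, major_pair a b f u U,
      exists v V : (R -> R) -> R, minor_pair a b f v V &
      ereal_sup (minor_values a b f) = ereal_inf (major_values a b f)].

(* Meaningful when f is integrable over [a,b]; the value is then finite. *)
Definition dist_integral (R : realType) (a b : R) (f : R -> \bar R) : \bar R :=
  ereal_inf (major_values a b f).

Definition indefinite_integral (R : realType) (a : R) (f : R -> \bar R)
    (x : R) : R :=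
  if x <= a then 0 else fine (dist_integral a x f).

(* Main.v *)
Require Import Defs.
From HB Require Import structures.
From mathcomp Require Import all_boot all_order all_algebra.
From mathcomp Require Import all_classical all_reals all_analysis.
From mathcomp Require Import ring lra.
Import Order.TTheory GRing.Theory Num.Theory.
Import numFieldNormedType.Exports.
Local Open Scope classical_set_scope.
Local Open Scope ring_scope.

(* A majorant is cut at a point by multiplying it with a smooth cutoff and letting the width of the
   transition go to 0: rescaled to unit size, the increments of this process pair a bounded family of
   distributions (Banach-Steinhaus) with a bounded family of test functions, so they decay like the
   width, and the limit is a distribution with the expected point value.  Hence majorants can be glued,
   restricted, and extended across a point at which they have a one-sided limit.

   Comparisons of point values pass to distributions: a distribution g with nonnegative point values is
   nonnegative.  Banach-Steinhaus gives g a finite order at each point; by Baire's theorem this order is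
   uniform on a portion of the closed set of points near which g is not nonnegative; a partition of
   unity at a small scale then gives g >= - C on that portion, and real induction improves - C to 0.

   Let c_n increase to b.  Majorants of f on [a, c_n] that are almost optimal are glued successively to a
   distribution U on the half-line before b such that U - F has nondecreasing point values, with
   supremum l at most eta.  So U has the left limit L + l at b, and extends to a majorant of f on [a, b].
   Conversely the restriction to [a, c] of a majorant U on [a, b] shows U(c) >= F(c), hence U(b) >= L.
   Minorants of f are the opposites of majorants of - f. *)

Set Implicit Arguments.
Unset Strict Implicit.
Unset Printing Implicit Defensive.

(** * Smooth functions *)

(** The limit at b is only distributional: the numbers F(c_n) need not tend to L, so the classical
    argument that adds up the values of the pieces breaks down. What does converge is the excess of
    a glued majorant over F, because its point values are monotone and bounded. To turn this into a
    limit of distributions, inequalities between point values must be inequalities between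
    distributions. A point value at x is a limit without any uniformity in x, which is why this
    comparison needs category and not only compactness. The pointwise conditions on majorants
    survive gluing at no cost, since the seams are countably many, hence negligible. The real cost
    is a point value at the seam: a distribution cannot be multiplied by a sharp Heaviside factor.
    These conditions also involve test functions without compact support, so they must first be
    shown to be local; the exponent alpha < -1 in T_0 makes the tails vanish. *)

Section Smooth.
Context {R : realType}.
Implicit Types (f g h : R -> R) (x y c k : R) (n N : nat) (S : set R).

Lemma is_derive_add f g x a b : is_derive x 1 f a -> is_derive x 1 g b ->
  is_derive x 1 (fun y => f y + g y) (a + b).
Proof. by move=> hf hg; exact: is_deriveD. Qed.

Lemma is_derive_scale f x c a : is_derive x 1 f a ->
  is_derive x 1 (fun y => c * f y) (c * a).
Proof. by move=> hf; exact: (is_deriveZ c hf). Qed.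

Lemma is_derive_mul f g x a b : is_derive x 1 f a -> is_derive x 1 g b ->
  is_derive x 1 (fun y => f y * g y) (a * g x + f x * b).
Proof.
move=> hf hg; have := is_deriveM hf hg; rewrite /GRing.scale /= => H.
by apply: (is_derive_eq H); ring.
Qed.

Lemma is_derive_affine f k c x a : is_derive (k * x + c) 1 f a ->
  is_derive x 1 (fun y => f (k * y + c)) (k * a).
Proof.
move=> hf.
have h1 : is_derive x 1 (fun y => k * y + c) k.
  have := is_derive_add (is_derive_scale k (is_derive_id x 1)) (is_derive_cst c x 1).
  by rewrite mulr1 addr0.
by apply: is_derive_eq (is_derive1_comp _ h1) _; rewrite mulrC.
Qed.

Lemma derive1_val f x a : is_derive x 1 f a -> derive1 f x = a.
Proof. by move=> h; rewrite derive1E derive_val. Qed.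

Lemma derive1n_Sr n f : derive1n n.+1 f = derive1n n (derive1 f).
Proof. by rewrite /derive1n iterSr. Qed.

Lemma near_derive1n n f g x : (\near x, f x = g x) ->
  \near x, derive1n n f x = derive1n n g x.
Proof.
elim: n f g => [//|n IH] f g fg; rewrite !derive1n_Sr; apply: IH.
have := fg => /near_join; apply: filterS => y fgy.
by rewrite !derive1E; exact: near_eq_derive.
Qed.

Lemma derive1n_local n f g x : (\near x, f x = g x) ->
  derive1n n f x = derive1n n g x.
Proof. by move=> /(near_derive1n n)/nbhs_singleton. Qed.

Lemma derive1n_local_ball n f g x r : 0 < r ->
  (forall y, `|y - x| < r -> f y = g y) -> derive1n n f x = derive1n n g x.
Proof.
move=> r0 fg; apply: derive1n_local; near=> y; apply: fg.
by rewrite distrC; near: y; apply: (nbhsx_ballx x r r0).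
Unshelve. all: by end_near. Qed.

(** A finite order makes induction possible: the derivative of a product, of an inverse or of a
    rescaled function is built from functions already known to have one order less, whereas [smooth]
    has no order to decrease. *)
Definition Cn n f := forall m x, (m <= n)%N -> derivable (derive1n m f) x 1.

Lemma smoothP f : smooth f <-> forall n, Cn n f.
Proof.
split=> [sf n m x _|H n x]; first exact: sf.
exact: (H n n).
Qed.

Lemma CnS n f g : (forall x, is_derive x 1 f (g x)) -> Cn n g -> Cn n.+1 f.
Proof.
move=> fg gn [|m] x mn; first by have := fg x => -[].
rewrite derive1n_Sr (_ : derive1 f = g); first exact: gn.
by apply/funext => y; apply: derive1_val.
Qed.

Lemma Cn_is_derive n f x : Cn n f -> is_derive x 1 f (derive1 f x).
Proof. by move=> fn; rewrite derive1E; apply: derivableP; exact: (fn 0%N). Qed.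

Lemma Cn_derive1 n f : Cn n.+1 f -> Cn n (derive1 f).
Proof. by move=> fn m x mn; rewrite -derive1n_Sr; exact: fn. Qed.

Lemma CnW n m f : (m <= n)%N -> Cn n f -> Cn m f.
Proof. by move=> mn fn k x km; apply: fn; exact: leq_trans mn. Qed.

Lemma Cn_cst n c : Cn n (fun=> c).
Proof.
elim: n c => [|n IH] c; last by apply: (@CnS _ _ (fun=> 0)) => // x; exact: is_derive_cst.
by move=> [|//] x _; exact: derivable_cst.
Qed.

Lemma CnD n f g : Cn n f -> Cn n g -> Cn n (fun x => f x + g x).
Proof.
elim: n f g => [|n IH] f g fn gn.
  by move=> [|//] x _; have [] := is_derive_add (Cn_is_derive x fn) (Cn_is_derive x gn).
apply: (@CnS n (fun x => f x + g x) (fun x => derive1 f x + derive1 g x)).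
  by move=> x; exact: is_derive_add (Cn_is_derive x fn) (Cn_is_derive x gn).
by apply: IH; exact: Cn_derive1.
Qed.

Lemma CnM n f g : Cn n f -> Cn n g -> Cn n (fun x => f x * g x).
Proof.
elim: n f g => [|n IH] f g fn gn.
  by move=> [|//] x _; have [] := is_derive_mul (Cn_is_derive x fn) (Cn_is_derive x gn).
apply: (@CnS n (fun x => f x * g x) (fun x => derive1 f x * g x + f x * derive1 g x)).
  by move=> x; exact: is_derive_mul (Cn_is_derive x fn) (Cn_is_derive x gn).
have fn' := Cn_derive1 fn; have gn' := Cn_derive1 gn.
have fW := CnW (leqnSn n) fn; have gW := CnW (leqnSn n) gn.
by apply: CnD; [exact: (IH _ _ fn' gW)|exact: (IH _ _ fW gn')].
Qed.

Lemma Cn_affine n f k c : Cn n f -> Cn n (fun x => f (k * x + c)).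
Proof.
elim: n f => [|n IH] f fn.
  by move=> [|//] x _; have [] := is_derive_affine (Cn_is_derive (k * x + c) fn).
apply: (@CnS n (fun x => f (k * x + c)) (fun x => k * derive1 f (k * x + c))).
  by move=> x; exact: is_derive_affine (Cn_is_derive _ fn).
apply: CnM; first exact: Cn_cst.
by apply: IH; exact: Cn_derive1.
Qed.

Lemma CnV n f : (forall x, f x != 0) -> Cn n f -> Cn n (fun x => (f x)^-1).
Proof.
move=> f0; have dV x : derivable f x 1 ->
    is_derive x 1 (fun y => (f y)^-1) (- derive1 f x * (f x)^-1 * (f x)^-1).
  move=> df; have H := is_deriveV (f0 x) (derivableP df).
  apply: (is_derive_eq H); rewrite derive1E /GRing.scale/=.
  by rewrite -exprVn expr2; ring.
elim: n => [|n IH] fn.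
  by move=> [|//] x _; have [] := dV x (fn 0%N x isT).
apply: (@CnS n (fun x => (f x)^-1) (fun x => - derive1 f x * (f x)^-1 * (f x)^-1)).
  by move=> x; apply: dV; exact: (fn 0%N).
have fV := IH (CnW (leqnSn _) fn).
apply: CnM; last exact: fV.
apply: CnM; last exact: fV.
rewrite (_ : (fun x => - derive1 f x) = (fun x => -1 * derive1 f x)).
  by apply: CnM; [exact: Cn_cst|exact: Cn_derive1].
by apply/funext => x; rewrite mulN1r.
Qed.

Lemma smooth_derivable f x : smooth f -> derivable f x 1.
Proof. by move/(_ 0%N x). Qed.

Lemma smooth_is_derive f x : smooth f -> is_derive x 1 f (derive1 f x).
Proof. by move/smoothP/(_ 0%N)/Cn_is_derive. Qed.

Lemma smooth_derive1 f : smooth f -> smooth (derive1 f).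
Proof. by move=> sf n x; rewrite -derive1n_Sr. Qed.

Lemma smooth_derive1n n f : smooth f -> smooth (derive1n n f).
Proof. by move=> sf m x; rewrite /derive1n -iterD; exact: (sf (m + n)%N). Qed.

Lemma smooth_continuous f : smooth f -> continuous f.
Proof.
by move=> sf x; apply/differentiable_continuous/derivable1_diffP/smooth_derivable.
Qed.

Lemma smooth_cst c : smooth (fun=> c).
Proof. by apply/smoothP => n; exact: Cn_cst. Qed.

Lemma smoothD f g : smooth f -> smooth g -> smooth (fun x => f x + g x).
Proof. by move=> /smoothP sf /smoothP sg; apply/smoothP => n; exact: CnD. Qed.

Lemma smoothM f g : smooth f -> smooth g -> smooth (fun x => f x * g x).
Proof. by move=> /smoothP sf /smoothP sg; apply/smoothP => n; exact: CnM. Qed.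

Lemma smoothZ c f : smooth f -> smooth (fun x => c * f x).
Proof. by apply: smoothM; exact: smooth_cst. Qed.

Lemma smoothN f : smooth f -> smooth (fun x => - f x).
Proof.
move=> /(@smoothZ (-1)); congr smooth; apply/funext => x.
by rewrite mulN1r.
Qed.

Lemma smoothB f g : smooth f -> smooth g -> smooth (fun x => f x - g x).
Proof. by move=> sf sg; exact: smoothD sf (smoothN sg). Qed.

Lemma smooth_affine f k c : smooth f -> smooth (fun x => f (k * x + c)).
Proof. by move=> /smoothP sf; apply/smoothP => n; exact: Cn_affine. Qed.

Lemma smoothV f : (forall x, f x != 0) -> smooth f -> smooth (fun x => (f x)^-1).
Proof. by move=> f0 /smoothP sf; apply/smoothP => n; exact: CnV. Qed.

Lemma derive1nD n f g x : smooth f -> smooth g ->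
  derive1n n (fun y => f y + g y) x = derive1n n f x + derive1n n g x.
Proof.
elim: n f g => [//|n IH] f g sf sg; rewrite !derive1n_Sr.
rewrite -IH; [|exact: smooth_derive1..]; congr (derive1n _ _ _).
apply/funext => y; apply: derive1_val; apply: is_derive_add; exact: smooth_is_derive.
Qed.

Lemma derive1nZ n c f x : smooth f ->
  derive1n n (fun y => c * f y) x = c * derive1n n f x.
Proof.
elim: n f => [//|n IH] f sf; rewrite !derive1n_Sr.
rewrite -IH; last exact: smooth_derive1; congr (derive1n _ _ _).
apply/funext => y; apply: derive1_val; apply: is_derive_scale; exact: smooth_is_derive.
Qed.

Lemma derive1nB n f g x : smooth f -> smooth g ->
  derive1n n (fun y => f y - g y) x = derive1n n f x - derive1n n g x.
Proof.
move=> sf sg; rewrite -mulN1r -(derive1nZ _ _ _ sg) -(derive1nD _ _ sf (smoothZ sg)).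
by congr (derive1n _ _ _); apply/funext => y; rewrite mulN1r.
Qed.

Lemma derive1n_affine n f k c x : smooth f ->
  derive1n n (fun y => f (k * y + c)) x = k ^+ n * derive1n n f (k * x + c).
Proof.
elim: n f => [|n IH] f sf; first by rewrite expr0 mul1r.
rewrite !derive1n_Sr exprSr -mulrA mulrCA -IH; last exact: smooth_derive1.
rewrite -derive1nZ; last by apply: smooth_affine; exact: smooth_derive1.
congr (derive1n _ _ _); apply/funext => y; apply: derive1_val.
by apply: is_derive_affine; exact: smooth_is_derive.
Qed.

Lemma derive1n_cst n c x : (0 < n)%N -> derive1n n (fun=> c) x = 0.
Proof.
case: n => // n _; rewrite derive1n_Sr.
have -> : derive1 (fun=> c : R) = fun=> 0 * 0 by apply/funext => y; rewrite mul0r derive1_cst.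
by rewrite (derive1nZ n 0 x (@smooth_cst 0)) mul0r.
Qed.

Lemma derive1n_eq0 n f x r : 0 < r -> (forall y, `|y - x| < r -> f y = 0) -> derive1n n f x = 0.
Proof.
move=> r0 f0; rewrite (@derive1n_local_ball n f (fun=> 0) x r r0 f0).
by case: n => [//|n]; exact: derive1n_cst.
Qed.

(* Leibniz' formula with the binomial coefficients bounded by [2 ^ N]. *)
Lemma derive1nM_bound N f g x M1 M2 : smooth f -> smooth g ->
  (forall n, (n <= N)%N -> `|derive1n n f x| <= M1) ->
  (forall n, (n <= N)%N -> `|derive1n n g x| <= M2) ->
  forall n, (n <= N)%N -> `|derive1n n (fun y => f y * g y) x| <= 2 ^+ N * M1 * M2.
Proof.
move=> sf sg bf bg n nN.
have M10 : 0 <= M1 by apply: le_trans (bf 0%N isT).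
have M20 : 0 <= M2 by apply: le_trans (bg 0%N isT).
apply: (@le_trans _ _ (2 ^+ n * M1 * M2)); last first.
  by rewrite -!mulrA ler_wpM2r ?mulr_ge0// ler_weXn2l// ler1n.
elim: n N f g sf sg bf bg nN => [|n IH] N f g sf sg bf bg nN.
  rewrite expr0 mul1r /= normrM ler_pM//; [exact: (bf 0%N)|exact: (bg 0%N)].
have sf' := smooth_derive1 sf; have sg' := smooth_derive1 sg.
have -> : derive1n n.+1 (fun y => f y * g y) x =
    derive1n n (fun y => derive1 f y * g y) x + derive1n n (fun y => f y * derive1 g y) x.
  rewrite derive1n_Sr -(derive1nD _ _ (smoothM sf' sg) (smoothM sf sg')).
  congr (derive1n _ _ _); apply/funext => y; apply: derive1_val.
  by apply: is_derive_mul; exact: smooth_is_derive.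
apply: le_trans (ler_normD _ _) _.
have -> : 2 ^+ n.+1 * M1 * M2 = 2 ^+ n * M1 * M2 + 2 ^+ n * M1 * M2 by rewrite exprS; ring.
case: N bf bg nN => // N bf bg nN.
apply: lerD.
- apply: (IH N _ _ sf' sg _ _ nN) => m mN; first by rewrite -derive1n_Sr; exact: bf.
  by apply: bg; exact: leq_trans mN _.
- apply: (IH N _ _ sf sg' _ _ nN) => m mN; last by rewrite -derive1n_Sr; exact: bg.
  by apply: bf; exact: leq_trans mN _.
Qed.

Lemma smooth_bounded N f p q : smooth f ->
  exists2 M, 0 < M & forall n x, (n <= N)%N -> p <= x <= q -> `|derive1n n f x| <= M.
Proof.
move=> sf; have [pq|qp] := lerP p q; last first.
  by exists 1 => // n x _ /andP[px xq]; have := le_trans px xq; rewrite leNgt qp.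
elim: N => [|N [M M0 IH]].
- have /compact_bounded : compact (f @` `[p, q]).
    apply: continuous_compact; last exact: segment_compact.
    by apply: continuous_subspaceT; exact: smooth_continuous.
  move=> [B [_ HB]]; exists (`|B| + 1) => [|n x]; first by rewrite ltr_wpDl.
  rewrite leqn0 => /eqP -> pxq /=; apply: HB; first by rewrite (le_lt_trans (ler_norm _))// ltrDl.
  by exists x => //=; rewrite in_itv.
- have /compact_bounded : compact (derive1n N.+1 f @` `[p, q]).
    apply: continuous_compact; last exact: segment_compact.
    by apply: continuous_subspaceT; apply: smooth_continuous; exact: smooth_derive1n.
  move=> [B [_ HB]]; exists (Num.max M (`|B| + 1)) => [|n x]; first by rewrite lt_max M0.
  rewrite leq_eqVlt => /orP[/eqP -> pxq|nN pxq]; rewrite le_max; last by rewrite IH.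
  apply/orP; right; apply: HB; first by rewrite (le_lt_trans (ler_norm _))// ltrDl.
  by exists x => //=; rewrite in_itv.
Qed.

Lemma MVT_bound f x y M : smooth f ->
  (forall z, Num.min x y <= z <= Num.max x y -> `|derive1 f z| <= M) ->
  `|f y - f x| <= M * `|y - x|.
Proof.
move=> sf; have mvt u v : u <= v ->
    (forall z, u <= z <= v -> `|derive1 f z| <= M) -> `|f v - f u| <= M * `|v - u|.
  move=> uv H; have [|c] := @MVT_segment _ f (derive1 f) u v uv (fun z _ => smooth_is_derive z sf).
    by apply: continuous_subspaceT; exact: smooth_continuous.
  by rewrite in_itv /= => /H cM ->; rewrite normrM ler_wpM2r.
have [xy|yx] := orP (le_total x y) => H.
  by apply: (mvt x y xy) => z /andP[xz zy]; apply: H; rewrite ge_min xz le_max zy orbT.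
rewrite distrC (distrC y); apply: (mvt y x yx) => z /andP[xz zy]; apply: H.
by rewrite ge_min xz le_max zy orbT.
Qed.

End Smooth.

(** * A smooth step function *)

Section Bump.
Context {R : realType}.
Implicit Types (f g : R -> R) (x y c k : R) (n N : nat).

Lemma is_derive_littleo f x d :
  (forall e : R, 0 < e -> exists2 r : R, 0 < r & forall h : R, `|h| < r ->
     `|f (x + h) - f x - d * h| <= e * `|h|) -> is_derive x 1 f d.
Proof.
move=> H; have cv : h^-1 *: ((f \o shift x) (h *: 1) - f x) @[h --> 0^'] --> d.
  apply/cvgrPdist_le => e e0; have [r r0 Hr] := H _ e0.
  near=> h; have h0 : h != 0 by near: h; exact: nbhs_dnbhs_neq.
  have hr : `|h| < r.
    rewrite -[h]subr0 distrC; near: h; apply: nbhs_dnbhs.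
    exact: (nbhsx_ballx (0:R) r r0).
  rewrite /= /GRing.scale /= mulr1 -(ler_pM2r (x := `|h|)) ?normr_gt0// -normrM.
  apply: le_trans (Hr _ hr); rewrite -normrN (addrC h x).
  suff -> : - ((d - h^-1 * (f (x + h) - f x)) * h) = f (x + h) - f x - d * h by [].
  by field.
by split; [apply/cvg_ex; exists d|exact: cvg_lim cv].
Unshelve. all: by end_near. Qed.

Lemma horner_bound (p : {poly R}) : exists2 C : R, 0 <= C &
  forall y, 1 <= y -> `|p.[y]| <= C * y ^+ size p.
Proof.
exists (\sum_(i < size p) `|p`_i|) => [|y y1]; first by apply: sumr_ge0.
rewrite horner_coef mulr_suml; apply: le_trans (ler_norm_sum _ _ _) _.
apply: ler_sum => i _; rewrite normrM ler_wpM2l// normrX ger0_norm ?(le_trans ler01 y1)//.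
by rewrite ler_weXn2l// ltnW.
Qed.

(** Letting the polynomial vary makes this family stable under differentiation, so that smoothness
    follows by induction on the order for all p at once. *)
Definition flat (p : {poly R}) x : R :=
  if 0 < x then p.[x^-1] * expR (- x^-1) else 0.

(** With y = 1/x >= 1, exp y dominates y^(k+2) / (k+2)! for k = [size p], which leaves a factor x^2.
    A quadratic bound gives derivative 0 at the origin. *)
Lemma flat_bound p : exists2 C, 0 < C & forall x, x <= 1 -> `|flat p x| <= C * x ^+ 2.
Proof.
have [C C0 HC] := horner_bound p.
exists ((C + 1) * (size p).+2`!%:R) => [|x x1].
  by rewrite mulr_gt0 ?ltr0n ?fact_gt0// ltr_wpDl.
rewrite /flat; case: ifPn => [x0|_]; last by rewrite normr0 mulr_ge0 ?sqr_ge0// mulr_ge0// addr_ge0.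
have y1 : 1 <= x^-1 by rewrite invf_ge1.
rewrite normrM [X in _ * X]ger0_norm ?expR_ge0//.
apply: (@le_trans _ _ ((C + 1) * x^-1 ^+ size p * expR (- x^-1))).
  rewrite ler_wpM2r ?expR_ge0// (le_trans (HC _ y1))// ler_wpM2r ?lerDl// exprn_ge0// invr_ge0 ltW//.
rewrite -!mulrA ler_pM2l ?ltr_wpDl//.
have y0 : 0 < x^-1 by rewrite invr_gt0.
have := @expR_ge1Dxn R x^-1 (size p).+1 (ltW y0).
rewrite expRN => H.
rewrite ler_pdivrMr ?expR_gt0//.
have {}H : x^-1 ^+ (size p).+2 / (size p).+2`!%:R <= expR x^-1 by apply: le_trans H; rewrite lerDr.
have f0 : 0 < (size p).+2`!%:R :> R by rewrite ltr0n fact_gt0.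
rewrite ler_pdivrMr// in H.
apply: (@le_trans _ _ (x^+2 * (expR x^-1 * (size p).+2`!%:R))); last first.
  by rewrite le_eqVlt; apply/orP; left; apply/eqP; ring.
apply: le_trans (ler_wpM2l (sqr_ge0 x) H).
have -> : x^-1 ^+ (size p).+2 = x^-1 ^+ size p * (x^-1 * x^-1).
  by rewrite -[(size p).+2]addn2 exprD expr2.
suff -> : x ^+ 2 * (x^-1 ^+ size p * (x^-1 * x^-1)) = x^-1 ^+ size p by [].
by rewrite expr2 mulrCA -mulrA (mulrCA x x^-1 x^-1) divff ?gt_eqF// mulr1 divff ?gt_eqF// mulr1.
Qed.

(** The chain rule applied to p(1/x) exp(-1/x) gives x^-2 (p - p')(1/x) exp(-1/x). *)
Definition flatD (p : {poly R}) : {poly R} := 'X^2 * (p - p^`()%R).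

Lemma flat_is_derive p x : is_derive x 1 (flat p) (flat (flatD p) x).
Proof.
case: (ltgtP x 0) => [x0|x0|->].
- rewrite {2}/flat (lt_gtF x0).
  apply: near_eq_is_derive (is_derive_cst (0:R) x 1); near=> y.
  rewrite /flat ltNge le_eqVlt; suff -> : y < 0 by rewrite orbT.
  by near: y; exact: lt_nbhsl.
- have dx : is_derive x 1 (fun y => p.[y^-1] * expR (- y^-1)) (flat (flatD p) x).
    have hV : is_derive x 1 (fun y => y^-1) (- x^-2).
      have := is_deriveV (lt0r_neq0 x0) (is_derive_id x 1).
      by rewrite /GRing.scale /= mulr1.
    have hp : is_derive x^-1 1 (horner p) (p^`()%R.[x^-1]).
      have := derivableP (derivable_horner (p := p) (x := x^-1)).
      by rewrite -derive1E -derivE.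
    have h1 := is_derive1_comp hp hV.
    have hN : is_derive x 1 (fun y => - y^-1) (x^-2) by apply: is_derive_eq (is_deriveN hV) _; rewrite opprK.
    have h2 := @is_derive1_comp _ expR (fun y => - y^-1) x _ _ (is_derive_expR (- x^-1)) hN.
    apply: is_derive_eq (is_derive_mul h1 h2) _ => /=.
    rewrite /flat x0 /flatD hornerM hornerXn hornerD hornerN.
    by rewrite -exprVn; ring.
  apply: near_eq_is_derive dx; near=> y.
  rewrite /flat; suff -> : 0 < y by [].
  by near: y; exact: lt_nbhsr.
- have fl0 q : flat q 0 = 0 by rewrite /flat ltxx.
  rewrite fl0; apply: is_derive_littleo => e e0.
  have [C C0 HC] := flat_bound p.
  exists (Num.min 1 (e / C)) => [|h]; first by rewrite lt_min ltr01 divr_gt0.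
  rewrite lt_min => /andP[h1 he]; rewrite add0r fl0 mul0r !subr0.
  apply: le_trans (HC _ _) _; first by rewrite (le_trans (ler_norm _))// ltW.
  rewrite -real_normK ?num_real// expr2 mulrA ler_wpM2r// mulrC.
  by rewrite -ler_pdivlMr// ltW.
Unshelve. all: by end_near. Qed.

Lemma smooth_flat p : smooth (flat p).
Proof.
apply/smoothP => n; elim: n p => [|n IH] p.
  by move=> [|//] x _; have [] := flat_is_derive p x.
by apply: CnS (IH _); exact: flat_is_derive.
Qed.

Definition flat1 : R -> R := flat 1.

Lemma flat1_ge0 x : 0 <= flat1 x.
Proof. by rewrite /flat1 /flat hornerC mul1r; case: ifP => // _; exact: expR_ge0. Qed.

Lemma flat1_gt0 x : 0 < x -> 0 < flat1 x.
Proof. by rewrite /flat1 /flat hornerC mul1r => ->; exact: expR_gt0. Qed.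

Lemma flat1_eq0 x : x <= 0 -> flat1 x = 0.
Proof. by rewrite /flat1 /flat leNgt => /negbTE ->. Qed.

Definition step x : R := flat1 x / (flat1 x + flat1 (1 - x)).

Lemma step_den x : 0 < flat1 x + flat1 (1 - x).
Proof.
have [x0|x0] := ltrP 0 x; first by rewrite ltr_pwDl ?flat1_gt0// flat1_ge0.
by rewrite ltr_wpDl ?flat1_ge0// flat1_gt0// subr_gt0 (le_lt_trans x0).
Qed.

Lemma smooth_step : smooth step.
Proof.
have s1 : smooth flat1 by exact: smooth_flat.
have s2 : smooth (fun x => flat1 (1 - x)).
  have := smooth_affine (k := -1) (c := 1) s1.
  by congr smooth; apply/funext => x; rewrite mulN1r addrC.
apply: (smoothM s1); apply: smoothV; last exact: (smoothD s1 s2).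
by move=> x; rewrite gt_eqF// step_den.
Qed.

Lemma step_eq0 x : x <= 0 -> step x = 0.
Proof. by move=> x0; rewrite /step flat1_eq0// mul0r. Qed.

Lemma step_eq1 x : 1 <= x -> step x = 1.
Proof.
move=> x1; have h : flat1 (1 - x) = 0 by rewrite flat1_eq0// subr_le0.
rewrite /step h addr0 divff// gt_eqF// flat1_gt0//.
by rewrite (lt_le_trans ltr01).
Qed.

Lemma step_ge0 x : 0 <= step x.
Proof. by rewrite divr_ge0 ?flat1_ge0// ltW// step_den. Qed.

Lemma step_le1 x : step x <= 1.
Proof. by rewrite ler_pdivrMr ?step_den// mul1r lerDl flat1_ge0. Qed.

(** Rises from 0 to 1 between c and c + w. The cutoffs and partitions of unity below are built from
    ramps because their sums telescope and rescaling maps ramps to ramps. *)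
Definition ramp (c w : R) x : R := step (w^-1 * (x - c)).

Lemma smooth_ramp c w : smooth (ramp c w).
Proof.
have := smooth_affine (k := w^-1) (c := - (w^-1 * c)) smooth_step.
by congr smooth; apply/funext => x; rewrite /ramp mulrBr.
Qed.

Lemma ramp_eq0 c w x : 0 < w -> x <= c -> ramp c w x = 0.
Proof. by move=> w0 xc; rewrite /ramp step_eq0// mulr_ge0_le0// ?subr_le0// invr_ge0 ltW. Qed.

Lemma ramp_eq1 c w x : 0 < w -> c + w <= x -> ramp c w x = 1.
Proof.
move=> w0 xc; rewrite /ramp step_eq1// mulrC ler_pdivlMr// mul1r.
by rewrite lerBrDl.
Qed.

Lemma ramp_ge0 c w x : 0 <= ramp c w x.
Proof. exact: step_ge0. Qed.

Lemma ramp_le1 c w x : ramp c w x <= 1.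
Proof. exact: step_le1. Qed.

End Bump.

(** * Test functions and their integrals *)

Section TestFunctions.
Context {R : realType}.
Implicit Types (phi psi : R -> R) (x y c k p q : R) (n N : nat) (Omega : set R).

(** Working form of a test function with an explicit interval, since constants depend on the
    interval. The case q < p is allowed and forces phi = 0. *)
Definition supported p q phi := smooth phi /\ forall x, phi x != 0 -> p <= x <= q.

Lemma supported_out p q phi x : supported p q phi -> (x < p) || (q < x) -> phi x = 0.
Proof.
move=> [_ H] out; apply/eqP/negPn/negP => /H/andP[px xq].
by move: out; rewrite !ltNge px xq.
Qed.

Lemma supported_test p q phi Omega : supported p q phi ->
  (forall x, p <= x <= q -> Omega x) -> test_function Omega phi.
Proof.
move=> [sphi H] pqO; have sub : fsupp phi `<=` `[p, q].
  rewrite /fsupp (_ : `[p, q]%classic = closure `[p, q]%classic); last first.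
    by apply/closure_id; exact: interval_closed.
  by apply: closure_subset => x /H; rewrite /= in_itv.
split.
- exact: sphi.
- apply: subclosed_compact sub; first exact: closed_closure.
  exact: segment_compact.
- by move=> x /sub; rewrite /= in_itv; exact: pqO.
Qed.

Lemma supported_testT p q phi : supported p q phi -> test_function setT phi.
Proof. by move=> /supported_test; apply. Qed.

Lemma fsupp_notin phi x : ~ fsupp phi x ->
  exists2 r : R, 0 < r & forall y, `|y - x| < r -> phi y = 0.
Proof.
move=> nx; have oC : open (~` fsupp phi) by apply: closed_openC; exact: closed_closure.
have /nbhs_ballP[r r0 Hr] : nbhs x (~` fsupp phi) by exact: open_nbhs_nbhs.
exists r => // y yx; apply/eqP/negPn/negP => y0.
have : (~` fsupp phi) y by apply: Hr; rewrite /ball /= distrC.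
by apply; apply: subset_closure.
Qed.

Lemma test_supported Omega phi : test_function Omega phi ->
  exists p q, [/\ p < q, supported p q phi & forall x, phi x != 0 -> Omega x].
Proof.
move=> [sphi /compact_bounded [B [_ HB]] sub].
have B1 : forall x, phi x != 0 -> `|x| <= `|B| + 1.
  move=> x x0; apply: HB; first by rewrite (le_lt_trans (ler_norm _))// ltrDl.
  exact: subset_closure.
exists (- (`|B| + 1)), (`|B| + 1); split.
- by rewrite gtrN// ltr_wpDl.
- by split=> [|x /B1]; [exact: sphi|rewrite ler_norml].
- by move=> x x0; apply: sub; exact: subset_closure.
Qed.

Lemma testT_supported Omega phi : test_function Omega phi ->
  exists p q, p < q /\ supported p q phi.
Proof. by move=> /test_supported[p [q [pq H _]]]; exists p, q. Qed.

Lemma test_itvNyo_supported c phi : test_function `]-oo, c[ phi ->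
  exists p q, [/\ p < q, q < c & supported p q phi].
Proof.
move=> tphi; have [p [q [pq [sphi H] _]]] := test_supported tphi.
have nc : ~ fsupp phi c by case: tphi => _ _ sub /sub; rewrite /= in_itv/= ltxx.
have [r r0 Hr] := fsupp_notin nc.
(* The left end is lowered only to keep p < q; the right end sits in the gap of width r that the
   compact support leaves before c. *)
exists (Num.min p (c - r - 1)), (c - r / 2); split.
- by rewrite gt_min; apply/orP; right; lra.
- lra.
- split=> [|x x0]; first exact: sphi.
  have /andP[px xq] := H _ x0; rewrite ge_min px/= leNgt; apply/negP => cx.
  have xc : x < c.
    case: tphi => _ _ sub; have : `]-oo, c[%classic x by apply: sub; exact: subset_closure.
    by rewrite /= in_itv.
  suff : phi x = 0 by move/eqP: x0.
  by apply: Hr; rewrite ltr_norml; apply/andP; split; lra.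
Qed.

Lemma supportedW p q p' q' phi : p' <= p -> q <= q' -> supported p q phi ->
  supported p' q' phi.
Proof.
move=> pp qq [sphi H]; split; first exact: sphi.
by move=> x /H/andP[px xq]; rewrite (le_trans pp px) (le_trans xq qq).
Qed.

Lemma supportedD p q phi psi : supported p q phi -> supported p q psi ->
  supported p q (fun x => phi x + psi x).
Proof.
move=> sphi spsi; split; first exact: (smoothD (proj1 sphi) (proj1 spsi)).
move=> x; apply: contraNT; rewrite negb_and -!ltNge => out.
by rewrite (supported_out sphi out) (supported_out spsi out) addr0.
Qed.

Lemma supportedMl p q phi psi : smooth psi -> supported p q phi ->
  supported p q (fun x => psi x * phi x).
Proof.
move=> spsi sphi; split; first exact: (smoothM spsi (proj1 sphi)).
move=> x; apply: contraNT; rewrite negb_and -!ltNge => out.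
by rewrite (supported_out sphi out) mulr0.
Qed.

Lemma supportedMr p q phi psi : smooth psi -> supported p q phi ->
  supported p q (fun x => phi x * psi x).
Proof.
move=> spsi sphi; rewrite (_ : (fun _ => _) = fun x => psi x * phi x).
  exact: supportedMl.
by apply/funext => x; rewrite mulrC.
Qed.

Lemma supportedZ p q c phi : supported p q phi -> supported p q (fun x => c * phi x).
Proof. by apply: supportedMl; exact: smooth_cst. Qed.

Lemma supportedN p q phi : supported p q phi -> supported p q (fun x => - phi x).
Proof.
move=> /(supportedZ (-1)); congr supported; apply/funext => x.
by rewrite mulN1r.
Qed.

Lemma supportedB p q phi psi : supported p q phi -> supported p q psi ->
  supported p q (fun x => phi x - psi x).
Proof. by move=> sphi spsi; exact: (supportedD sphi (supportedN spsi)). Qed.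

Lemma supported0 p q : supported p q (fun=> 0).
Proof. by split=> [|x]; [exact: smooth_cst|rewrite eqxx]. Qed.

Lemma supported_sum p q n (F : nat -> R -> R) : (forall i, (i < n)%N -> supported p q (F i)) ->
  supported p q (fun x => \sum_(i < n) F i x).
Proof.
elim: n => [|n IH] H.
  have -> : (fun x => \sum_(i < 0) F i x) = fun=> 0 by apply/funext => x; rewrite big_ord0.
  exact: supported0.
have -> : (fun x => \sum_(i < n.+1) F i x) = fun x => \sum_(i < n) F i x + F n x.
  by apply/funext => x; rewrite big_ord_recr.
by apply: supportedD; [apply: IH => i ni; apply: H; exact: ltnW|exact: H].
Qed.

Lemma derive1n_out p q phi n x : supported p q phi -> (x < p) || (q < x) ->
  derive1n n phi x = 0.
Proof.
move=> sphi /orP[xp|qx].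
- apply: (@derive1n_eq0 _ n phi x (p - x)); first by rewrite subr_gt0.
  move=> y; rewrite ltr_norml => /andP[_ H]; apply: (supported_out sphi).
  by apply/orP; left; lra.
- apply: (@derive1n_eq0 _ n phi x (x - q)); first by rewrite subr_gt0.
  move=> y; rewrite ltr_norml => /andP[H _]; apply: (supported_out sphi).
  by apply/orP; right; lra.
Qed.

Lemma supported_derive1 p q phi : supported p q phi -> supported p q (derive1 phi).
Proof.
move=> sphi; split; first exact: (smooth_derive1 (proj1 sphi)).
move=> x; apply: contraNT; rewrite negb_and -!ltNge => out.
by rewrite -derive1n1 (derive1n_out _ sphi).
Qed.

Lemma supported_bounded p q phi N : supported p q phi ->
  exists2 M, 0 < M & forall n x, (n <= N)%N -> `|derive1n n phi x| <= M.
Proof.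
move=> sphi; have [M M0 HM] := smooth_bounded N p q (proj1 sphi).
exists M => // n x nN; have [xpq|out] := boolP (p <= x <= q); first exact: HM.
rewrite (derive1n_out _ sphi) ?normr0 ?ltW//.
by move: out; rewrite negb_and -!ltNge.
Qed.

Lemma supported_rescale p q phi x e : 0 < e -> supported p q phi ->
  supported (x + e * p) (x + e * q) (fun y => phi ((y - x) / e)).
Proof.
move=> e0 [sphi H]; split.
  have := smooth_affine (k := e^-1) (c := - (x / e)) sphi.
  by congr smooth; apply/funext => y; rewrite mulrBl mulrC.
move=> y /H; rewrite ler_pdivlMr// ler_pdivrMr// => /andP[h1 h2].
by apply/andP; split; lra.
Qed.

Lemma derive1n_rescale n phi x e y : smooth phi ->
  derive1n n (fun y => phi ((y - x) / e)) y = e^-1 ^+ n * derive1n n phi ((y - x) / e).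
Proof.
move=> sphi.
have -> : (fun y => phi ((y - x) / e)) = fun y => phi (e^-1 * y + - (x / e)).
  by apply/funext => z; rewrite mulrBl mulrC.
by rewrite derive1n_affine// mulrBl (mulrC y).
Qed.

Lemma supported_reflect p q phi : supported p q phi ->
  supported (- q) (- p) (fun y => phi (- y)).
Proof.
move=> [sphi H]; split.
  have := smooth_affine (k := -1) (c := 0) sphi.
  by congr smooth; apply/funext => y; rewrite mulN1r addr0.
by move=> y /H; rewrite lerNr lerNl andbC.
Qed.

Definition J phi : R := \int[lebesgue_measure]_y phi y.

Lemma supported_integrable p q phi (A : set R) : measurable A -> supported p q phi ->
  lebesgue_measure.-integrable A (EFin \o phi).
Proof.
move=> mA sphi; apply: (@integrableS _ _ _ lebesgue_measure setT) => //.
have -> : EFin \o phi = (EFin \o phi) \_ `[p, q].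
  apply/funext => x; rewrite patchE; case: ifPn => //=.
  by rewrite notin_setE /= in_itv /= => /negP; rewrite negb_and -!ltNge => /(supported_out sphi) ->.
rewrite -integrable_mkcond//.
apply: continuous_compact_integrable; first exact: segment_compact.
by apply: continuous_subspaceT; exact: (smooth_continuous (proj1 sphi)).
Qed.

Lemma supported_primitive p q phi : supported p q phi ->
  exists F : R -> R, forall x, is_derive x 1 F (phi x).
Proof.
move=> sphi; exists (fun x => \int[lebesgue_measure]_(t in [set` `]-oo, x]]) (phi t)) => x.
have x1 : x < x + 1 by rewrite ltrDl.
have ix : lebesgue_measure.-integrable `]-oo, x + 1] (EFin \o phi).
  by apply: supported_integrable sphi; exact: measurable_itv.
have cx : {for x, continuous phi} by exact: (smooth_continuous (proj1 sphi)).
have [|d1 d2] := @continuous_FTC1 R phi -oo%O x (x + 1) x1 ix _ cx; first by rewrite ltNyr.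
by split; [exact: d1|rewrite -derive1E].
Qed.

(** Reduces integrals of test functions to values of a primitive, so that linearity, rescaling and
    reflection become identities between primitives and need no change of variables in the Lebesgue
    integral. *)
Lemma J_primitive p q phi (F : R -> R) : p < q -> supported p q phi ->
  (forall x, is_derive x 1 F (phi x)) -> J phi = F q - F p.
Proof.
move=> pq sphi dF; have cF : continuous F.
  by move=> x; apply/differentiable_continuous/derivable1_diffP; have [] := dF x.
have -> : J phi = \int[lebesgue_measure]_(x in `[p, q]) phi x.
  rewrite Rintegral_mkcond; congr (Rintegral _ _ _); apply/funext => x.
  rewrite patchE; case: ifPn => //=.
  by rewrite notin_setE /= in_itv /= => /negP; rewrite negb_and -!ltNge => /(supported_out sphi) ->.
rewrite /Rintegral (@continuous_FTC2 _ phi F)//.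
- by apply: continuous_subspaceT; exact: (smooth_continuous (proj1 sphi)).
- split.
  + by move=> x _; have [] := dF x.
  + by apply: cvg_at_right_filter; exact: cF.
  + by apply: cvg_at_left_filter; exact: cF.
- by move=> x _; exact: derive1_val.
Qed.

Lemma J_lin p q k phi psi : supported p q phi -> supported p q psi ->
  J (fun x => k * phi x + psi x) = k * J phi + J psi.
Proof.
(* Nothing orders p and q here, so p is lowered to obtain a nondegenerate interval. *)
move=> sphi spsi; have p'q' : Num.min p q - 1 < q by rewrite ltrBlDr gt_min ltrDl ltr01 orbT.
have p'p : Num.min p q - 1 <= p by rewrite lerBlDr ge_min lerDl ler01.
have {}sphi := supportedW p'p (lexx q) sphi; have {}spsi := supportedW p'p (lexx q) spsi.
have [F dF] := supported_primitive sphi; have [G dG] := supported_primitive spsi.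
rewrite (J_primitive p'q' sphi dF) (J_primitive p'q' spsi dG).
rewrite (@J_primitive _ _ _ (fun x => k * F x + G x) p'q').
- by ring.
- exact: (supportedD (supportedZ k sphi) spsi).
Qed.

Lemma J_rescale p q phi x e : p < q -> 0 < e -> supported p q phi ->
  J (fun y => phi ((y - x) / e)) = e * J phi.
Proof.
move=> pq e0 sphi; have [F dF] := supported_primitive sphi.
have pq' : x + e * p < x + e * q by rewrite ltrD2l ltr_pM2l.
have dG y : is_derive y 1 (fun y => e * F (e^-1 * y + - (x / e))) (phi ((y - x) / e)).
  have := is_derive_scale e (is_derive_affine (dF (e^-1 * y + - (x / e)))).
  rewrite mulrA divff ?gt_eqF// mul1r => H; apply: (is_derive_eq H).
  by congr phi; field; rewrite gt_eqF.
rewrite (J_primitive pq sphi dF) (J_primitive pq' (supported_rescale x e0 sphi) dG).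
have h z : e^-1 * (x + e * z) + - (x / e) = z by field; rewrite gt_eqF.
by rewrite !h mulrBr.
Qed.

Lemma J_reflect p q phi : p < q -> supported p q phi -> J (fun y => phi (- y)) = J phi.
Proof.
move=> pq sphi; have [F dF] := supported_primitive sphi.
have dG y : is_derive y 1 (fun y => -1 * F (-1 * y + 0)) (phi (- y)).
  have := is_derive_scale (-1) (is_derive_affine (dF (-1 * y + 0))).
  by rewrite !mulN1r opprK addr0.
have pq' : - q < - p by rewrite ltrN2.
rewrite (J_primitive pq sphi dF) (J_primitive pq' (supported_reflect sphi) dG).
by rewrite !addr0 !mulN1r !opprK addrC.
Qed.

Lemma J_derive1 p q phi : supported p q phi -> J (derive1 phi) = 0.
Proof.
move=> sphi; pose r := `|p| + `|q| + 1.
have [rp qr] : - r < p /\ q < r.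
  by have := ler_norm (- p); have := ler_norm q; rewrite normrN /r; have := normr_ge0 p; have := normr_ge0 q; split; lra.
have rr : - r < r by rewrite gtrN// /r ltr_wpDl// addr_ge0.
have sphi' := supportedW (ltW rp) (ltW qr) (supported_derive1 sphi).
rewrite (J_primitive rr sphi' (fun x => smooth_is_derive x (proj1 sphi))).
by rewrite (supported_out sphi) ?qr ?orbT// (supported_out sphi) ?rp// subr0.
Qed.

Lemma J_ge0 phi : (forall x, 0 <= phi x) -> 0 <= J phi.
Proof. by move=> H; apply: Rintegral_ge0. Qed.

Lemma J_bound p q phi M : p < q -> supported p q phi ->
  (forall x, p <= x <= q -> `|phi x| <= M) -> `|J phi| <= M * (q - p).
Proof.
move=> pq sphi HM; have [F dF] := supported_primitive sphi.
rewrite (J_primitive pq sphi dF).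
have [|c] := @MVT_segment _ F phi p q (ltW pq) (fun x _ => dF x).
  apply: continuous_subspaceT => x.
  by apply/differentiable_continuous/derivable1_diffP; have [] := dF x.
have pq0 : 0 <= q - p by rewrite subr_ge0 ltW.
by rewrite in_itv /= => /HM Hc ->; rewrite normrM (ger0_norm pq0) ler_wpM2r.
Qed.

Definition plateau (s t w x : R) : R := ramp s w x - ramp t w x.

Lemma smooth_plateau s t w : smooth (plateau s t w).
Proof. exact (smoothB (@smooth_ramp R s w) (@smooth_ramp R t w)). Qed.

Lemma plateau_out s t w x : 0 < w -> s <= t -> (x <= s) || (t + w <= x) -> plateau s t w x = 0.
Proof.
move=> w0 st /orP[xs|tx]; rewrite /plateau.
  by rewrite !ramp_eq0 ?subrr// (le_trans xs).
by rewrite !ramp_eq1 ?subrr// (le_trans _ tx)// lerD2r.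
Qed.

Lemma supported_plateau s t w : 0 < w -> s <= t -> supported s (t + w) (plateau s t w).
Proof.
move=> w0 st; split; first exact: smooth_plateau.
move=> x; apply: contraNT; rewrite negb_and -!ltNge => /orP[h|h]; rewrite plateau_out// (ltW h)//.
by rewrite orbT.
Qed.

Lemma plateau_eq1 s t w x : 0 < w -> s + w <= x <= t -> plateau s t w x = 1.
Proof. by move=> w0 /andP[h1 h2]; rewrite /plateau ramp_eq1// ramp_eq0// subr0. Qed.

Lemma plateau_ge0 s t w x : 0 < w -> s + w <= t -> 0 <= plateau s t w x.
Proof.
move=> w0 st; rewrite /plateau subr_ge0; have [xt|tx] := lerP x t.
  by rewrite (ramp_eq0 (c := t))// ramp_ge0.
by rewrite (ramp_eq1 (c := s)) ?ramp_le1// (le_trans st)// ltW.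
Qed.

(** A primitive does not decrease across either ramp and grows by exactly t - (s + w) over the flat
    part. *)
Lemma J_plateau_gt0 s t w : 0 < w -> s + w < t -> 0 < J (plateau s t w).
Proof.
move=> w0 st; have st' : s <= t by apply: le_trans (ltW st); rewrite lerDl ltW.
have spl := supported_plateau w0 st'.
have [F dF] := supported_primitive spl.
rewrite (J_primitive _ spl dF); last by rewrite (le_lt_trans st')// ltrDl.
have mvt u v : u <= v -> exists2 z, u <= z <= v & F v - F u = plateau s t w z * (v - u).
  move=> uv; have [|z] := @MVT_segment _ F (plateau s t w) u v uv (fun x _ => dF x).
    apply: continuous_subspaceT => x.
    by apply/differentiable_continuous/derivable1_diffP; have [] := dF x.
  by rewrite in_itv /= => ?; exists z.
have [z1 _ h1] := mvt s (s + w) ltac:(lra).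
have [z2 z2b h2] := mvt (s + w) t (ltW st).
have [z3 _ h3] := mvt t (t + w) ltac:(lra).
have e1 : 0 <= F (s + w) - F s by rewrite h1 mulr_ge0 ?plateau_ge0 ?ltW//; lra.
have e3 : 0 <= F (t + w) - F t by rewrite h3 mulr_ge0 ?plateau_ge0 ?ltW//; lra.
rewrite plateau_eq1// mul1r in h2; lra.
Qed.

End TestFunctions.

(** * Distributions on intervals and point values *)

Section Distr.
Context {R : realType}.
Implicit Types (phi psi chi : R -> R) (x y c k p q e : R) (n N : nat) (Omega : set R)
  (g T : (R -> R) -> R).

Definition dbound N phi (M : R) := forall n x, (n <= N)%N -> `|derive1n n phi x| <= M.

Lemma dboundM N phi psi M1 M2 : smooth phi -> smooth psi ->
  dbound N phi M1 -> dbound N psi M2 ->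
  dbound N (fun x => phi x * psi x) (2 ^+ N * M1 * M2).
Proof.
move=> sphi spsi b1 b2 n x nN; apply: derive1nM_bound => // m mN; [exact: b1|exact: b2].
Qed.

Lemma dboundD N phi psi M1 M2 : smooth phi -> smooth psi ->
  dbound N phi M1 -> dbound N psi M2 -> dbound N (fun x => phi x + psi x) (M1 + M2).
Proof.
move=> sphi spsi b1 b2 n x nN; rewrite derive1nD//.
by apply: le_trans (ler_normD _ _) _; apply: lerD; [exact: b1|exact: b2].
Qed.

Lemma dboundZ N k phi M : smooth phi -> dbound N phi M -> dbound N (fun x => k * phi x) (`|k| * M).
Proof.
by move=> sphi b n x nN; rewrite derive1nZ// normrM ler_wpM2l//; exact: b.
Qed.

Lemma dboundW N N' phi M M' : (N' <= N)%N -> M <= M' -> dbound N phi M -> dbound N' phi M'.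
Proof. by move=> NN MM b n x nN; apply: le_trans MM; apply: b; exact: leq_trans NN. Qed.

Lemma dbound_ge0 N phi M : dbound N phi M -> 0 <= M.
Proof. by move=> b; apply: le_trans (b 0%N 0 isT). Qed.

Lemma dbound_rescale N phi x e M : smooth phi -> 0 < e -> dbound N phi M ->
  dbound N (fun y => phi ((y - x) / e)) ((1 + e^-1) ^+ N * M).
Proof.
move=> sphi e0 b n y nN; rewrite derive1n_rescale// normrM normrX ger0_norm ?invr_ge0 ?(ltW e0)//.
apply: ler_pM => //; [by rewrite exprn_ge0// invr_ge0 ltW| |exact: b].
have e1 : 0 <= e^-1 by rewrite invr_ge0 ltW.
apply: (@le_trans _ _ ((1 + e^-1) ^+ n)); first by rewrite lerXn2r ?nnegrE ?addr_ge0// lerDr.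
by rewrite ler_weXn2l// lerDl.
Qed.

(** Stretching a function out (k <= 1) increases none of its derivatives, so its bounds survive a
    change of scale without a factor depending on the scale. *)
Lemma dbound_scale N phi (k c M : R) : smooth phi -> 0 <= k -> k <= 1 -> dbound N phi M ->
  dbound N (fun x => phi (k * x + c)) M.
Proof.
move=> sphi k0 k1 b n x nN; rewrite derive1n_affine// normrM normrX ger0_norm//.
rewrite -[leRHS]mul1r ler_pM// ?exprn_ge0// ?exprn_ile1//; exact: b.
Qed.

Definition lin_itv p q T := forall k phi psi, supported p q phi -> supported p q psi ->
  T (fun x => k * phi x + psi x) = k * T phi + T psi.

Definition bnd_itv p q T (C : R) N := 0 <= C /\ forall phi M,
  supported p q phi -> dbound N phi M -> `|T phi| <= C * M.

(* Membership in the dual of the Frechet space of test functions supported in the interval from [p] to [q]. *)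
Definition cdist p q T := lin_itv p q T /\ exists C N, bnd_itv p q T C N.

Definition distr Omega g := forall p q, (forall x, p <= x <= q -> Omega x) -> cdist p q g.

Lemma distrW Omega Omega' g : Omega' `<=` Omega -> distr Omega g -> distr Omega' g.
Proof. by move=> OO dg p q pq; apply: dg => x /pq /OO. Qed.

Lemma distribution_distr Omega g : Defs.distribution Omega g -> distr Omega g.
Proof.
move=> [lg bg] p q pqO; split.
  move=> k phi psi sphi spsi; apply: lg; exact: supported_test pqO.
have sub : `[p, q]%classic `<=` Omega by move=> x; rewrite /= in_itv /= => /pqO.
have [C [N H]] := bg _ (@segment_compact _ p q) sub.
exists `|C|, N; split=> // phi M sphi bphi.
apply: le_trans (H phi M _ _ _ _) _.
- exact: supported_test sphi pqO.
- by have [] := @supported_test _ p q phi `[p, q] sphi (fun x h => h).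
- exact: dbound_ge0 bphi.
- by move=> n x nN _; exact: bphi.
- by rewrite ler_wpM2r ?ler_norm// (dbound_ge0 bphi).
Qed.

Lemma distr_distributionT g : distr setT g -> Defs.distribution setT g.
Proof.
move=> dg; split.
  move=> k phi psi /testT_supported[p [q [pq sphi]]] /testT_supported[p' [q' [pq' spsi]]].
  have [lg _] := dg (Num.min p p') (Num.max q q') (fun _ _ => I).
  apply: lg.
  - by apply: supportedW sphi; rewrite ?ge_min ?le_max lexx.
  - by apply: supportedW spsi; rewrite ?ge_min ?le_max lexx orbT.
move=> K /compact_bounded [B [_ HB]] _.
have {}HB x : K x -> - (`|B| + 1) <= x <= `|B| + 1.
  by move=> Kx; rewrite -ler_norml; apply: HB => //; rewrite (le_lt_trans (ler_norm _))// ltrDl.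
have [_ [C [N [C0 H]]]] := dg (- (`|B| + 1)) (`|B| + 1) (fun _ _ => I).
exists C, N => phi M [sphi _ _] subK M0 bphi; apply: H.
  split; first exact: sphi.
  by move=> x x0; apply: HB; apply: subK; exact: subset_closure.
move=> n x nN; have [Kx|nKx] := pselect (K x); first exact: bphi.
have [r r0 Hr] := fsupp_notin (fun h => nKx (subK _ h)).
by rewrite (derive1n_eq0 n r0 Hr) normr0.
Qed.

Section Linear.
Variables (p q : R) (T : (R -> R) -> R).
Hypothesis cT : cdist p q T.

Lemma cdist0 : T (fun=> 0) = 0.
Proof.
have [lT _] := cT; have := lT (-1) (fun=> 0) (fun=> 0) (supported0 p q) (supported0 p q).
rewrite (_ : (fun x => _) = (fun=> 0)); first by rewrite mulN1r addNr.
by apply/funext => x; rewrite mulr0 addr0.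
Qed.

Lemma cdistD phi psi : supported p q phi -> supported p q psi ->
  T (fun x => phi x + psi x) = T phi + T psi.
Proof.
have [lT _] := cT; move=> s1 s2; rewrite -[T phi]mul1r -lT//.
by congr T; apply/funext => x; rewrite mul1r.
Qed.

Lemma cdistZ k phi : supported p q phi -> T (fun x => k * phi x) = k * T phi.
Proof.
have [lT _] := cT; move=> s1; rewrite -[RHS]addr0 -cdist0 -lT//; last exact: supported0.
by congr T; apply/funext => x; rewrite addr0.
Qed.

Lemma cdistN phi : supported p q phi -> T (fun x => - phi x) = - T phi.
Proof.
move=> s1; rewrite -mulN1r -cdistZ//.
by congr T; apply/funext => x; rewrite mulN1r.
Qed.

Lemma cdistB phi psi : supported p q phi -> supported p q psi ->
  T (fun x => phi x - psi x) = T phi - T psi.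
Proof. by move=> s1 s2; rewrite cdistD ?cdistN//; exact: supportedN. Qed.

Lemma cdist_sum n (F : nat -> R -> R) : (forall i, (i < n)%N -> supported p q (F i)) ->
  T (fun x => \sum_(i < n) F i x) = \sum_(i < n) T (F i).
Proof.
elim: n => [|n IH] H.
  by rewrite big_ord0 -[RHS]cdist0; congr T; apply/funext => x; rewrite big_ord0.
rewrite big_ord_recr/= -IH; last by move=> i ni; apply: H; exact: ltnW.
rewrite -cdistD; last 2 first.
- by apply: supported_sum => i ni; apply: H; exact: ltnW.
- exact: H.
by congr T; apply/funext => x; rewrite big_ord_recr.
Qed.

End Linear.

Lemma cdist_lin p q k T1 T2 : cdist p q T1 -> cdist p q T2 ->
  cdist p q (fun phi => k * T1 phi + T2 phi).
Proof.
move=> [l1 [C1 [N1 [C10 b1]]]] [l2 [C2 [N2 [C20 b2]]]]; split.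
  by move=> c phi psi s1 s2; rewrite l1// l2//; ring.
exists (`|k| * C1 + C2), (maxn N1 N2); split; first by rewrite addr_ge0// mulr_ge0.
move=> phi M s1 bM; apply: le_trans (ler_normD _ _) _.
rewrite normrM mulrDl -mulrA lerD// ?ler_wpM2l//.
- by apply: b1 => //; apply: dboundW bM; rewrite ?leq_maxl.
- by apply: b2 => //; apply: dboundW bM; rewrite ?leq_maxr.
Qed.

Lemma distr_lin Omega k g1 g2 : distr Omega g1 -> distr Omega g2 ->
  distr Omega (fun phi => k * g1 phi + g2 phi).
Proof. by move=> d1 d2 p q pq; apply: cdist_lin; [exact: d1|exact: d2]. Qed.

Lemma cdist_rescale p q x e g : 0 < e -> cdist (x + e * p) (x + e * q) g ->
  cdist p q (fun phi => g (fun y => phi ((y - x) / e))).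
Proof.
move=> e0 [lg [C [N [C0 bg]]]]; split.
  by move=> k phi psi s1 s2; apply: lg; exact: supported_rescale.
exists (C * (1 + e^-1) ^+ N), N; split.
  by rewrite mulr_ge0// exprn_ge0// addr_ge0// invr_ge0 ltW.
move=> phi M s1 bM; rewrite -mulrA; apply: bg; first exact: supported_rescale.
exact: dbound_rescale (proj1 s1) e0 bM.
Qed.

Lemma cdist_mul p q p' q' chi g : cdist p' q' g ->
  (forall N, exists B, dbound N chi B) -> smooth chi ->
  (forall phi, supported p q phi -> supported p' q' (fun x => chi x * phi x)) ->
  cdist p q (fun phi => g (fun x => chi x * phi x)).
Proof.
move=> [lg [C [N' [C0 bg]]]] bchi schi H; split.
  move=> k phi psi s1 s2; rewrite -lg; [|exact: H|exact: H].
  by congr g; apply/funext => x; ring.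
have [B' bB] := bchi N'; have B0 := dbound_ge0 bB.
exists (C * (2 ^+ N' * B')), N'; split; first by rewrite !mulr_ge0// exprn_ge0.
move=> phi M s1 bM; rewrite -mulrA; apply: bg; first exact: H.
exact: (dboundM schi (proj1 s1) bB bM).
Qed.

Lemma dbound_derive1 N phi M : dbound N.+1 phi M -> dbound N (derive1 phi) M.
Proof. by move=> b n x nN; rewrite -derive1n_Sr; exact: b. Qed.

Definition constd c : (R -> R) -> R := fun phi => c * J phi.

Lemma distr_constd Omega c : distr Omega (constd c).
Proof.
move=> p q _; split.
  by move=> k phi psi s1 s2; rewrite /constd (J_lin _ s1 s2); ring.
exists (`|c| * (`|q - p| + 1)), 0%N; split; first by rewrite mulr_ge0// addr_ge0.
move=> phi M s1 bM; rewrite /constd normrM -mulrA ler_wpM2l//.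
have M0 := dbound_ge0 bM.
have := @J_bound _ p (Num.max q (p + 1)) phi M _ _ (fun x _ => bM 0%N x isT).
move=> /(_ _ _)/le_trans -> //.
- by rewrite lt_max ltrDl ltr01 orbT.
- by apply: supportedW s1; rewrite ?le_max lexx.
rewrite mulrC ler_wpM2r//; case: (leP q (p+1)) => h; last by rewrite ler_wpDr// ler_norm.
by rewrite addrAC subrr add0r lerDr.
Qed.

Lemma rescaledE g x e phi : 0 < e -> rescaled g x e phi = e^-1 * g (fun y => phi ((y - x) / e)).
Proof. by move=> e0; rewrite /rescaled ger0_norm ?ltW. Qed.

Lemma rescaled_reflect g x e phi : rescaled g x e phi = rescaled g x (- e) (fun y => phi (- y)).
Proof.
rewrite /rescaled normrN; congr (_ * g _); apply/funext => y.
by rewrite invrN mulrN opprK.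
Qed.

Lemma point_value_eps g x c p q phi (eta : R) : has_point_value g x c -> supported p q phi ->
  0 < eta -> exists2 d : R, 0 < d & forall e, 0 < e -> e < d ->
    `|rescaled g x e phi - c * J phi| <= eta.
Proof.
move=> H s1 eta0; have /cvgrPdist_le/(_ _ eta0) := H _ (supported_testT s1).
move=> /nbhs_ballP[d /= d0 Hd]; exists d => // e e0 ed; rewrite distrC; apply: Hd.
- by rewrite /ball /= sub0r normrN gtr0_norm.
- by rewrite gt_eqF.
Qed.

(** Negative e reduce to positive ones by reflecting the test function, which does not change its
    integral. *)
Lemma point_value_intro g x c :
  (forall p q phi (eta : R), p < q -> supported p q phi -> 0 < eta ->
     exists2 d : R, 0 < d & forall e, 0 < e -> e < d ->
       `|rescaled g x e phi - c * J phi| <= eta) -> has_point_value g x c.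
Proof.
move=> H phi /testT_supported[p [q [pq s1]]]; apply/cvgrPdist_le => eta eta0.
have [d1 d10 H1] := H _ _ _ _ pq s1 eta0.
have pq' : - q < - p by rewrite ltrN2.
have [d2 d20 H2] := H _ _ _ _ pq' (supported_reflect s1) eta0.
rewrite (J_reflect pq s1) in H2.
apply/nbhs_ballP; exists (Num.min d1 d2) => /=; first by rewrite lt_min d10.
move=> e; rewrite /ball /= sub0r normrN => ed e0.
have := ed; rewrite lt_min => /andP[ed1 ed2]; rewrite distrC.
case: (ltgtP e 0) e0 => [en _|ep _|-> /eqP//].
- rewrite rescaled_reflect; apply: H2; first by rewrite oppr_gt0.
  by rewrite ltr0_norm in ed2.
- by apply: H1 => //; rewrite gtr0_norm in ed1.
Qed.

Lemma left_limit_eps g x c p q phi (eta : R) : left_dist_limit g x c -> supported p q phi ->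
  q < 0 -> 0 < eta -> exists2 d : R, 0 < d & forall e, 0 < e -> e < d ->
    `|rescaled g x e phi - c * J phi| <= eta.
Proof.
move=> H s1 q0 eta0; have tphi : test_function `]-oo, 0[ phi.
  by apply: supported_test s1 _ => y /andP[_ yq]; rewrite /= in_itv/= (le_lt_trans yq).
have /cvgrPdist_le/(_ _ eta0)/nbhs_ballP[d /= d0 Hd] := H _ tphi.
exists d => // e e0 ed; rewrite distrC; apply: Hd => //.
by rewrite /ball /= sub0r normrN gtr0_norm.
Qed.

Lemma left_limit_intro g x c :
  (forall p q phi (eta : R), p < q -> q < 0 -> supported p q phi -> 0 < eta ->
     exists2 d : R, 0 < d & forall e, 0 < e -> e < d ->
       `|rescaled g x e phi - c * J phi| <= eta) -> left_dist_limit g x c.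
Proof.
move=> H phi /test_itvNyo_supported[p [q [pq q0 s1]]]; apply/cvgrPdist_le => eta eta0.
have [d d0 Hd] := H _ _ _ _ pq q0 s1 eta0.
apply/nbhs_ballP; exists d => //= e; rewrite /ball /= sub0r normrN => ed e0.
by rewrite distrC; apply: Hd => //; rewrite gtr0_norm in ed.
Qed.

Lemma point_value_left g x c : has_point_value g x c -> left_dist_limit g x c.
Proof.
by move=> H; apply: left_limit_intro => p q phi eta pq q0 s1; exact: point_value_eps s1.
Qed.

Lemma supported_rescale_in p q phi (r : R) : 0 < r -> supported p q phi ->
  exists2 d : R, 0 < d & forall x e, 0 < e -> e < d ->
    supported (x - r) (x + r) (fun y => phi ((y - x) / e)).
Proof.
move=> r0 s1; exists (r / (`|p| + `|q| + 1)) => [|x e e0 ed].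
  by rewrite divr_gt0// ltr_wpDl// addr_ge0.
have B0 : 0 < `|p| + `|q| + 1 by rewrite ltr_wpDl// addr_ge0.
rewrite ltr_pdivlMr// in ed.
apply: supportedW (supported_rescale x e0 s1); rewrite lerD2l.
- rewrite lerNl -mulrN (le_trans _ (ltW ed))// ler_pM2l// (le_trans (ler_norm _))// normrN.
  by have := normr_ge0 q; lra.
- rewrite (le_trans _ (ltW ed))// ler_pM2l// (le_trans (ler_norm _))//.
  by have := normr_ge0 p; lra.
Qed.

Lemma point_value_local g1 g2 x (r c : R) : 0 < r ->
  (forall phi, supported (x - r) (x + r) phi -> g1 phi = g2 phi) ->
  has_point_value g1 x c -> has_point_value g2 x c.
Proof.
move=> r0 gg H; apply: point_value_intro => p q phi eta pq s1 eta0.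
have [d1 d10 H1] := point_value_eps H s1 eta0.
have [d2 d20 H2] := supported_rescale_in r0 s1.
exists (Num.min d1 d2) => [|e e0]; first by rewrite lt_min d10.
rewrite lt_min => /andP[ed1 ed2].
have -> : rescaled g2 x e phi = rescaled g1 x e phi by rewrite !rescaledE// gg//; exact: H2.
exact: H1.
Qed.

Lemma point_value_lin g1 g2 x k c1 c2 : has_point_value g1 x c1 -> has_point_value g2 x c2 ->
  has_point_value (fun phi => k * g1 phi + g2 phi) x (k * c1 + c2).
Proof.
move=> H1 H2 phi tphi.
rewrite (_ : (fun _ => _) = fun e => k * rescaled g1 x e phi + rescaled g2 x e phi).
  rewrite mulrDl -mulrA; apply: cvgD; last exact: H2.
  by apply: cvgMr; exact: H1.
by apply/funext => e; rewrite /rescaled; ring.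
Qed.

Lemma left_limit_lin g1 g2 x k c1 c2 : left_dist_limit g1 x c1 -> left_dist_limit g2 x c2 ->
  left_dist_limit (fun phi => k * g1 phi + g2 phi) x (k * c1 + c2).
Proof.
move=> H1 H2 phi tphi.
rewrite (_ : (fun _ => _) = fun e => k * rescaled g1 x e phi + rescaled g2 x e phi).
  rewrite mulrDl -mulrA; apply: cvgD; last exact: H2.
  by apply: cvgMr; exact: H1.
by apply/funext => e; rewrite /rescaled; ring.
Qed.

Lemma point_value_constd x c : has_point_value (constd c) x c.
Proof.
apply: point_value_intro => p q phi eta pq s1 eta0; exists 1 => // e e0 _.
rewrite rescaledE// /constd (J_rescale _ pq e0 s1) mulrCA mulKf ?gt_eqF//.
by rewrite subrr normr0 ltW.
Qed.

Lemma left_limit_unique g x c1 c2 : left_dist_limit g x c1 -> left_dist_limit g x c2 -> c1 = c2.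
Proof.
move=> H1 H2; pose psi := plateau (-4) (-2) (1 : R).
have s1 : supported (-4) (-1) psi.
  have := @supported_plateau R (-4) (-2) 1 ltr01 ltac:(lra).
  by have -> : -2 + 1 = -1 :> R by lra.
have J0 : 0 < J psi by apply: J_plateau_gt0; lra.
have tpsi : test_function `]-oo, 0[ psi.
  by apply: supported_test s1 _ => y /andP[_ yq]; rewrite /= in_itv/=; lra.
have E : c1 * J psi = c2 * J psi.
  by apply: (cvg_unique _ (H1 _ tpsi) (H2 _ tpsi)); exact: norm_hausdorff.
exact: (mulIf (lt0r_neq0 J0) E).
Qed.

Lemma point_value_unique g x c1 c2 : has_point_value g x c1 -> has_point_value g x c2 -> c1 = c2.
Proof. by move=> /point_value_left H1 /point_value_left; exact: left_limit_unique. Qed.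

End Distr.

(** * The Banach-Steinhaus theorem *)

Section BanachSteinhaus.
Context {R : realType}.
Implicit Types (phi psi chi : R -> R) (x y c p q e : R) (k n N : nat)
  (g T : (R -> R) -> R).

(** Completeness in the form used below: the intervals [u i - e i, u i + e i] meet pairwise, so the
    supremum of their left ends lies in all of them. The index set is arbitrary, since the lemma
    also serves families indexed by pairs. *)
Lemma squeeze_sup (I : Type) (P : set I) (u e : I -> R) : (exists i, P i) ->
  (forall i j, P i -> P j -> u i - e i <= u j + e j) ->
  exists l, forall i, P i -> `|l - u i| <= e i.
Proof.
move=> [i0 Pi0] H; pose A := [set u i - e i | i in P].
have A0 : A !=set0 by exists (u i0 - e i0); exists i0.
exists (sup A) => i Pi.
have ubA j : P j -> ubound A (u j + e j) by move=> Pj _ [i' Pi' <-]; exact: H.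
have hs : has_sup A by split=> //; exists (u i0 + e i0); exact: ubA.
have h1 : u i - e i <= sup A by apply: ub_le_sup; [exact: hs.2|exists i].
have h2 : sup A <= u i + e i by apply: ge_sup => //; exact: ubA.
by rewrite ler_norml; apply/andP; split; lra.
Qed.

Lemma half_small (C e : R) : 0 < e -> exists k, C * 2^-1 ^+ k <= e.
Proof.
move=> e0; have [k Hk] : exists k : nat, `|C| / e < k%:R.
  by exists (Num.truncn (`|C| / e)).+1; rewrite truncnS_gt.
exists k; rewrite exprVn ler_pdivrMr ?exprn_gt0// (le_trans (ler_norm _))//.
rewrite ltr_pdivrMr// mulrC in Hk; rewrite (le_trans (ltW Hk))// ler_pM2l//.
by rewrite -natrX ler_nat ltnW// ltn_expl.
Qed.

Lemma halfX_gt0 n : 0 < 2^-1 ^+ n :> R.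
Proof. by rewrite exprn_gt0// invr_gt0. Qed.

Lemma half_le i j : (i <= j)%N -> 2^-1 ^+ j <= 2^-1 ^+ i :> R.
Proof. by move=> ij; apply: ler_wiXn2l => //; lra. Qed.

Lemma le_half_approx (a b c : R) k : (forall j, (k <= j)%N -> a <= b + c * 2^-1 ^+ j) -> a <= b.
Proof.
move=> H; apply/ler_addgt0Pr => e e0; have [j Hj] := half_small `|c| e0.
apply: le_trans (H (maxn k j) (leq_maxl _ _)) _; rewrite lerD2l (le_trans _ Hj)//.
apply: (@le_trans _ _ (`|c| * 2^-1 ^+ maxn k j)).
  by rewrite ler_wpM2r ?ler_norm// ltW// halfX_gt0.
by rewrite ler_wpM2l// half_le// leq_maxr.
Qed.

Lemma half_telescope (u : nat -> R) c k : 0 <= c ->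
  (forall j, (k <= j)%N -> `|u j.+1 - u j| <= c * 2^-1 ^+ j) ->
  forall j, (k <= j)%N -> `|u j - u k| <= 2 * c * 2^-1 ^+ k.
Proof.
move=> c0 H j kj; suff : `|u j - u k| <= 2 * c * 2^-1 ^+ k - 2 * c * 2^-1 ^+ j.
  move/le_trans; apply; rewrite gerBl mulr_ge0 ?mulr_ge0// ltW// halfX_gt0.
rewrite -(subnKC kj); elim: (j - k)%N => [|m IH]; first by rewrite addn0 !subrr normr0.
have := H (k + m)%N (leq_addr _ _); rewrite addnS exprS => h.
have := ler_normD (u (k + m).+1 - u (k + m)%N) (u (k + m)%N - u k).
rewrite addrA subrK => /le_trans; apply.
have := halfX_gt0 (k + m); lra.
Qed.

Lemma MVT_eq phi x y : smooth phi -> exists2 z, Num.min x y <= z <= Num.max x y &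
  phi y - phi x = derive1 phi z * (y - x).
Proof.
move=> sphi; have mvt u v : u <= v -> exists2 z, u <= z <= v & phi v - phi u = derive1 phi z * (v - u).
  move=> uv; have [|z] := @MVT_segment _ phi (derive1 phi) u v uv (fun z _ => smooth_is_derive z sphi).
    by apply: continuous_subspaceT; exact: smooth_continuous.
  by rewrite in_itv /= => ? ?; exists z.
have [xy|yx] := orP (le_total x y).
  have [z /andP[z1 z2] zE] := mvt x y xy; exists z => //.
  by rewrite ge_min z1 le_max z2 orbT.
have [z /andP[z1 z2] zE] := mvt y x yx; exists z; last by rewrite -opprB zE -mulrN opprB.
by rewrite ge_min z1 le_max z2 orbT.
Qed.

Lemma taylor1 phi x : smooth phi -> exists2 M : R, 0 < M & forall h : R, `|h| <= 1 ->
  `|phi (x + h) - phi x - derive1 phi x * h| <= M * `|h| * `|h|.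
Proof.
move=> sphi; have [M M0 HM] := smooth_bounded 2 (x - 1) (x + 1) sphi.
exists M => // h; rewrite ler_norml => /andP[h1 h2].
have [z zx ->] := MVT_eq x (x + h) sphi.
have [zx1 zh] : x - 1 <= z <= x + 1 /\ `|z - x| <= `|h|.
  move: zx; rewrite ge_min le_max => /andP[/orP[z1|z1] /orP[z2|z2]].
  - have -> : z = x by lra.
    by rewrite subrr normr0; split=> //; lra.
  - split; first lra.
    rewrite ger0_norm; last lra.
    rewrite ger0_norm; lra.
  - split; first lra.
    rewrite ler0_norm; last lra.
    rewrite ler0_norm; lra.
  - have -> : z = x + h by lra.
    by rewrite addrAC subrr add0r; split=> //; lra.
rewrite addrAC subrr add0r -mulrBl normrM ler_wpM2r//.
apply: le_trans (@MVT_bound R (derive1 phi) x z M (smooth_derive1 sphi) _) _; last by rewrite ler_wpM2l// ltW.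
move=> w wz; rewrite (_ : derive1 (derive1 phi) = derive1n 2 phi)//; apply: HM => //.
by move: wz; rewrite ge_min le_max => /andP[/orP[w1|w1] /orP[w2|w2]]; lra.
Qed.

(** Completeness of the space of smooth functions. Order n is controlled only from stage n on, which
    is all that a diagonal construction provides. *)
Lemma smooth_limit (s : nat -> R -> R) : (forall k, smooth (s k)) ->
  (forall n k x, (n <= k)%N -> `|derive1n n (s k.+1) x - derive1n n (s k) x| <= 2^-1 ^+ k) ->
  exists2 phi, smooth phi & forall n k x, (n <= k)%N ->
    `|derive1n n phi x - derive1n n (s k) x| <= 2 * 2^-1 ^+ k.
Proof.
move=> ss Hs.
have tele n k x j : (n <= k)%N -> (k <= j)%N ->
    `|derive1n n (s j) x - derive1n n (s k) x| <= 2 * 2^-1 ^+ k.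
  move=> nk kj; have := @half_telescope (fun j => derive1n n (s j) x) 1 k ler01 _ j kj.
  rewrite mulr1; apply => i ki; rewrite mul1r; apply: Hs; exact: leq_trans ki.
have /choice[G HG] : forall nx : nat * R, exists l, forall k, (nx.1 <= k)%N ->
    `|l - derive1n nx.1 (s k) nx.2| <= 2 * 2^-1 ^+ k.
  move=> [n x] /=; apply: (@squeeze_sup nat (fun k => (n <= k)%N) (fun k => derive1n n (s k) x)).
    by exists n => /=.
  move=> j k /= nj nk; have hj := halfX_gt0 j; have hk := halfX_gt0 k.
  have [jk|/ltnW kj] := leqP j k.
    by have := tele n j x k nj jk; rewrite ler_norml => /andP[]; lra.
  by have := tele n k x j nk kj; rewrite ler_norml => /andP[]; lra.
pose H n x := G (n, x).
have HH n x k : (n <= k)%N -> `|H n x - derive1n n (s k) x| <= 2 * 2^-1 ^+ k by exact: (HG (n, x)).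
have dH n x : is_derive x 1 (H n) (H n.+1 x).
  apply: is_derive_littleo => e e0.
  (* Three errors must add up to at most e |h|: e/2 |h| from Taylor's formula for [s k], and twice 2
     * 2^-k |h| from replacing the limits by [s k]. *)
  have [k0 Hk0] := half_small 8 e0; pose k := maxn k0 n.+1.
  have nk : (n.+1 <= k)%N by rewrite leq_maxr.
  have Hk : 8 * 2^-1 ^+ k <= e.
    apply: le_trans Hk0; rewrite ler_pM2l//.
    by rewrite half_le// leq_maxl.
  have [M M0 HM] := taylor1 x (@smooth_derive1n _ n _ (ss k)).
  exists (Num.min 1 (e / (2 * M))) => [|h]; first by rewrite lt_min ltr01 divr_gt0// mulr_gt0.
  rewrite lt_min => /andP[/ltW h1 he].
  have h0 := normr_ge0 h.
  have A : `|derive1n n (s k) (x + h) - derive1n n (s k) x - derive1n n.+1 (s k) x * h| <= e / 2 * `|h|.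
    rewrite derive1nS; apply: le_trans (HM h h1) _; rewrite ler_wpM2r//.
    by rewrite mulrC -ler_pdivlMr// (le_trans (ltW he))// invfM mulrA.
  (* The mean value theorem for the difference of stages j and k gives a bound proportional to |h|
     and uniform in j; then j tends to infinity. *)
  have B : `|(H n (x + h) - H n x) - (derive1n n (s k) (x + h) - derive1n n (s k) x)| <= 2 * 2^-1 ^+ k * `|h|.
    apply: (@le_half_approx _ _ 4 k) => j kj.
    have nj : (n <= j)%N by apply: leq_trans kj; exact: ltnW.
    have b1 := HH n (x + h) j nj; have b2 := HH n x j nj.
    have sjk : smooth (fun y => derive1n n (s j) y - derive1n n (s k) y).
      by exact: (smoothB (@smooth_derive1n _ n _ (ss j)) (@smooth_derive1n _ n _ (ss k))).
    have b3 : `|(derive1n n (s j) (x + h) - derive1n n (s k) (x + h)) -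
                (derive1n n (s j) x - derive1n n (s k) x)| <= 2 * 2^-1 ^+ k * `|h|.
      have := @MVT_bound R _ x (x + h) (2 * 2^-1 ^+ k) sjk.
      rewrite (addrAC x) subrr add0r; apply => z _.
      rewrite -derive1n1 (derive1nB 1 z (@smooth_derive1n _ n _ (ss j)) (@smooth_derive1n _ n _ (ss k))).
      by rewrite !derive1n1 -!derive1nS; exact: tele.
    move: b1 b2 b3; rewrite !ler_norml => /andP[? ?] /andP[? ?] /andP[? ?].
    by apply/andP; split; lra.
  have C : `|(derive1n n.+1 (s k) x - H n.+1 x) * h| <= 2 * 2^-1 ^+ k * `|h|.
    by rewrite normrM distrC ler_wpM2r//; exact: HH.
  have D : 4 * 2^-1 ^+ k * `|h| <= e / 2 * `|h| by rewrite ler_wpM2r//; lra.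
  move: A B C; rewrite !ler_norml => /andP[? ?] /andP[? ?] /andP[? ?].
  by apply/andP; split; lra.
have dHn n m : derive1n n (H m) = H (n + m)%N.
  elim: n m => [//|n IH] m; rewrite derive1n_Sr addSnnS -IH; congr (derive1n n _).
  by apply/funext => x; apply: derive1_val; exact: dH.
exists (H 0%N).
  apply/smoothP => n; elim: n (0%N) => [|n IH] m.
    by move=> [|//] x _; have [] := dH m x.
  exact: CnS (dH m) (IH m.+1).
by move=> n k x nk; rewrite dHn addn0; exact: HH.
Qed.

Lemma dependent_choice_inv (S : Type) (inv : set S) (rel : nat -> S -> S -> Prop) s0 :
  inv s0 -> (forall i s, inv s -> exists2 s', inv s' & rel i s s') ->
  exists st : nat -> S, [/\ st 0%N = s0, forall i, inv (st i) & forall i, rel i (st i) (st i.+1)].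
Proof.
move=> i0 H.
have /choice[f Hf] : forall t : nat * S, exists s', inv t.2 -> inv s' /\ rel t.1 t.2 s'.
  move=> [i s] /=; have [vs|nvs] := pselect (inv s); last by exists s.
  by have [s' ? ?] := H i s vs; exists s'.
pose st := fix st i := if i is j.+1 then f (j, st j) else s0.
have inv_st i : inv (st i) by elim: i => //= i IH; have [] := Hf (i, st i) IH.
by exists st; split=> // i; have [] := Hf (i, st i) (inv_st i).
Qed.

(* Gliding hump.  The sign of each hump is chosen so that [T n] is at least as large on the new partial
   sum as on the hump itself; hence no bound on [T n] at the previous partial sum is needed. *)
Lemma banach_steinhaus p q (T : nat -> (R -> R) -> R) :
  (forall n, cdist p q (T n)) ->
  (forall phi, supported p q phi -> exists M : R, forall n, `|T n phi| <= M) ->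
  exists C N, forall n, bnd_itv p q (T n) C N.
Proof.
move=> cT bT; apply: contrapT => nub.
(* Failure of a uniform bound, normalised: some functional is arbitrarily large on a test function
   that is arbitrarily small in arbitrarily many seminorms. *)
have hump (A : R) N (d : R) : 0 <= A -> 0 < d -> exists n psi,
    [/\ supported p q psi, dbound N psi d & A < `|T n psi|].
  move=> A0 d0; apply: contrapT => H; apply: nub; exists (A / d), N => n.
  split=> [|phi M sphi bphi]; first by rewrite divr_ge0// ltW.
  have M0 := dbound_ge0 bphi; have := M0; rewrite le_eqVlt => /orP[/eqP M0'|{}M0].
    have -> : phi = fun=> 0.
      apply/funext => x; apply/eqP; rewrite -normr_le0 M0'.
      exact: (bphi 0%N x).
    by rewrite (cdist0 (cT n)) normr0 mulr_ge0 ?divr_ge0// ?ltW// -M0'.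
  rewrite leNgt; apply/negP => AM; apply: H; exists n, (fun x => d / M * phi x).
  have dM : 0 < d / M by rewrite divr_gt0.
  split.
  - exact: supportedZ.
  - have := dboundZ (d / M) (proj1 sphi) bphi.
    by rewrite ger0_norm ?(ltW dM)// mulfVK// gt_eqF.
  - rewrite (cdistZ (cT n))// normrM gtr0_norm// mulrC -ltr_pdivrMr//.
    by rewrite invf_div mulrA mulrAC.
(* A state is a partial sum with a constant B and an order P that serve for every functional
   selected so far. The next hump is at most 2^-i / (B + 1) up to order P, so that all later humps
   together change the earlier functionals by a bounded amount. *)
pose inv (s : (R -> R) * R * nat) := supported p q s.1.1 /\ 0 <= s.1.2.
pose rel (i : nat) (s s' : (R -> R) * R * nat) :=
  [/\ s.1.2 <= s'.1.2, (s.2 <= s'.2)%N,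
      dbound (maxn i s.2) (fun x => s'.1.1 x - s.1.1 x) (2^-1 ^+ i / (s.1.2 + 1)) &
      exists n, bnd_itv p q (T n) s'.1.2 s'.2 /\ i.+1%:R < `|T n s'.1.1|].
have [||st [st0 inv_st rel_st]] := @dependent_choice_inv _ inv rel (fun=> 0, 0, 0%N).
- by split=> //=; exact: supported0.
- move=> i [[phi B] P] [/= sphi B0].
  have d0 : 0 < 2^-1 ^+ i / (B + 1) by rewrite divr_gt0 ?halfX_gt0// ltr_wpDl.
  have [n [psi [spsi bpsi Apsi]]] := hump i.+1%:R (maxn i P) _ (ler0n _ _) d0.
  have [_ [C [N [C0 bC]]]] := cT n.
  have [phi' [sphi' bphi' Aphi']] : exists phi', [/\ supported p q phi',
      dbound (maxn i P) (fun x => phi' x - phi x) (2^-1 ^+ i / (B + 1)) &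
      i.+1%:R < `|T n phi'|].
    have E : `|T n psi| <= `|T n (fun x => phi x + psi x)| \/
             `|T n psi| <= `|T n (fun x => phi x - psi x)|.
      rewrite (cdistD (cT n) sphi spsi) (cdistB (cT n) sphi spsi).
      have [h|h] := lerP `|T n psi| `|T n phi + T n psi|; first by left.
      right; rewrite -(ler_pM2l (x := 2))//.
      have := ler_normB (T n phi + T n psi) (T n phi - T n psi).
      have -> : T n phi + T n psi - (T n phi - T n psi) = 2 * T n psi by ring.
      by rewrite normrM ger0_norm//; lra.
    case: E => E.
    - exists (fun x => phi x + psi x); split.
      + exact: supportedD.
      + by rewrite (_ : (fun _ => _) = psi)//; apply/funext => x; rewrite addrAC subrr add0r.
      + exact: lt_le_trans E.
    - exists (fun x => phi x - psi x); split.
      + exact: supportedB.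
      + rewrite (_ : (fun _ => _) = fun x => -1 * psi x); last by apply/funext => x; ring.
        by have := dboundZ (-1) (proj1 spsi) bpsi; rewrite normrN1 mul1r.
      + exact: lt_le_trans E.
  exists (phi', Num.max B C, maxn P N); rewrite /inv /rel /=.
    by rewrite le_max B0.
  split; [by rewrite le_max lexx|exact: leq_maxl|exact: bphi'|].
  exists n; split=> //; split; first by rewrite le_max B0.
  move=> chi M schi bchi; apply: (@le_trans _ _ (C * M)).
    by apply: bC => //; apply: dboundW bchi; rewrite ?leq_maxr.
  by rewrite ler_wpM2r ?(dbound_ge0 bchi)// le_max lexx orbT.
pose s i := (st i).1.1; pose B i := (st i).1.2; pose P i := (st i).2.
have ss k : smooth (s k) by have [[]] := inv_st k.
have sups k : supported p q (s k) by have [] := inv_st k.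
have B0 k : 0 <= B k by have [] := inv_st k.
have Bmono : {homo B : i j / (i <= j)%N >-> i <= j}.
  by apply: homo_leq => [//|//|i]; [exact: le_trans|have [] := rel_st i].
have Pmono : {homo P : i j / (i <= j)%N >-> (i <= j)%N}.
  by apply: homo_leq => [//|//|i]; [exact: leq_trans|have [] := rel_st i].
have step n k x : (n <= maxn k (P k))%N ->
    `|derive1n n (s k.+1) x - derive1n n (s k) x| <= 2^-1 ^+ k / (B k + 1).
  by move=> nk; rewrite -(derive1nB n x (ss k.+1) (ss k)); have [_ _ + _] := rel_st k; apply.
have [|phi sphi Hphi] := smooth_limit ss.
  move=> n k x nk; apply: le_trans (step n k x _) _; first by rewrite leq_max nk.
  have := halfX_gt0 k => h; rewrite ler_pdivrMr ?ltr_wpDl//.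
  by rewrite mulrDr mulr1 lerDr mulr_ge0// ltW.
have supphi : supported p q phi.
  split=> // x; apply: contraNT; rewrite negb_and -!ltNge => out.
  rewrite -normr_le0; apply: (@le_half_approx _ _ 2 0%N) => j _.
  by rewrite add0r; have := Hphi 0%N j x isT; rewrite /= (supported_out (sups j) out) subr0.
have tail i n x : (n <= P i)%N -> `|derive1n n phi x - derive1n n (s i) x| <= 2 * (B i + 1)^-1 * 2^-1 ^+ i.
  move=> nP; apply: (@le_half_approx _ _ 2 (maxn i n)) => j; rewrite geq_max => /andP[ij nj].
  have h1 := Hphi n j x nj.
  have Bi : 0 <= (B i + 1)^-1 by rewrite invr_ge0 addr_ge0.
  have h2 := @half_telescope (fun j => derive1n n (s j) x) _ i Bi _ j ij.
  have {}h2 : `|derive1n n (s j) x - derive1n n (s i) x| <= 2 * (B i + 1)^-1 * 2^-1 ^+ i.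
    apply: h2 => k ik; apply: le_trans (step n k x _) _.
      by rewrite leq_max (leq_trans nP (Pmono _ _ ik)) orbT.
    rewrite mulrC ler_wpM2r ?(ltW (halfX_gt0 _))// lef_pV2 ?posrE ?ltr_wpDl//.
    by rewrite lerD2r Bmono.
  have := ler_normD (derive1n n phi x - derive1n n (s j) x) (derive1n n (s j) x - derive1n n (s i) x).
  by rewrite addrA subrK; lra.
have [M HM] := bT _ supphi.
have [i Hi] : exists i : nat, M < i%:R.
  by exists (Num.truncn M).+1; rewrite truncnS_gt.
have [_ _ _ [n [[_ bn] Tn]]] := rel_st i.
(* With B taken at stage i + 1, what is added later contributes at most B * 2 / (B + 1) * 2^-(i + 1)
   <= 1. As [T n] exceeds i + 1 on the partial sum, it exceeds i > M on phi. *)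
have : `|T n (fun x => phi x - s i.+1 x)| <= 1.
  apply: le_trans (bn _ (2 * (B i.+1 + 1)^-1 * 2^-1 ^+ i.+1) _ _) _.
  - exact: supportedB.
  - by move=> m x mP; rewrite (derive1nB m x sphi (ss i.+1)); exact: tail.
  - have B1 : 0 < B i.+1 + 1 by rewrite ltr_wpDl.
    rewrite -/(B i.+1) exprS (mulrC 2) -!mulrA (mulrA 2) mulfV// mul1r.
    have hi : 2^-1 ^+ i <= 1 :> R by have := half_le (leq0n i); rewrite expr0.
    apply: (@le_trans _ _ (B i.+1 * (B i.+1 + 1)^-1)).
      by rewrite ler_wpM2l// ler_piMr// invr_ge0 ltW.
    by rewrite ler_pdivrMr// mul1r lerDl.
rewrite (cdistB (cT n) supphi (sups _)) => h.
have := HM n; have := ler_normB (T n phi) (T n phi - T n (s i.+1)).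
have -> : T n phi - (T n phi - T n (s i.+1)) = T n (s i.+1) by ring.
by move: Tn; rewrite -/(s i.+1) -natr1; lra.
Qed.

End BanachSteinhaus.

(** * Distributions with nonnegative point values *)

Section LowerBound.
Context {R : realType}.
Implicit Types (phi psi chi : R -> R) (x y c p q e : R) (k n N : nat)
  (g T : (R -> R) -> R).

(** At the supremum of the points reached, the local hypothesis both attains that point and goes
    past it. A step is anchored at some t between t1 and t2, ends included, because a point value at
    t controls both sides of t. *)
Lemma cousin_ind p q (P : R -> Prop) : p <= q -> P p ->
  (forall t, p <= t <= q -> exists2 r : R, 0 < r &
     forall t1 t2, p <= t1 -> t1 <= t -> t <= t2 -> t2 <= q -> t - r < t1 -> t2 < t + r ->
       P t1 -> P t2) -> P q.
Proof.
move=> pq Pp H; pose S := [set t | p <= t <= q /\ P t].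
have S0 : S !=set0 by exists p; split=> //; rewrite lexx.
have ubS : ubound S q by move=> t [/andP[]].
have hS : has_sup S by split=> //; exists q.
have supq : sup S <= q by apply: ge_sup.
have psup : p <= sup S by apply: ub_le_sup; [exact: hS.2|split=> //; rewrite lexx].
have [|r r0 Hr] := H (sup S); first by rewrite psup.
have [t1 [/andP[pt1 t1q] Pt1] st1] := sup_adherent r0 hS.
have t1s : t1 <= sup S by apply: ub_le_sup; [exact: hS.2|split=> //; rewrite pt1].
have Pend t2 : sup S <= t2 -> t2 <= q -> t2 < sup S + r -> P t2.
  by move=> st2 t2q t2r; exact: (Hr t1 t2).
have [sq|] := ltrP (sup S) q; last by move=> qs; apply: Pend => //; lra.
exfalso; pose t2 := Num.min q (sup S + r / 2).
have st2 : sup S < t2 by rewrite /t2 lt_min sq/=; lra.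
have : t2 <= sup S.
  apply: ub_le_sup; first exact: hS.2.
  split; first by rewrite (le_trans psup (ltW st2)) /t2 ge_min lexx.
  apply: Pend; [exact: ltW|by rewrite /t2 ge_min lexx|].
  by rewrite /t2 gt_min; apply/orP; right; lra.
by rewrite leNgt st2.
Qed.

Lemma ramp_diff c1 w1 c2 w2 : 0 < w1 -> 0 < w2 -> c1 + w1 <= c2 ->
  [/\ smooth (fun x => ramp c1 w1 x - ramp c2 w2 x),
      supported c1 (c2 + w2) (fun x => ramp c1 w1 x - ramp c2 w2 x),
      forall x, 0 <= ramp c1 w1 x - ramp c2 w2 x & forall x, ramp c1 w1 x - ramp c2 w2 x <= 1].
Proof.
move=> w10 w20 c12.
have s : smooth (fun x => ramp c1 w1 x - ramp c2 w2 x).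
  exact (smoothB (@smooth_ramp R c1 w1) (@smooth_ramp R c2 w2)).
split; first exact: s.
- split; first exact: s.
  move=> x; apply: contraNT; rewrite negb_and -!ltNge => /orP[h|h].
    by rewrite !ramp_eq0 ?subrr//; lra.
  by rewrite !ramp_eq1 ?subrr//; lra.
- move=> x; rewrite subr_ge0; have [h|h] := lerP x c2.
    by rewrite (ramp_eq0 (c := c2))// ramp_ge0.
  by rewrite (ramp_eq1 (c := c1)) ?ramp_le1//; lra.
- by move=> x; rewrite lerBlDr (le_trans (ramp_le1 _ _ _))// lerDl ramp_ge0.
Qed.

Lemma ramp_rescale c w t e x : 0 < w -> 0 < e -> ramp c w ((x - t) / e) = ramp (t + c * e) (w * e) x.
Proof. by move=> w0 e0; rewrite /ramp; congr step; field; rewrite !gt_eqF. Qed.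

Lemma smooth_shift phi c : smooth phi -> smooth (fun x => phi (x + c)).
Proof.
move=> sphi; have := smooth_affine (k := 1) (c := c) sphi.
by congr smooth; apply/funext => y; rewrite mul1r.
Qed.

(** A weak form of g >= - C dx, with length times maximum in place of the integral of psi. This is
    what summation over a grid yields, and it suffices because it is applied only to error terms. *)
Definition lower_bounded s t g (C : R) := forall p q psi (B : R), s < p -> p < q -> q < t ->
  supported p q psi -> (forall x, 0 <= psi x <= B) -> 0 < B -> - (C * (q - p) * B) <= g psi.

(** Near x the function phi is almost constant. Removing the multiple phi x - M1 e of the bump
    leaves a nonnegative function of size at most 2 M1 e, whose pairing is bounded below through C;
    the multiple itself is handled by the point value c >= 0. *)
Lemma point_value_lower s t g (C M1 d c : R) phi Psi x : 0 < C -> distr `]s, t[ g ->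
  lower_bounded s t g C -> smooth phi -> (forall y, 0 <= phi y) -> 0 < M1 ->
  (forall y, `|derive1 phi y| <= M1) -> 0 < d -> s < x < t -> 0 <= c -> has_point_value g x c ->
  supported (-1) 1 Psi -> (forall y, 0 <= Psi y <= 1) ->
  exists2 r : R, 0 < r & forall e, 0 < e -> e < r ->
    - (d / 2 * e) <= g (fun y => phi y * Psi ((y - x) / e)).
Proof.
move=> C0 dg LB sm phi0 M10 dphiM d0 /andP[sx xt] c0 pvx sPsi Psi01.
have f0 : 0 < phi x + 1 by rewrite ltr_wpDl.
have eta0 : 0 < d / (6 * (phi x + 1)) by rewrite divr_gt0// mulr_gt0.
set eta := d / (6 * (phi x + 1)) in eta0.
have etaE : eta * (phi x + 1) = d / 6 by rewrite /eta; field; lra.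
have [d1 d10 Hd1] := point_value_eps pvx sPsi eta0.
have JP : 0 <= J Psi by apply: J_ge0 => y; have /andP[] := Psi01 y.
pose C2 := c * J Psi + eta.
have C20 : 0 < C2 by rewrite /C2 ltr_wpDl// mulr_ge0.
(* Collects the terms of order e^2: 4 C M1 from the remainder and M1 C2 from the upper bound C2 e
   for the bump. Small e make them at most d/3 * e; the choice of [eta] accounts for the remaining
   d/6 * e. *)
pose D := 4 * C * M1 + M1 * C2.
have D0 : 0 < D by rewrite /D addr_gt0// !mulr_gt0.
exists (Num.min (Num.min d1 (d / (3 * D))) (Num.min (x - s) (t - x))).
  by rewrite !lt_min d10 divr_gt0 ?mulr_gt0// !subr_gt0 sx xt.
move=> e e0; rewrite !lt_min => /andP[/andP[ed1 eD] /andP[es et]].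
have sPe := supported_rescale x e0 sPsi.
rewrite mulrN1 mulr1 in sPe.
have cge : cdist (x - e) (x + e) g by apply: dg => y /andP[? ?]; rewrite /= in_itv/=; lra.
set Pe := fun y => Psi ((y - x) / e) in sPe *.
have gPe : `|g Pe - c * J Psi * e| <= eta * e.
  have := Hd1 e e0 ed1; rewrite rescaledE// -(ler_pM2r (x := e))// => H.
  apply: le_trans H.
  have -> : g Pe - c * J Psi * e = (e^-1 * g Pe - c * J Psi) * e by field; rewrite gt_eqF.
  by rewrite normrM (gtr0_norm e0).
have s1 : supported (x - e) (x + e) (fun y => (phi y + (M1 * e - phi x)) * Pe y).
  by apply: (supportedMl _ sPe); exact (smoothD sm (@smooth_cst R (M1 * e - phi x))).
have -> : (fun y => phi y * Psi ((y - x) / e)) = fun y =>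
    (phi y + (M1 * e - phi x)) * Pe y + (phi x - M1 * e) * Pe y.
  by apply/funext => y; rewrite /Pe; ring.
rewrite (cdistD cge s1 (supportedZ _ sPe)) (cdistZ cge _ sPe).
have h1 : - (C * (2 * e) * (2 * M1 * e)) <= g (fun y => (phi y + (M1 * e - phi x)) * Pe y).
  have := LB (x - e) (x + e) _ (2 * M1 * e) _ _ _ s1.
  have -> : x + e - (x - e) = 2 * e by ring.
  apply; [lra|lra|lra| |by rewrite !mulr_gt0].
  move=> y; have /andP[P0 P1] := Psi01 ((y - x) / e).
  have [yin|yout] := boolP (x - e <= y <= x + e); last first.
    have -> : Pe y = 0 by apply: (supported_out sPe); move: yout; rewrite negb_and -!ltNge.
    by rewrite mulr0 lexx /= ltW// !mulr_gt0.
  have := @MVT_bound R phi x y M1 sm (fun z _ => dphiM z).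
  have yx : `|y - x| <= e by rewrite ler_norml; move: yin => /andP[? ?]; apply/andP; split; lra.
  move=> /le_trans/(_ (ler_wpM2l (ltW M10) yx)); rewrite ler_norml => /andP[b1 b2].
  have b3 : 0 <= phi y + (M1 * e - phi x) by lra.
  have b4 : phi y + (M1 * e - phi x) <= 2 * M1 * e by lra.
  rewrite mulr_ge0//= (le_trans _ b4)// -[leRHS]mulr1 ler_wpM2l//.
have h2 : - (d / 6 * e) - M1 * C2 * e * e <= (phi x - M1 * e) * g Pe.
  move: gPe; rewrite ler_norml => /andP[g1 g2].
  have cJe : 0 <= c * J Psi * e by rewrite !mulr_ge0// ltW.
  have u1 : - (eta * e) <= g Pe by lra.
  have u2 : g Pe <= C2 * e by rewrite /C2; lra.
  have v1 : phi x * - (eta * e) <= phi x * g Pe by rewrite ler_wpM2l.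
  have v2 : M1 * e * g Pe <= M1 * e * (C2 * e) by rewrite ler_wpM2l// mulr_ge0// ltW.
  have v3 : phi x * eta <= d / 6 by rewrite -etaE; lra.
  have v4 : phi x * eta * e <= d / 6 * e by rewrite ler_wpM2r// ltW.
  by rewrite mulrBl; lra.
have h3 : D * e * e <= d / 3 * e.
  by rewrite ler_pM2r// mulrC -ler_pdivlMr// (le_trans (ltW eD))// invfM mulrA.
by rewrite /D in h3; lra.
Qed.

(* [g + C dx] is a positive measure whose density is at least [C] at each point because of the point
   values.  Real induction on [t1] bounds [g] below on the part of [phi] to the left of [t1]; a step from
   [t1] to [t1 + e] uses the point value at one end, and pays for the two transition zones, of width
   [w0 * e], with the bound [C]. *)
Lemma nonneg_of_lower_bound s t g (C : R) : 0 < C -> distr `]s, t[ g ->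
  lower_bounded s t g C ->
  (forall x, s < x < t -> exists2 c, 0 <= c & has_point_value g x c) ->
  forall p q phi, s < p -> p < q -> q < t -> supported p q phi -> (forall x, 0 <= phi x) ->
    0 <= g phi.
Proof.
move=> C0 dg LB pv p q phi sp pq qt sphi phi0.
have cg : cdist p q g by apply: dg => x /andP[px xq]; rewrite /= in_itv/=; lra.
have sm := proj1 sphi.
have [M1 M10 HM1] := supported_bounded 1 sphi.
have phiM x : phi x <= M1 by rewrite (le_trans (ler_norm _))//; exact: (HM1 0%N).
have dphiM x : `|derive1 phi x| <= M1 by rewrite -derive1n1; exact: HM1.
(* Room to the right of q: the induction ends at q', where the final cutoff equals 1 on the support
   of phi. *)
pose q' := (q + t) / 2.
have qq' : q < q' by rewrite /q'; lra.
have q't : q' < t by rewrite /q'; lra.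
suff main (d : R) : 0 < d -> - (d * (q' - p) + d) <= g phi.
  rewrite leNgt; apply/negP => gn.
  have a0 : 0 < q' - p + 1 by lra.
  have := main (- g phi / (2 * (q' - p + 1))); rewrite divr_gt0 ?oppr_gt0// ?mulr_gt0//.
  move=> /(_ isT); rewrite -[X in - (_ + X)]mulr1 -mulrDr.
  have -> : - g phi / (2 * (q' - p + 1)) * (q' - p + 1) = - g phi / 2 by field; lra.
  by lra.
(* In a step of length e the two transition zones measure about w0 e and 2 w0 e, whence the factor
   3; w0 <= 1/4 keeps them apart. *)
move=> d0; pose w0 := Num.min (4^-1) (d / (6 * C * M1)).
have w00 : 0 < w0 by rewrite lt_min divr_gt0 ?mulr_gt0//; lra.
have w04 : w0 <= 4^-1 by rewrite ge_min lexx.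
have w0d : 3 * w0 * C * M1 <= d / 2.
  have : w0 <= d / (6 * C * M1) by rewrite ge_min lexx orbT.
  by rewrite ler_pdivlMr ?mulr_gt0//; lra.
pose blk t1 e := fun x => phi x * (ramp t1 (w0 * e) x - ramp (t1 + (1 - 2 * w0) * e) (w0 * e) x).
have blk_near x : s < x < t -> exists2 r : R, 0 < r & forall e, 0 < e -> e < r ->
    - (d / 2 * e) <= g (blk x e) /\ - (d / 2 * e) <= g (blk (x - e) e).
  move=> xst.
  have shape2 c1 c2 : -1 <= c1 -> c1 + w0 <= c2 -> c2 + w0 <= 1 -> exists2 r : R, 0 < r &
      forall e, 0 < e -> e < r ->
      - (d / 2 * e) <= g (fun y => phi y * (ramp c1 w0 ((y - x) / e) - ramp c2 w0 ((y - x) / e))).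
    move=> c1a c12 c2b; have [_ sP P0 P1] := ramp_diff w00 w00 c12.
    have [c c0 pvx] := pv x xst.
    apply: (point_value_lower (Psi := fun z => ramp c1 w0 z - ramp c2 w0 z) C0 dg LB sm phi0 M10
      dphiM d0 xst c0 pvx (supportedW c1a c2b sP)).
    by move=> y; rewrite P0 P1.
  have [r1 r10 H1] : exists2 r : R, 0 < r & forall e, 0 < e -> e < r ->
      - (d / 2 * e) <= g (fun y => phi y * (ramp 0 w0 ((y - x) / e) - ramp (1 - 2 * w0) w0 ((y - x) / e))).
    by apply: shape2; clear -w00 w04; lra.
  have [r2 r20 H2] : exists2 r : R, 0 < r & forall e, 0 < e -> e < r ->
      - (d / 2 * e) <= g (fun y => phi y * (ramp (-1) w0 ((y - x) / e) - ramp (- (2 * w0)) w0 ((y - x) / e))).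
    by apply: shape2; clear -w00 w04; lra.
  exists (Num.min r1 r2) => [|e e0]; first by rewrite lt_min r10.
  rewrite lt_min => /andP[er1 er2]; split.
  - have := H1 e e0 er1; congr (_ <= g _); apply/funext => y; rewrite /blk.
    by rewrite !ramp_rescale// mul0r addr0.
  - have := H2 e e0 er2; congr (_ <= g _); apply/funext => y; rewrite /blk !ramp_rescale//.
    by congr (_ * (ramp _ _ _ - ramp _ _ _)); ring.
(* Both the width of the cut at t1 and the loss d' can be made as small as desired, so that the
   losses at successive cuts do not accumulate. *)
pose Q t1 := forall d' : R, 0 < d' -> exists w, [/\ 0 < w, w < d' &
  - (d * (t1 - p) + d') <= g (fun x => phi x * (1 - ramp (t1 - w) w x))].
have srest c w : smooth (fun x => 1 - ramp c w x).
  exact (smoothB (@smooth_cst R 1) (@smooth_ramp R c w)).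
have stepQ t1 e : p <= t1 -> 0 < e -> t1 + e <= q' -> - (d / 2 * e) <= g (blk t1 e) ->
    Q t1 -> Q (t1 + e).
  move=> pt1 e0 eq' Hblk Qt1 d' d'0.
  have CM0 : 0 < C * M1 by rewrite mulr_gt0.
  pose d1 := Num.min (d' / 2) (Num.min (d' / (2 * (C * M1))) (p - s)).
  have d10 : 0 < d1 by rewrite !lt_min !divr_gt0 ?mulr_gt0// subr_gt0.
  have [w1 [w10 w1d Hw1]] := Qt1 d1 d10.
  have d1d : d1 <= d' / 2 by rewrite ge_min lexx.
  have /andP[w1a w1b] : (w1 < d' / (2 * (C * M1))) && (w1 < p - s).
    by move: w1d; rewrite !lt_min => /andP[].
  rewrite ltr_pdivlMr ?mulr_gt0// in w1a.
  have we0 : 0 < w0 * e by rewrite mulr_gt0.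
  have we4 : w0 * e <= 4^-1 * e by rewrite ler_wpM2r// ltW.
  pose w2 := Num.min (w0 * e) d' / 2.
  have m0 : 0 < Num.min (w0 * e) d' by rewrite lt_min we0.
  have ma : Num.min (w0 * e) d' <= w0 * e by rewrite ge_min lexx.
  have mb : Num.min (w0 * e) d' <= d' by rewrite ge_min lexx orbT.
  have w20 : 0 < w2 by rewrite /w2; lra.
  exists w2; split; [exact: w20|by rewrite /w2; lra|].
  have [smA sA A0 A1] := @ramp_diff (t1 - w1) w1 t1 (w0 * e) w10 we0 ltac:(lra).
  have [smD sD D0 D1] := @ramp_diff (t1 + (1 - 2 * w0) * e) (w0 * e) (t1 + e - w2) w2 we0 w20
    ltac:(rewrite /w2; lra).
  have [smB _ _ _] := @ramp_diff t1 (w0 * e) (t1 + (1 - 2 * w0) * e) (w0 * e) we0 we0 ltac:(lra).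
  have -> : (fun x => phi x * (1 - ramp (t1 + e - w2) w2 x)) = fun x =>
      phi x * (1 - ramp (t1 - w1) w1 x) + phi x * (ramp (t1 - w1) w1 x - ramp t1 (w0 * e) x)
      + blk t1 e x + phi x * (ramp (t1 + (1 - 2 * w0) * e) (w0 * e) x - ramp (t1 + e - w2) w2 x).
    by apply/funext => x; rewrite /blk; ring.
  have z1 := supportedMr (srest (t1 - w1) w1) sphi.
  have z2 := supportedMr smA sphi; have z3 := supportedMr smB sphi.
  have z4 := supportedMr smD sphi.
  rewrite (cdistD cg (supportedD (supportedD z1 z2) z3) z4).
  rewrite (cdistD cg (supportedD z1 z2) z3) (cdistD cg z1 z2).
  have hA : - (C * (w1 + w0 * e) * M1) <= g (fun x => phi x * (ramp (t1 - w1) w1 x - ramp t1 (w0 * e) x)).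
    have := LB (t1 - w1) (t1 + w0 * e) _ M1 _ _ _ (supportedMl sm sA).
    have -> : t1 + w0 * e - (t1 - w1) = w1 + w0 * e by ring.
    apply; [by clear -pt1 w1b; lra|by clear -w10 we0; lra|by clear -we4 w04 eq' q't e0; lra| |exact: M10].
    by move=> x; rewrite mulr_ge0//= (le_trans _ (phiM x))// -[leRHS]mulr1 ler_wpM2l.
  have hD : - (C * (2 * (w0 * e)) * M1) <=
      g (fun x => phi x * (ramp (t1 + (1 - 2 * w0) * e) (w0 * e) x - ramp (t1 + e - w2) w2 x)).
    have := LB (t1 + (1 - 2 * w0) * e) (t1 + e - w2 + w2) _ M1 _ _ _ (supportedMl sm sD).
    have -> : t1 + e - w2 + w2 - (t1 + (1 - 2 * w0) * e) = 2 * (w0 * e) by ring.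
    apply; [by clear -pt1 sp we4 e0; lra|by clear -we0; lra|by clear -eq' q't; lra| |exact: M10].
    by move=> x; rewrite mulr_ge0//= (le_trans _ (phiM x))// -[leRHS]mulr1 ler_wpM2l.
  have w0de : 3 * w0 * C * M1 * e <= d / 2 * e by rewrite ler_wpM2r// ltW.
  by rewrite -/(blk t1 e) in Hblk *; lra.
have Qq' : Q q'.
  apply: (@cousin_ind p q' Q); first lra.
  - move=> d' d'0; exists (d' / 2); split; [lra|lra|].
    rewrite (_ : (fun x => _) = fun=> 0).
      by rewrite (cdist0 cg); lra.
    apply/funext => x; have [xp|px] := ltrP x p.
      by rewrite (supported_out sphi) ?mul0r// xp.
    by rewrite ramp_eq1 ?subrr ?mulr0//; lra.
  - move=> x /andP[px xq']; have [|r r0 Hr] := blk_near x; first lra.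
    exists r => // t1 t2 pt1 t1x xt2 t2q' h1 h2 Qt1.
    have Qx : Q x.
      have [E|t1x'] := eqVneq t1 x; first by rewrite -E.
      have e0 : 0 < x - t1 by rewrite subr_gt0 lt_neqAle t1x'.
      have [_ Hb] := Hr (x - t1) e0 ltac:(lra).
      have Ex : t1 + (x - t1) = x by ring.
      have Et : x - (x - t1) = t1 by ring.
      rewrite Et in Hb; rewrite -Ex; apply: stepQ Qt1; [exact: pt1|exact: e0|by rewrite Ex|exact: Hb].
    have [<-//|xt2'] := eqVneq x t2.
    have e0 : 0 < t2 - x by rewrite subr_gt0 lt_neqAle xt2'.
    have [Hb _] := Hr (t2 - x) e0 ltac:(lra).
    have Ex : x + (t2 - x) = t2 by ring.
    by rewrite -Ex; apply: stepQ Qx; [exact: px|exact: e0|rewrite Ex|exact: Hb].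
have [|w [w0' wd Hw]] := Qq' (Num.min d (q' - q)); first by rewrite lt_min d0 subr_gt0.
have md : Num.min d (q' - q) <= d by rewrite ge_min lexx.
have mq : Num.min d (q' - q) <= q' - q by rewrite ge_min lexx orbT.
apply: le_trans (le_trans Hw _); first lra.
rewrite (_ : (fun x => _) = phi)//; apply/funext => x.
have [qx|xq] := ltrP q x; first by rewrite (supported_out sphi) ?mul0r// qx orbT.
by rewrite ramp_eq0 ?subr0 ?mulr1//; lra.
Qed.

End LowerBound.

(** * From nonnegative point values to nonnegative distributions *)

Section Positivity.
Context {R : realType}.
Implicit Types (phi psi chi : R -> R) (x y c p q e : R) (k n N : nat)
  (g T : (R -> R) -> R).

Lemma sum_plateau p h k x :
  \sum_(i < k.+1) plateau (p + i%:R * h - h) (p + i%:R * h) h x =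
  ramp (p - h) h x - ramp (p + k%:R * h) h x.
Proof.
elim: k => [|k IH]; first by rewrite big_ord1 mul0r addr0.
rewrite big_ord_recr/= IH /plateau.
have -> : p + k.+1%:R * h - h = p + k%:R * h by rewrite -natr1; ring.
by rewrite addrA subrK.
Qed.

Lemma plateau_partition p q k x : p < q -> (0 < k)%N -> p <= x <= q ->
  let h := (q - p) / k%:R in
  \sum_(i < k.+1) plateau (p + i%:R * h - h) (p + i%:R * h) h x = 1.
Proof.
move=> pq k0 /andP[px xq] h; have k0' : 0 < k%:R :> R by rewrite ltr0n.
have h0 : 0 < h by rewrite divr_gt0// subr_gt0.
have kh : k%:R * h = q - p by rewrite /h mulrC divfK// gt_eqF.
by rewrite sum_plateau kh ramp_eq1 ?ramp_eq0 ?subr0//; lra.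
Qed.

Lemma partition_decomp p q k phi g : cdist p q g -> p < q -> (0 < k)%N -> supported p q phi ->
  let h := (q - p) / k%:R in
  g phi = \sum_(i < k.+1) g (fun x => plateau (p + i%:R * h - h) (p + i%:R * h) h x * phi x).
Proof.
move=> cg pq k0 sphi h.
pose F i x := plateau (p + i%:R * h - h) (p + i%:R * h) h x * phi x.
have sF i : supported p q (F i) by apply: supportedMl sphi; exact: smooth_plateau.
rewrite -(cdist_sum (F := F) cg (fun i _ => sF i)); congr g; apply/funext => x.
rewrite -mulr_suml; have [xpq|out] := boolP (p <= x <= q).
  by rewrite plateau_partition// mul1r.
by rewrite (supported_out sphi) ?mulr0//; move: out; rewrite negb_and -!ltNge.
Qed.

Lemma grid_node p q k i : p < q -> (i < k.+1)%N ->
  p <= p + i%:R * ((q - p) / k%:R) <= q.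
Proof.
move=> pq; rewrite ltnS => ik; have := ik; rewrite leq_eqVlt => /orP[/eqP ->|ik'].
  have [->|k0] := eqVneq k 0%N; first by rewrite mul0r addr0 lexx ltW.
  by rewrite mulrC divfK ?pnatr_eq0// lerDl subr_ge0 ltW//=; lra.
have k0' : 0 < k%:R :> R by rewrite ltr0n (leq_ltn_trans _ ik').
have qp : 0 < q - p by rewrite subr_gt0.
have h0 : 0 <= i%:R * ((q - p) / k%:R) by rewrite mulr_ge0 ?ler0n// divr_ge0// ltW.
have h1 : i%:R * ((q - p) / k%:R) <= q - p.
  by rewrite mulrA ler_pdivrMr// mulrC ler_pM2l// ler_nat ltnW.
by apply/andP; split; lra.
Qed.

Definition nonneg_near g x (r : R) := forall phi, supported (x - r) (x + r) phi ->
  (forall y, 0 <= phi y) -> 0 <= g phi.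

(** Real induction plays the part of compactness and yields one radius r for the whole interval; a
    partition of unity of mesh at most r then splits phi into pieces supported near single
    points. *)
Lemma nonneg_near_cover p q g : p < q -> cdist p q g ->
  (forall x, p <= x <= q -> exists2 r : R, 0 < r & nonneg_near g x r) ->
  forall phi, supported p q phi -> (forall y, 0 <= phi y) -> 0 <= g phi.
Proof.
move=> pq cg H phi sphi phi0.
have [|||r r0 Hr] := @cousin_ind R p q (fun t => exists2 r : R, 0 < r &
    forall x, p <= x <= t -> nonneg_near g x r); first exact: ltW.
- have [|r r0 Hr] := H p; first by rewrite lexx ltW.
  by exists r => // x /andP[px xp]; rewrite (le_anti (introT andP (conj xp px))).
- move=> t tpq; have [r r0 Hr] := H t tpq; exists (r / 2); first by rewrite divr_gt0.
  move=> t1 t2 pt1 t1t tt2 t2q h1 h2 [r1 r10 Hr1].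
  exists (Num.min r1 (r / 2)) => [|x /andP[px xt2] chi schi chi0].
    by rewrite lt_min r10 divr_gt0.
  have m1 : Num.min r1 (r / 2) <= r1 by rewrite ge_min lexx.
  have m2 : Num.min r1 (r / 2) <= r / 2 by rewrite ge_min lexx orbT.
  have [xt1|t1x] := lerP x t1.
    apply: (Hr1 x) => //; first by rewrite px.
    by apply: supportedW schi; lra.
  by apply: Hr => //; apply: supportedW schi; lra.
have [k [k0 kr]] : exists k : nat, (0 < k)%N /\ (q - p) / k%:R <= r.
  exists (Num.truncn ((q - p) / r)).+1; split=> //.
  have := truncnS_gt ((q - p) / r); rewrite ltr_pdivrMr// => h.
  by rewrite ler_pdivrMr ?ltr0n// mulrC ltW.
have h0 : 0 < (q - p) / k%:R by rewrite divr_gt0 ?ltr0n// subr_gt0.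
rewrite (partition_decomp cg pq k0 sphi); apply: sumr_ge0 => i _.
set h := (q - p) / k%:R in kr h0 *.
apply: (Hr (p + i%:R * h)); first exact: grid_node.
- have s1 : supported (p + i%:R * h - h) (p + i%:R * h + h) (plateau (p + i%:R * h - h) (p + i%:R * h) h).
    by apply: supported_plateau => //; lra.
  apply: (@supportedW _ (p + i%:R * h - h) (p + i%:R * h + h)); [lra|lra|].
  by apply: supportedMr s1; exact: (proj1 sphi).
- by move=> y; rewrite mulr_ge0// plateau_ge0//; lra.
Qed.

(** Baire's theorem on the part of K in a closed ball, by nested balls that avoid one [A n] after
    another. The conclusion is density in a portion of K, so that no [A n] has to be closed. *)
Lemma baire_local (K : set R) (A : nat -> set R) x0 (r0 : R) : K x0 -> 0 < r0 ->
  (forall x, `|x - x0| <= r0 -> (forall e : R, 0 < e -> exists2 y, K y & `|y - x| < e) -> K x) ->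
  (forall x, K x -> `|x - x0| <= r0 -> exists n, A n x) ->
  exists n x1 (r1 : R), [/\ K x1, 0 < r1, `|x1 - x0| + r1 <= r0 &
    forall y (r : R), K y -> 0 < r -> `|y - x1| + r <= r1 -> exists z, [/\ K z, `|z - y| < r & A n z]].
Proof.
move=> Kx0 r00 clK HA; apply: contrapT => nD.
pose inv (s : R * R) := [/\ K s.1, 0 < s.2 & `|s.1 - x0| + s.2 <= r0].
pose rel (n : nat) (s s' : R * R) := [/\ `|s'.1 - s.1| + s'.2 <= s.2, s'.2 <= 2^-1 ^+ n &
   forall z, K z -> `|z - s'.1| <= s'.2 -> ~ A n z].
have [||st [st0 inv_st rel_st]] := @dependent_choice_inv _ inv rel (x0, r0).
- by split=> //=; rewrite subrr normr0 add0r.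
- move=> n [x1 r1] [/= Kx1 r10 x1r].
  have [y [r [Ky r0' yr Hyr]]] : exists y r, [/\ K y, 0 < r, `|y - x1| + r <= r1 &
      forall z, K z -> `|z - y| < r -> ~ A n z].
    apply: contrapT => H; apply: nD; exists n, x1, r1; split=> // y r Ky r0' yr.
    apply: contrapT => H'; apply: H; exists y, r; split=> // z Kz zy Az.
    by apply: H'; exists z.
  have hn := @halfX_gt0 R n.
  have m0 : 0 < Num.min r (2^-1 ^+ n) by rewrite lt_min r0'.
  have m1 : Num.min r (2^-1 ^+ n) <= r by rewrite ge_min lexx.
  have m2 : Num.min r (2^-1 ^+ n) <= 2^-1 ^+ n by rewrite ge_min lexx orbT.
  exists (y, Num.min r (2^-1 ^+ n) / 2); rewrite /inv /rel /=.
    split=> //; first by rewrite divr_gt0.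
    have := ler_normD (y - x1) (x1 - x0); rewrite addrA subrK; lra.
  split; [lra|lra|] => z Kz zy; apply: Hyr => //; lra.
pose u n := (st n).1; pose r n := (st n).2.
have r_gt0 n : 0 < r n by have [] := inv_st n.
have nest n m : (n <= m)%N -> `|u m - u n| + r m <= r n.
  move=> /subnKC <-; elim: (m - n)%N => [|j IH]; first by rewrite addn0 subrr normr0 add0r.
  have [h1 _ _] := rel_st (n + j)%N; rewrite -/(u _) -/(u (n + j).+1) -/(r _) -/(r (n + j).+1) in h1.
  rewrite addnS; have := ler_normD (u (n + j).+1 - u (n + j)%N) (u (n + j)%N - u n).
  rewrite addrA subrK; lra.
have [x Hx] : exists x, forall n, True -> `|x - u n| <= r n.
  apply: (@squeeze_sup R nat (fun=> True) u r); first by exists 0%N.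
  move=> i j _ _; have ri := r_gt0 i; have rj := r_gt0 j.
  have [ij|/ltnW ji] := leqP i j.
    by have := nest _ _ ij; have := ler_norm (u i - u j); rewrite distrC; lra.
  by have := nest _ _ ji; have := ler_norm (u i - u j); lra.
have xx0 : `|x - x0| <= r0 by have := Hx 0%N I; rewrite /u /r st0.
have Kx : K x.
  apply: clK => // e e0; have [n Hn] := half_small 2 e0.
  exists (u n.+1); first by have [] := inv_st n.+1.
  rewrite distrC (le_lt_trans (Hx _ I))//.
  have [_ h2 _] := rel_st n; have := @halfX_gt0 R n; rewrite /r; lra.
have [n An] := HA x Kx xx0.
by have [_ _ H] := rel_st n; exact: H Kx (Hx n.+1 I) An.
Qed.

Lemma tail_bounded (u : nat -> R) n0 (B : R) : (forall n, (n0 <= n)%N -> `|u n| <= B) ->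
  exists M : R, forall n, `|u n| <= M.
Proof.
move=> H; exists (\sum_(i < n0) `|u i| + `|B|) => n; have [nn|nn] := leqP n0 n.
  by apply: le_trans (H n nn) _; rewrite (le_trans (ler_norm B))// lerDr sumr_ge0.
rewrite (bigD1 (Ordinal nn)) //= -addrA lerDl addr_ge0// sumr_ge0//.
Qed.

Lemma inv_natS_small (d : R) : 0 < d -> exists n0 : nat, forall n, (n0 <= n)%N -> n.+1%:R^-1 < d.
Proof.
move=> d0; exists (Num.truncn d^-1).+1 => n n0n.
rewrite -[ltRHS]invrK ltf_pV2 ?posrE ?ltr0n ?invr_gt0//.
by apply: lt_trans (truncnS_gt _) _; rewrite ltr_nat ltnS.
Qed.

(** Banach-Steinhaus speaks of sequences. If no constants work, then C = N = n and d' = 1/(n + 1)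
    fail at some e_n < 1/(n + 1), and the functionals rescaled by these e_n contradict the uniform
    bound at a large index. *)
Lemma rescaled_bounded g x p q (d : R) : 0 < d ->
  (forall e, 0 < e -> e < d -> cdist (x + e * p) (x + e * q) g) ->
  (forall phi, supported p q phi -> exists (B d' : R), 0 < d' /\
     forall e, 0 < e -> e < d' -> `|e^-1 * g (fun y => phi ((y - x) / e))| <= B) ->
  exists (C : R) N (d' : R), [/\ 0 <= C, 0 < d' & forall e phi M, 0 < e -> e < d' ->
     supported p q phi -> dbound N phi M -> `|g (fun y => phi ((y - x) / e))| <= C * e * M].
Proof.
move=> d0 cg bg; apply: contrapT => H.
have /choice[v Hv] : forall n : nat, exists v : R * (R -> R) * R, [/\ 0 < v.1.1, v.1.1 < n.+1%:R^-1,
    supported p q v.1.2, dbound n v.1.2 v.2 &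
    n%:R * v.1.1 * v.2 < `|g (fun y => v.1.2 ((y - x) / v.1.1))|].
  move=> n; apply: contrapT => H'; apply: H; exists n%:R, n, n.+1%:R^-1; split=> //.
  move=> e phi M e0 en sphi bphi.
  by rewrite leNgt; apply/negP => lt; apply: H'; exists (e, phi, M).
have small (d' : R) : 0 < d' -> exists n0 : nat, forall n, (n0 <= n)%N -> (v n).1.1 < d'.
  move=> /inv_natS_small[n0 Hn0]; exists n0 => n /Hn0; apply: lt_trans.
  by have [_ + _ _ _] := Hv n.
have [n0 Hn0] := small d d0.
pose T m phi := (v (n0 + m)%N).1.1^-1 * g (fun y => phi ((y - x) / (v (n0 + m)%N).1.1)).
have cT m : cdist p q (T m).
  have [e0 _ _ _ _] := Hv (n0 + m)%N; have ed := Hn0 (n0 + m)%N (leq_addr _ _).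
  have c1 := cdist_rescale e0 (cg _ e0 ed).
  have -> : T m = fun phi => (v (n0 + m)%N).1.1^-1 *
      g (fun y => phi ((y - x) / (v (n0 + m)%N).1.1)) + constd 0 phi.
    by apply/funext => phi; rewrite /constd mul0r addr0.
  exact: (cdist_lin _ c1 (@distr_constd R setT 0 p q (fun _ _ => I))).
have [|C [N HCN]] := banach_steinhaus cT.
  move=> phi sphi; have [B [d1 [d10 Hd1]]] := bg phi sphi.
  have [n1 Hn1] := small d1 d10.
  apply: (@tail_bounded _ n1 B) => m n1m.
  have [e0 _ _ _ _] := Hv (n0 + m)%N.
  exact: Hd1 _ e0 (Hn1 (n0 + m)%N (leq_trans n1m (leq_addl _ _))).
pose m := maxn N (Num.truncn C).+1.
have [_ HT] := HCN m; have [e0 _ sphi bphi] := Hv (n0 + m)%N.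
set e := (v (n0 + m)%N).1.1 in e0 *; set phi := (v (n0 + m)%N).1.2 in sphi bphi *.
set M := (v (n0 + m)%N).2 in bphi *; apply/negP; rewrite -leNgt.
have M0 := dbound_ge0 bphi.
have := HT phi M sphi (dboundW (leq_trans (leq_maxl _ _) (leq_addl _ _)) (lexx M) bphi).
rewrite /T -/e normrM gtr0_norm ?invr_gt0// mulrC ler_pdivrMr// => /le_trans; apply.
rewrite mulrAC; apply: (ler_wpM2r M0); apply: (ler_wpM2r (ltW e0)).
apply: le_trans (ltW (truncnS_gt C)) _; rewrite ler_nat.
by apply: leq_trans (leq_addl n0 _); exact: leq_maxr.
Qed.

(** A single integer bounds the order, the constant and the inverse of the radius, so that countably
    many conditions exhaust all cases, as Baire's theorem requires. The interval from -3 to 3 leaves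
    room for a piece of half-width h centred within 2 h of x. *)
Definition bounded_order g n x := forall (e : R) phi (M : R), 0 < e -> e < n.+1%:R^-1 ->
  supported (-3) 3 phi -> dbound n phi M -> `|g (fun y => phi ((y - x) / e))| <= n%:R * e * M.

Lemma point_value_bounded_order s t g x c : distr `]s, t[ g -> s < x < t ->
  has_point_value g x c -> exists n, bounded_order g n x.
Proof.
move=> dg /andP[sx xt] pv.
have m0 : 0 < Num.min (x - s) (t - x) by rewrite lt_min !subr_gt0 sx.
have m1 : Num.min (x - s) (t - x) <= x - s by rewrite ge_min lexx.
have m2 : Num.min (x - s) (t - x) <= t - x by rewrite ge_min lexx orbT.
have [|||C [N [d [C0 d0 H]]]] := @rescaled_bounded g x (-3) 3 (Num.min (x - s) (t - x) / 4).
- by rewrite divr_gt0.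
- move=> e e0 ed; apply: dg => y /andP[? ?].
  by rewrite /= in_itv/=; apply/andP; split; lra.
- move=> phi sphi; have [d1 d10 Hd1] := point_value_eps pv sphi ltr01.
  exists (`|c * J phi| + 1), d1; split=> // e e0 ed; have := Hd1 _ e0 ed.
  rewrite rescaledE//; set A := e^-1 * _ => h.
  have := ler_normD (A - c * J phi) (c * J phi); rewrite subrK; lra.
have [n0 Hn0] := inv_natS_small d0.
pose n := maxn (maxn N n0) (Num.truncn C).+1; exists n => e phi M e0 en sphi bphi.
have nN : (N <= n)%N by rewrite /n -maxnA leq_maxl.
have nn0 : (n0 <= n)%N by rewrite /n leq_max leq_maxr.
have M0 := dbound_ge0 bphi.
apply: le_trans (H e phi M e0 (lt_trans en (Hn0 _ nn0)) sphi (dboundW nN (lexx M) bphi)) _.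
apply: (ler_wpM2r M0); apply: (ler_wpM2r (ltW e0)).
by apply: le_trans (ltW (truncnS_gt C)) _; rewrite ler_nat leq_maxr.
Qed.

(* The piece is, up to rescaling by [h] at [z], a product of two functions with bounds independent of [h]. *)
Lemma plateau_piece_bound g n z xi (h Mp : R) psi (B M : R) : bounded_order g n z ->
  0 < h -> h < n.+1%:R^-1 -> h <= 1 -> `|z - xi| < 2 * h ->
  dbound n (plateau (-1) 0 1) Mp -> smooth psi -> (forall y, 0 <= psi y <= B) ->
  dbound n psi M -> h * M <= B ->
  `|g (fun y => plateau (xi - h) xi h y * psi y)| <= n%:R * h * (2 ^+ n * Mp * B).
Proof.
move=> Az h0 hn h1 zxi bMp spsi psiB bM hM.
pose Phi u := plateau (-1) 0 1 (u + (z - xi) / h) * psi (h * u + z).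
have sm1 : smooth (fun u => plateau (-1) 0 1 (u + (z - xi) / h)).
  by apply: smooth_shift; exact: smooth_plateau.
have sm2 : smooth (fun u => psi (h * u + z)) by exact: (smooth_affine spsi).
have -> : (fun y => plateau (xi - h) xi h y * psi y) = fun y => Phi ((y - z) / h).
  apply/funext => w; rewrite /Phi; congr (_ * psi _); last by field; rewrite gt_eqF.
  have -> : (w - z) / h + (z - xi) / h = (w - xi) / h by ring.
  by rewrite /plateau !ramp_rescale// mul0r addr0 mul1r mulN1r.
have m10 : -1 <= 0 :> R by lra.
apply: (Az h Phi _ h0 hn).
- split; first exact: (smoothM sm1 sm2).
  move=> u; rewrite mulf_eq0 negb_or => /andP[pl0 _].
  have [_ /(_ _ pl0)] := @supported_plateau R (-1) 0 1 ltr01 m10.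
  rewrite add0r => /andP[u1 u2].
  have : `|(z - xi) / h| < 2 by rewrite normrM normfV (gtr0_norm h0) ltr_pdivrMr.
  by rewrite ltr_norml => /andP[? ?]; apply/andP; split; lra.
- apply: (dboundM sm1 sm2).
  + have := dbound_scale ((z - xi) / h) (@smooth_plateau R (-1) 0 1) ler01 (lexx 1) bMp.
    by congr dbound; apply/funext => w; rewrite mul1r.
  + move=> [|m] u mn; first by rewrite /= ger0_norm; have /andP[] := psiB (h * u + z).
    rewrite (derive1n_affine _ _ _ _ spsi) normrM normrX gtr0_norm//.
    apply: le_trans hM; apply: ler_pM => //; [by rewrite exprn_ge0// ltW| |exact: bM].
    by rewrite exprS; apply: (ler_piMr (ltW h0)); apply: exprn_ile1 => //; exact: ltW.
Qed.

(** On a grid of mesh h, a piece far from K pairs nonnegatively; a piece near K lies within 2 h of a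
    point of order n, hence pairs to at least - D h B. There are about (q - p) / h pieces, so h
    cancels. *)
Lemma bounded_order_lower_bounded s t g (K : set R) n : distr `]s, t[ g ->
  (forall y, s < y < t -> ~ K y -> exists2 r : R, 0 < r & nonneg_near g y r) ->
  (forall y (r : R), K y -> 0 < r -> s <= y - r -> y + r <= t ->
     exists z, `|z - y| < r /\ bounded_order g n z) ->
  exists2 C : R, 0 < C & lower_bounded s t g C.
Proof.
move=> dg good dense.
have m10 : -1 <= 0 :> R by lra.
have [Mp Mp0 HMp] := supported_bounded n (@supported_plateau R (-1) 0 1 ltr01 m10).
pose D := n%:R * 2 ^+ n * Mp.
have D0 : 0 <= D by rewrite /D !mulr_ge0 ?ler0n ?exprn_ge0// ltW.
have piece xi (h M B : R) psi : s < xi - 2 * h -> xi + 2 * h < t -> 0 < h -> h < n.+1%:R^-1 ->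
    h <= 1 -> smooth psi -> (forall y, 0 <= psi y <= B) -> dbound n psi M -> h * M <= B ->
    - (D * h * B) <= g (fun y => plateau (xi - h) xi h y * psi y).
  move=> sxi xit h0 hn h1 spsi psiB bM hM.
  have [[y Ky yxi]|noK] := pselect (exists2 y, K y & `|y - xi| < 2 * h); last first.
    have xhh : xi - h + h <= xi by rewrite subrK.
    have xh : xi - h <= xi by rewrite gerBl ltW.
    have spp := supportedMr spsi (supported_plateau h0 xh).
    have pos : 0 <= g (fun y => plateau (xi - h) xi h y * psi y).
      apply: (nonneg_near_cover _ _ _ spp).
      - by clear -h0; lra.
      - apply: dg => y /andP[y1 y2]; rewrite /= in_itv/=; clear -sxi xit h0 y1 y2.
        by apply/andP; split; lra.
      - move=> y /andP[y1 y2]; apply: good.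
          by clear -sxi xit h0 y1 y2; apply/andP; split; lra.
        move=> Ky; apply: noK; exists y => //.
        by rewrite ltr_norml; clear -h0 y1 y2; apply/andP; split; lra.
      - by move=> y; have /andP[? _] := psiB y; rewrite mulr_ge0// plateau_ge0.
    have B0 : 0 <= B by have /andP[] := psiB 0; exact: le_trans.
    apply: le_trans pos; rewrite oppr_le0; apply: mulr_ge0 => //; apply: mulr_ge0 => //.
    exact: ltW.
  move: (yxi); rewrite ltr_norml => /andP[y1 y2].
  have n1 := ler_norm (y - xi); have n2 := ler_norm (xi - y); rewrite distrC in n2.
  (* This radius keeps the point found within 2 h of the node. *)
  have [|||z [zy Az]] := dense y (2 * h - `|y - xi|) Ky; first by rewrite subr_gt0.
  - by clear -n2 sxi; lra.
  - by clear -n1 xit; lra.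
  have zxi : `|z - xi| < 2 * h.
    by have := ler_normD (z - y) (y - xi); rewrite addrA subrK; clear -zy; lra.
  have := plateau_piece_bound Az h0 hn h1 zxi HMp spsi psiB bM hM.
  by rewrite ler_norml => /andP[+ _]; congr (_ <= _); rewrite /D; congr (- _); ring.
exists (2 * D + 1); first by clear -D0; lra.
move=> p q psi B sp pq qt spsi psiB B0.
have cg : cdist p q g.
  by apply: dg => y /andP[? ?]; rewrite /= in_itv/=; apply/andP; split; [apply: lt_le_trans sp _|apply: le_lt_trans qt].
have [M M0 HM] := supported_bounded n spsi.
have qp0 : 0 < q - p by rewrite subr_gt0.
pose m := Num.min (p - s) (t - q).
have m0 : 0 < m by rewrite lt_min !subr_gt0 sp.
(* The mesh is chosen after psi: h M <= B makes the derivatives of psi, rescaled by h, no larger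
   than B, so that the final constant does not depend on the bound M. *)
pose h0 := Num.min (Num.min (n.+1%:R^-1) 1) (Num.min (B / M) (m / 2)).
have h00 : 0 < h0 by rewrite !lt_min invr_gt0 ltr0n ltr01 !divr_gt0.
have [k [k0 kr]] : exists k : nat, (0 < k)%N /\ (q - p) / k%:R < h0.
  exists (Num.truncn ((q - p) / h0)).+1; split=> //.
  have := truncnS_gt ((q - p) / h0); rewrite ltr_pdivrMr// => h.
  by rewrite ltr_pdivrMr ?ltr0n// mulrC.
have kR0 : 0 < k%:R :> R by rewrite ltr0n.
rewrite (partition_decomp cg pq k0 spsi).
set h := (q - p) / k%:R in kr *.
have h_gt0 : 0 < h by rewrite divr_gt0.
move: kr; rewrite !lt_min => /andP[/andP[hn h1] /andP[hB hm]].
have hM : h * M <= B by rewrite -ler_pdivlMr// ltW.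
have m1 : m <= p - s by rewrite ge_min lexx.
have m2 : m <= t - q by rewrite ge_min lexx orbT.
have : - (D * h * B) *+ k.+1 <= \sum_(i < k.+1)
    g (fun y => plateau (p + i%:R * h - h) (p + i%:R * h) h y * psi y).
  rewrite -[X in _ *+ X]card_ord -sumr_const; apply: ler_sum => i _.
  have /andP[pi iq] : p <= p + i%:R * h <= q by exact: grid_node.
  apply: (piece _ _ M) => //; last exact: (proj1 spsi).
  - by clear -pi m1 hm; lra.
  - by clear -iq m2 hm; lra.
  - exact: ltW.
apply: le_trans.
have -> : - (D * h * B) *+ k.+1 = - (D * B * (k.+1%:R * h)).
  by rewrite -[in LHS]mulr_natr -natr1; ring.
rewrite lerN2.
have kh : k%:R * h = q - p by rewrite /h mulrC divfK// gt_eqF.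
have k1 : k.+1%:R * h <= 2 * (q - p).
  have : 1 * h <= k%:R * h by rewrite ler_pM2r// ler1n.
  by rewrite -natr1 mulrDl kh mul1r; clear; lra.
have i1 : D * B * (k.+1%:R * h) <= D * B * (2 * (q - p)) by rewrite ler_wpM2l// mulr_ge0// ltW.
have i2 : 0 <= (q - p) * B by rewrite mulr_ge0// ltW.
by clear -i1 i2; lra.
Qed.

Lemma nonneg_of_point_values s t g : distr `]s, t[ g ->
  (forall x, s < x < t -> exists2 c, 0 <= c & has_point_value g x c) ->
  forall p q phi, s < p -> p < q -> q < t -> supported p q phi -> (forall y, 0 <= phi y) ->
    0 <= g phi.
Proof.
move=> dg pv p q phi sp pq qt; apply: nonneg_near_cover => //.
  by apply: dg => x /andP[? ?]; rewrite /= in_itv/=; apply/andP; split; lra.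
move=> x /andP[px xq]; have : s < x < t by apply/andP; split; lra.
clear p q phi sp pq qt px xq; apply: contraPP => bad_x sxt.
pose K := [set x | s < x < t /\ ~ exists2 r : R, 0 < r & nonneg_near g x r].
have Kx : K x by [].
have /andP[sx xt] := sxt.
pose r0 := Num.min (x - s) (t - x) / 2.
have m0 : 0 < Num.min (x - s) (t - x) by rewrite lt_min !subr_gt0 sx.
have m1 : Num.min (x - s) (t - x) <= x - s by rewrite ge_min lexx.
have m2 : Num.min (x - s) (t - x) <= t - x by rewrite ge_min lexx orbT.
have r00 : 0 < r0 by rewrite /r0 divr_gt0.
have inr y : `|y - x| <= r0 -> s < y < t.
  by rewrite ler_norml /r0 => /andP[? ?]; apply/andP; split; lra.
have [||n [x1 [r1 [Kx1 r10 x1r dense]]]] := @baire_local K (bounded_order g) x r0 Kx r00.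
- move=> y yx Hy; split; first exact: inr.
  move=> [r r0' Hr]; have r20 : 0 < r / 2 by lra.
  have [z [_ badz] zy] := Hy (r / 2) r20.
  apply: badz; exists (r / 2) => // chi schi chi0; apply: Hr => //.
  by move: zy; rewrite ltr_norml => /andP[? ?]; apply: supportedW schi; lra.
- move=> y [syt _] _; have [c _ pvy] := pv y syt.
  exact: (point_value_bounded_order dg syt pvy).
(* The portion is centred at a bad point x1, so nonnegativity near x1 is the contradiction
   sought. *)
have [_ badx1] := Kx1; apply: badx1.
have [s1 t1] : s < x1 - r1 /\ x1 + r1 < t.
  have := ler_norm (x1 - x); have := ler_norm (x - x1); rewrite distrC /r0 in x1r *.
  by move=> ? ?; split; lra.
have dg1 : distr `](x1 - r1), (x1 + r1)[ g.
  by apply: distrW dg => y /=; rewrite !in_itv/= => /andP[? ?]; apply/andP; split; lra.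
clear -s1 t1 dg1 r10 dense pv.
have [||C C0 lower] := bounded_order_lower_bounded (K := K) (n := n) dg1.
- move=> y /andP[y1 y2] nKy; apply: contrapT => bady; apply: nKy; split=> //.
  by apply/andP; split; lra.
- move=> y r Ky r0' h1 h2; have [|z [_ zy Az]] := dense y r Ky r0'; last by exists z.
  by rewrite -lerBrDr ler_norml; apply/andP; split; lra.
exists (r1 / 2); first by rewrite divr_gt0.
move=> phi sphi phi0.
have hp : x1 - r1 < x1 - r1 / 2 by lra.
have hpq : x1 - r1 / 2 < x1 + r1 / 2 by lra.
have hq : x1 + r1 / 2 < x1 + r1 by lra.
apply: (nonneg_of_lower_bound C0 dg1 lower _ hp hpq hq sphi phi0) => y /andP[? ?].
by apply: pv; apply/andP; split; lra.
Qed.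

End Positivity.

(** * Cutting and gluing distributions *)

Section Cut.
Context {R : realType}.
Implicit Types (phi psi chi : R -> R) (x y p q e : R) (k n N : nat)
  (g T : (R -> R) -> R).

Lemma le0_of_small (a B d1 : R) : 0 <= B -> 0 < d1 ->
  (forall d : R, 0 < d -> d < d1 -> a <= B * d) -> a <= 0.
Proof.
move=> B0 d10 Ha; apply/ler_addgt0Pr => e e0; rewrite add0r.
pose d := Num.min (d1 / 2) (e / (B + 1)).
have d_0 : 0 < d by rewrite lt_min !divr_gt0// ltr_wpDl.
have da : d <= d1 / 2 by rewrite ge_min lexx.
have db : d <= e / (B + 1) by rewrite ge_min lexx orbT.
rewrite ler_pdivlMr ?ltr_wpDl// in db.
by have := Ha d d_0 ltac:(lra); lra.
Qed.

Lemma step_dbound N : exists2 S : R, 0 < S & dbound N (@step R) S.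
Proof.
have [M M0 HM] := smooth_bounded N (-1) 2 (@smooth_step R).
exists (M + 1) => [|n x nN]; first by rewrite addr_gt0.
have [x1|x1] := ltrP x (-1).
  rewrite (@derive1n_eq0 _ n step x 1 ltr01); first by rewrite normr0 addr_ge0 ?(ltW M0).
  by move=> y; rewrite ltr_norml => /andP[? ?]; rewrite step_eq0//; lra.
have [x2|x2] := lerP x 2.
  by apply: le_trans (HM n x nN _) _; [rewrite x1|rewrite lerDl].
case: n nN => [|n] nN.
  by rewrite /= step_eq1 ?normr1 ?lerDr ?(ltW M0)//; lra.
rewrite (@derive1n_local_ball _ n.+1 step (fun=> 1) x 1 ltr01).
  by rewrite derive1n_cst// normr0 addr_ge0 ?(ltW M0).
by move=> y; rewrite ltr_norml => /andP[? ?]; rewrite step_eq1//; lra.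
Qed.

Lemma dbound_ramp N c w S : 0 < w -> dbound N (@step R) S -> dbound N (ramp c w) ((1 + w^-1) ^+ N * S).
Proof.
move=> w0 bS; have := dbound_rescale c (@smooth_step R) w0 bS.
by congr dbound; apply/funext => x; rewrite /ramp mulrC.
Qed.

Variables (c : R) (H : (R -> R) -> R).
Hypothesis dH : distr `]-oo, c[ H.
Hypothesis limH : left_dist_limit H c 0.

Let cH p q : q < c -> cdist p q H.
Proof. by move=> qc; apply: dH => x /andP[_ xq]; rewrite /= in_itv/=; exact: le_lt_trans qc. Qed.

(** Equal to 1 before c - d and to 0 after c - d / 2: its product with a test function stays at a
    positive distance from c, where H is defined. *)
Definition cutoff (d x : R) : R := 1 - ramp (c - d) (d / 2) x.

Lemma smooth_cutoff d : smooth (cutoff d).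
Proof. exact (smoothB (@smooth_cst R 1) (@smooth_ramp R (c - d) (d / 2))). Qed.

Lemma supported_cutoff p q d phi : 0 < d -> supported p q phi ->
  supported p (c - d / 2) (fun x => cutoff d x * phi x).
Proof.
move=> d0 sphi; split; first exact: (smoothM (@smooth_cutoff d) (proj1 sphi)).
move=> x; rewrite mulf_eq0 negb_or => /andP[k0 /(proj2 sphi)/andP[px _]]; rewrite px/=.
rewrite leNgt; apply: contra k0 => cx; rewrite /cutoff ramp_eq1 ?subrr//; lra.
Qed.

Lemma cutoff_eq1 d x : 0 < d -> x <= c - d -> cutoff d x = 1.
Proof. by move=> d0 xc; rewrite /cutoff ramp_eq0 ?subr0//; lra. Qed.

Lemma cutoff_eq0 d x : 0 < d -> c - d / 2 <= x -> cutoff d x = 0.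
Proof. by move=> d0 xc; rewrite /cutoff ramp_eq1 ?subrr//; lra. Qed.

Definition cut_at (d : R) phi : R := H (fun x => cutoff d x * phi x).

Lemma cdist_cut_at p q d : 0 < d -> cdist p q (cut_at d).
Proof.
move=> d0; apply: (@cdist_mul R p q p (c - d / 2) (cutoff d)).
- by apply: cH; lra.
- move=> N; have [S S0 bS] := step_dbound N.
  have d2 : 0 < d / 2 by lra.
  have b1 := dboundZ (-1) (@smooth_ramp R (c - d) (d / 2)) (dbound_ramp (c - d) d2 bS).
  have b2 : dbound N (fun=> 1 : R) 1.
    move=> [|n] x _; first by rewrite /= normr1.
    by rewrite derive1n_cst// normr0.
  have b3 := dboundD (@smooth_cst R 1) (smoothZ (c := -1) (@smooth_ramp R (c - d) (d / 2))) b2 b1.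
  exists (1 + `|-1| * ((1 + (d / 2)^-1) ^+ N * S)); move: b3; congr dbound.
  by apply/funext => x; rewrite mulN1r.
- exact: smooth_cutoff.
- by move=> phi; exact: supported_cutoff.
Qed.

(* The increments of [cut_at d] as [d] shrinks are [O(d)]: rescaled to unit size they are pairings of
   the bounded family of rescalings of [H] with a bounded family of test functions. *)
Lemma cut_increment : exists (C : R) N (d0 : R), [/\ 0 <= C, 0 < d0 &
  forall e phi M p q d d', 0 < e -> supported p q phi -> dbound N phi M ->
    0 < d' -> d' <= d -> d < d0 -> d <= e ->
    `|cut_at d' (fun x => phi ((x - c) / e)) - cut_at d (fun x => phi ((x - c) / e))| <= C * d * M].
Proof.
(* For d / 2 <= d' <= d the two cutoffs differ only between c - d and c - d' / 2 <= c - d / 4; in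
   the unit d this is contained in the interval from -1 to -1/4. *)
have [|||C [N [d0 [C0 d00 HC]]]] := @rescaled_bounded R H c (-1) (- 4^-1) 1.
- exact: ltr01.
- by move=> e e0 e1; apply: cH; lra.
- move=> phi sphi; have [|d d0 Hd] := left_limit_eps limH sphi _ ltr01; first lra.
  exists 1, d; split=> // e e0 ed; have := Hd e e0 ed.
  by rewrite rescaledE// mul0r subr0.
have [S S0 bS] := step_dbound N.
(* In the unit d the ramps have width at least 1/4, whence 1 + 4 = 5. *)
pose B := 2 ^+ N * (5 ^+ N * S + 5 ^+ N * S).
have B0 : 0 <= B by rewrite mulr_ge0 ?exprn_ge0// addr_ge0// mulr_ge0 ?exprn_ge0// ltW.
have CB0 : 0 <= C * B by exact: mulr_ge0.
have CB2 : 0 <= 2 * (C * B) by lra.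
have near e phi M p q d d' : 0 < e -> supported p q phi -> dbound N phi M ->
    d / 2 <= d' -> 0 < d -> d' <= d -> d < d0 -> d <= e ->
    `|cut_at d' (fun x => phi ((x - c) / e)) - cut_at d (fun x => phi ((x - c) / e))| <= C * B * d * M.
  move=> e0 sphi bphi dd' d_gt0 d'd dd0 de.
  have d'0 : 0 < d' by lra.
  have M0 := dbound_ge0 bphi.
  pose r := d' / d; have r2 : 2^-1 <= r by rewrite /r ler_pdivlMr//; lra.
  have r1 : r <= 1 by rewrite /r ler_pdivrMr// mul1r.
  have sre := supported_rescale c e0 sphi.
  have s1 := supported_cutoff d'0 sre; have s2 := supported_cutoff d_gt0 sre.
  have dd2 : c - d / 2 <= c - d' / 2 by lra.
  have {}s2 := supportedW (lexx _) dd2 s2.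
  have cc : cdist (c + e * p) (c - d' / 2) H by apply: cH; lra.
  rewrite /cut_at -(cdistB cc s1 s2).
  (* In the variable (x - c) / d the difference of the cutoffs is [theta], bounded uniformly in d
     and d', and the test function has its variable multiplied by d / e <= 1, which preserves its
     bound M. *)
  pose theta y := ramp (-1) (2^-1) y - ramp (- r) (r / 2) y.
  have E : (fun x => cutoff d' x * phi ((x - c) / e) - cutoff d x * phi ((x - c) / e)) =
      fun x => theta ((x - c) / d) * phi (d / e * ((x - c) / d) + 0).
    apply/funext => x; have -> : d / e * ((x - c) / d) + 0 = (x - c) / e by field; rewrite !gt_eqF.
    rewrite -mulrBl; congr (_ * _); rewrite /theta !ramp_rescale//; try lra.
    have -> : c + -1 * d = c - d by ring.
    have -> : c + - r * d = c - d' by rewrite /r; field; rewrite gt_eqF.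
    have -> : r / 2 * d = d' / 2 by rewrite /r; field; rewrite gt_eqF.
    by rewrite /cutoff (mulrC _ d); ring.
  rewrite E.
  have sth : supported (-1) (- 4^-1) theta.
    split; first exact (smoothB (@smooth_ramp R (-1) (2^-1)) (@smooth_ramp R (- r) (r / 2))).
    move=> y; apply: contraNT; rewrite negb_and -!ltNge => /orP[h|h].
      by rewrite /theta !ramp_eq0 ?subrr//; lra.
    by rewrite /theta !ramp_eq1 ?subrr//; lra.
  have sp : smooth (fun y => phi (d / e * y + 0)) by exact: (smooth_affine (proj1 sphi)).
  have bp : dbound N (fun y => phi (d / e * y + 0)) M.
    apply: (dbound_scale 0 (proj1 sphi) _ _ bphi); first by rewrite divr_ge0 ?ltW.
    by rewrite ler_pdivrMr// mul1r.
  have br (w a : R) : 4^-1 <= w -> dbound N (ramp a w) (5 ^+ N * S).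
    move=> w4; apply: dboundW (leqnn N) _ (dbound_ramp a _ bS); last lra.
    rewrite ler_pM2r// lerXn2r ?nnegrE//; first by rewrite addr_ge0// invr_ge0; lra.
    have : w^-1 <= (4^-1)^-1 by rewrite lef_pV2 ?posrE; lra.
    by rewrite invrK; lra.
  have bth : dbound N theta (5 ^+ N * S + 5 ^+ N * S).
    have b1 : dbound N (ramp (-1) (2^-1)) (5 ^+ N * S) by apply: br; lra.
    have b2 : dbound N (ramp (- r) (r / 2)) (5 ^+ N * S) by apply: br; lra.
    have := dboundD (@smooth_ramp R _ _) (smoothZ (c := -1) (@smooth_ramp R _ _)) b1 (dboundZ (-1) (@smooth_ramp R _ _) b2).
    rewrite normrN1 mul1r; congr dbound; apply/funext => y; by rewrite mulN1r.
  have := HC d (fun y => theta y * phi (d / e * y + 0)) _ d_gt0 dd0 (supportedMr sp sth)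
    (dboundM (proj1 sth) sp bth bp).
  by move=> /le_trans; apply; rewrite le_eqVlt; apply/orP; left; apply/eqP; rewrite /B; ring.
exists (2 * (C * B)), N, d0; split; [exact: CB2|exact: d00|].
move=> e phi M p q d d' e0 sphi bphi d'0 d'd dd0 de.
have M0 := dbound_ge0 bphi.
(* Halving d until it is at most 2 d' gives a geometric series, whence the factor 2. The integer j
   only bounds the number of halvings. *)
have [j Hj] := half_small d d'0.
elim: j d d'd dd0 de Hj => [|j IH] d d'd dd0 de Hj.
  have -> : d' = d by apply/le_anti/andP; split; [|rewrite expr0 mulr1 in Hj].
  by rewrite subrr normr0; apply: mulr_ge0 => //; apply: (mulr_ge0 CB2); lra.
have d_gt0 : 0 < d by lra.
have CBdM : 0 <= C * B * d * M by apply: mulr_ge0 => //; apply: (mulr_ge0 CB0); lra.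
have [h|h] := lerP (d / 2) d'.
  by apply: le_trans (near _ _ _ _ _ _ _ e0 sphi bphi h d_gt0 d'd dd0 de) _; lra.
have d2 : d / 2 <= d by lra.
have hj : d / 2 * 2^-1 ^+ j <= d' by rewrite -mulrA -exprS.
have i1 := IH (d / 2) (ltW h) (le_lt_trans d2 dd0) (le_trans d2 de) hj.
have i2 := near _ _ _ _ _ _ _ e0 sphi bphi (lexx (d / 2)) d_gt0 d2 dd0 de.
set A := cut_at d' _ in i1 *; set A2 := cut_at d _ in i2 *; set A1 := cut_at (d / 2) _ in i1 i2.
have := ler_normD (A - A1) (A1 - A2); rewrite addrA subrK.
have -> : 2 * (C * B) * d * M = 2 * (C * B) * (d / 2) * M + C * B * d * M by field.
by lra.
Qed.

(** The value of K at phi is the common point of the intervals of radius C d M around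
    [cut_at d phi], over all small d and all bounds M of phi. Keeping M free makes the estimate
    available with whatever bound is at hand. *)
Lemma cut_exists : exists K : (R -> R) -> R,
  [/\ distr setT K,
      forall p q phi, q < c -> supported p q phi -> K phi = H phi,
      forall p q phi, c <= p -> supported p q phi -> K phi = 0 &
      has_point_value K c 0].
Proof.
have [C [N [d0 [C0 d00 HC]]]] := cut_increment.
(* The increment bound requires d <= e and is first used at scale e = 1. *)
pose d1 := Num.min d0 1.
have d10 : 0 < d1 by rewrite lt_min d00 ltr01.
have d1a : d1 <= d0 by rewrite ge_min lexx.
have d1b : d1 <= 1 by rewrite ge_min lexx orbT.
have unscale phi : (fun x => phi ((x - c) / 1 + c)) = phi by apply/funext => x; rewrite divr1 subrK.
have incr phi M p q d d' : supported p q phi -> dbound N phi M -> 0 < d' -> d' <= d -> d < d1 ->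
    `|cut_at d' phi - cut_at d phi| <= C * d * M.
  move=> sphi bphi d'0 d'd dd1.
  have sphi' : supported (p - c) (q - c) (fun x => phi (x + c)).
    split; first by apply: smooth_shift; exact: (proj1 sphi).
    by move=> x /(proj2 sphi)/andP[? ?]; apply/andP; split; lra.
  have bphi' : dbound N (fun x => phi (x + c)) M.
    have := dbound_scale c (proj1 sphi) ler01 (lexx 1) bphi.
    by congr dbound; apply/funext => x; rewrite mul1r.
  have := HC 1 _ M _ _ d d' ltr01 sphi' bphi' d'0 d'd; rewrite unscale; apply; lra.
have /choice[K HK] : forall phi, exists l, forall p q d M, supported p q phi -> dbound N phi M ->
    0 < d -> d < d1 -> `|l - cut_at d phi| <= C * d * M.
  move=> phi; have [[p [q sphi]]|ns] := pselect (exists p q, supported p q phi); last first.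
    by exists 0 => p q d M sphi; case: ns; exists p, q.
  have [M0 M00 bphi0] := supported_bounded N sphi.
  have [||l Hl] := @squeeze_sup R (R * R) [set dM | [/\ 0 < dM.1, dM.1 < d1 & dbound N phi dM.2]]
      (fun dM => cut_at dM.1 phi) (fun dM => C * dM.1 * dM.2).
  - by exists (d1 / 2, M0) => /=; split; [lra|lra|exact: bphi0].
  - move=> [d M] [d' M'] /= [d_0 dd1 bM] [d'_0 d'd1 bM'].
    have CdM : 0 <= C * d * M by rewrite !mulr_ge0 ?(dbound_ge0 bM)// ltW.
    have CdM' : 0 <= C * d' * M' by rewrite !mulr_ge0 ?(dbound_ge0 bM')// ltW.
    have [dd'|/ltW d'd] := lerP d d'.
      by have := incr phi M' p q d' d sphi bM' d_0 dd' d'd1; rewrite ler_norml => /andP[]; lra.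
    by have := incr phi M p q d d' sphi bM d'_0 d'd dd1; rewrite ler_norml => /andP[]; lra.
  exists l => p' q' d M _ bM d_0 dd1; exact: (Hl (d, M)).
have Klin p q : lin_itv p q K.
  move=> k phi psi sphi spsi.
  have sl := supportedD (supportedZ k sphi) spsi.
  have [M1 M10 b1] := supported_bounded N sphi; have [M2 M20 b2] := supported_bounded N spsi.
  have [M3 M30 b3] := supported_bounded N sl.
  apply/eqP; rewrite -subr_eq0 -normr_le0.
  apply: (@le0_of_small _ (C * M3 + `|k| * (C * M1) + C * M2) d1) => //.
    by rewrite !addr_ge0 ?mulr_ge0// ltW.
  move=> d d_0 dd1; have h1 := HK _ _ _ _ _ sphi b1 d_0 dd1.
  have h2 := HK _ _ _ _ _ spsi b2 d_0 dd1; have h3 := HK _ _ _ _ _ sl b3 d_0 dd1.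
  have [lc _] := @cdist_cut_at p q d d_0; rewrite (lc k phi psi sphi spsi) in h3.
  set A := K _ in h3 *; set A1 := K phi in h1 *; set A2 := K psi in h2 *.
  set B1 := cut_at d phi in h1 h3; set B2 := cut_at d psi in h2 h3.
  have -> : A - (k * A1 + A2) = (A - (k * B1 + B2)) - (k * (A1 - B1)) - (A2 - B2) by ring.
  apply: le_trans (ler_normB _ _) _.
  have := ler_normB (A - (k * B1 + B2)) (k * (A1 - B1)); rewrite normrM.
  have : `|k| * `|A1 - B1| <= `|k| * (C * d * M1) by rewrite ler_wpM2l.
  by lra.
have dK : distr setT K.
  move=> p q _; split; first exact: Klin.
  have d12 : 0 < d1 / 2 by rewrite divr_gt0.
  have [_ [C1 [N1 [C10 b1]]]] := @cdist_cut_at p q (d1 / 2) d12.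
  exists (C * (d1 / 2) + C1), (maxn N N1); split.
    by rewrite addr_ge0// mulr_ge0// ltW.
  move=> phi M sphi bM.
  have h1 := HK phi p q (d1 / 2) M sphi (dboundW (leq_maxl _ _) (lexx M) bM) d12 ltac:(lra).
  have h2 := b1 phi M sphi (dboundW (leq_maxr _ _) (lexx M) bM).
  have := ler_normD (K phi - cut_at (d1 / 2) phi) (cut_at (d1 / 2) phi); rewrite subrK; lra.
exists K; split=> //.
- move=> p q phi qc sphi; have [M M0 bM] := supported_bounded N sphi.
  apply/eqP; rewrite -subr_eq0 -normr_le0.
  apply: (@le0_of_small _ (C * M) (Num.min d1 (c - q))); first by rewrite mulr_ge0// ltW.
    by rewrite lt_min d10 subr_gt0.
  move=> e e0; rewrite lt_min => /andP[ed1 eq].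
  have := HK _ _ _ _ _ sphi bM e0 ed1; rewrite /cut_at (_ : (fun x => _) = phi).
    by rewrite mulrAC.
  apply/funext => x; have [xq|qx] := lerP x q; first by rewrite cutoff_eq1 ?mul1r//; lra.
  by rewrite (supported_out sphi) ?mulr0// qx orbT.
- move=> p q phi cp sphi; have [M M0 bM] := supported_bounded N sphi.
  apply/eqP; rewrite -normr_le0.
  apply: (@le0_of_small _ (C * M) d1) => //; first by rewrite mulr_ge0// ltW.
  move=> d d_0 dd1; have := HK _ _ _ _ _ sphi bM d_0 dd1.
  rewrite /cut_at (_ : (fun x => _) = fun=> 0).
    have cpd : c - d < c by lra.
    by rewrite (cdist0 (@cH p (c - d) cpd)) subr0 mulrAC.
  apply/funext => x; have [cx|xc] := lerP c x; first by rewrite cutoff_eq0 ?mul0r//; lra.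
  by rewrite (supported_out sphi) ?mulr0// (lt_le_trans xc cp).
- apply: point_value_intro => p q phi eta pq sphi eta0.
  have [M M0 bM] := supported_bounded N sphi.
  (* At scale e the cut is made at distance kap e with kap fixed. The cut test function is then the
     rescaling of one fixed psi supported in the negative half-line, to which the left limit
     applies; the rest costs at most C M kap e <= eta / 2 * e. *)
  pose kap := Num.min 1 (eta / (2 * (C * M + 1))).
  have CM0 : 0 < C * M + 1 by rewrite ltr_wpDl// mulr_ge0// ltW.
  have kap0 : 0 < kap by rewrite lt_min ltr01 divr_gt0// mulr_gt0.
  have kap1 : kap <= 1 by rewrite ge_min lexx.
  have kape : C * M * kap <= eta / 2.
    have : kap <= eta / (2 * (C * M + 1)) by rewrite ge_min lexx orbT.
    by rewrite ler_pdivlMr ?mulr_gt0//; lra.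
  pose psi y := (1 - ramp (- kap) (kap / 2) y) * phi y.
  have spsi : supported p (- (kap / 2)) psi.
    split; first by apply: (smoothM _ (proj1 sphi)); exact (smoothB (@smooth_cst R 1) (@smooth_ramp R (- kap) (kap / 2))).
    move=> x; rewrite mulf_eq0 negb_or => /andP[k0 /(proj2 sphi)/andP[px _]]; rewrite px/=.
    rewrite leNgt; apply: contra k0 => cx; rewrite ramp_eq1 ?subrr//; lra.
  have eta20 : 0 < eta / 2 by rewrite divr_gt0.
  have [|d2 d20 Hd2] := left_limit_eps limH spsi _ eta20; first lra.
  exists (Num.min d1 d2) => [|e e0]; first by rewrite lt_min d10.
  rewrite lt_min => /andP[ed1 ed2]; rewrite mul0r subr0 rescaledE//.
  have h1 := Hd2 e e0 ed2; rewrite mul0r subr0 rescaledE// in h1.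
  have d0' : 0 < kap * e by rewrite mulr_gt0.
  have ke : kap * e <= e by rewrite ler_piMl// ltW.
  have E : (fun x => psi ((x - c) / e)) = fun x => cutoff (kap * e) x * phi ((x - c) / e).
    apply/funext => x; rewrite /psi /cutoff ramp_rescale//; last lra.
    by congr ((1 - ramp _ _ _) * _); ring.
  rewrite E -/(cut_at _ _) in h1.
  set phie := fun x => phi ((x - c) / e) in h1 *.
  have sphie := supported_rescale c e0 sphi.
  (* The bound M' of the rescaled function may deteriorate with e, but it multiplies d, which tends
     to 0 with e fixed; the increments involve only M, which does not depend on e. *)
  have h2 : `|K phie - cut_at (kap * e) phie| <= C * (kap * e) * M.
    have [M' M'0 bM'] := supported_bounded N sphie.
    rewrite -subr_le0; apply: (@le0_of_small _ (C * M') (Num.min d1 (kap * e))).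
    - by rewrite mulr_ge0// ltW.
    - by rewrite lt_min d10.
    move=> d d_0; rewrite lt_min => /andP[dd1 dk].
    have i1 := HK _ _ _ _ _ sphie bM' d_0 dd1.
    have i2 := HC e phi M p q (kap * e) d e0 sphi bM d_0 (ltW dk) ltac:(lra) ke.
    rewrite -/phie in i1 i2.
    have := ler_normD (K phie - cut_at d phie) (cut_at d phie - cut_at (kap * e) phie).
    by rewrite addrA subrK; lra.
  have := ler_normD (K phie - cut_at (kap * e) phie) (cut_at (kap * e) phie); rewrite subrK => h3.
  have ei : 0 < e^-1 by rewrite invr_gt0.
  rewrite normrM (gtr0_norm ei) ler_pdivrMl// in h1.
  rewrite normrM (gtr0_norm ei) ler_pdivrMl//.
  have : C * M * kap * e <= eta / 2 * e by rewrite ler_wpM2r// ltW.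
  by lra.
Qed.

End Cut.

Section Glue.
Context {R : realType}.
Implicit Types (phi psi chi : R -> R) (x y p q e c : R) (U : (R -> R) -> R).

(** Once U2 is shifted by the constant l1 - l2, its difference from U1 has left limit 0 at c; the
    cut of this difference is what must be added to the shifted U2. *)
Lemma glue c U1 U2 l1 l2 : distr `]-oo, c[ U1 -> left_dist_limit U1 c l1 ->
  distr setT U2 -> has_point_value U2 c l2 ->
  exists U, [/\ distr setT U,
    forall p q phi, q < c -> supported p q phi -> U phi = U1 phi,
    forall p q phi, c <= p -> supported p q phi -> U phi = U2 phi + (l1 - l2) * J phi &
    has_point_value U c l1].
Proof.
move=> dU1 lim1 dU2 pv2.
pose H phi := -1 * (U2 phi) + (-1 * constd (l1 - l2) phi + U1 phi).
have dH : distr `]-oo, c[ H.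
  apply: distr_lin; first exact: distrW dU2.
  by apply: distr_lin dU1; exact: distr_constd.
have limH : left_dist_limit H c 0.
  have -> : 0 = -1 * l2 + (-1 * (l1 - l2) + l1) by ring.
  apply: left_limit_lin; first exact: point_value_left.
  by apply: left_limit_lin lim1; apply: point_value_left; exact: point_value_constd.
have [K [dK K1 K2 pvK]] := cut_exists dH limH.
exists (fun phi => 1 * (1 * U2 phi + constd (l1 - l2) phi) + K phi); split.
- apply: distr_lin dK; apply: distr_lin dU2 _; exact: distr_constd.
- by move=> p q phi qc sphi; rewrite (K1 p q)// /H; ring.
- by move=> p q phi cp sphi; rewrite (K2 p q)// !mul1r addr0.
- have -> : l1 = 1 * (1 * l2 + (l1 - l2)) + 0 by ring.
  apply: point_value_lin pvK; apply: point_value_lin pv2 _.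
  have -> : 1 * (1 * l2 + (l1 - l2)) + 0 - l2 = l1 - l2 by ring.
  exact: point_value_constd.
Qed.

End Glue.

(** * Locality of the conditions on major pairs *)

Section Locality.
Context {R : realType}.
Implicit Types (phi psi chi : R -> R) (x y p q : R) (k n N : nat)
  (g u U : (R -> R) -> R) (f : R -> \bar R).

Lemma le0_powR (s a b : R) : s <= 0 -> 0 < a -> a <= b -> b `^ s <= a `^ s.
Proof.
move=> s0 a0 ab; rewrite -[s]opprK powRN (powRN a).
have b0 : 0 < b by exact: lt_le_trans ab.
rewrite lef_pV2 ?posrE ?powR_gt0//.
have sN : 0 <= - s by rewrite oppr_ge0.
by apply: (ge0_ler_powR sN _ _ ab); rewrite nnegrE ltW.
Qed.

Lemma powR_small (s e : R) : s < 0 -> 0 < e -> exists2 A : R, 0 < A & forall z, A <= z -> z `^ s <= e.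
Proof.
move=> s0 e0; exists (e `^ s^-1); first exact: powR_gt0.
move=> z Az; apply: le_trans (le0_powR (ltW s0) (powR_gt0 _ e0) Az) _.
by rewrite -powRrM mulVf ?lt_eqF// powRr1// ltW.
Qed.

Lemma T0_decay phi N : T0 phi -> exists (alpha C A : R), [/\ alpha < -1, 0 <= C, 1 <= A &
  forall m z, (m <= N)%N -> A <= `|z| -> `|derive1n m phi z| <= C * `|z| `^ (alpha - m%:R)].
Proof.
move=> [_ _ _ [alpha a1 H]].
suff [C [A [C0 A1 HCA]]] : exists C A : R, [/\ 0 <= C, 1 <= A &
    forall m z, (m <= N)%N -> A <= `|z| -> `|derive1n m phi z| <= C * `|z| `^ (alpha - m%:R)].
  by exists alpha, C, A.
elim: N => [|N [C [A [C0 A1 IH]]]].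
  have [C [A HCA]] := H 0%N; exists `|C|, (Num.max A 1); split=> //; first by rewrite le_max lexx orbT.
  move=> m z; rewrite leqn0 => /eqP ->; rewrite ge_max => /andP[Az _].
  by apply: le_trans (HCA z Az) _; rewrite ler_wpM2r ?powR_ge0// ler_norm.
have [C' [A' HCA]] := H N.+1; exists (C + `|C'|), (Num.max A A'); split.
- by rewrite addr_ge0.
- by rewrite le_max A1.
move=> m z; rewrite leq_eqVlt ltnS ge_max => /orP[/eqP ->|mN] /andP[Az A'z].
  apply: le_trans (HCA z A'z) _; rewrite ler_wpM2r ?powR_ge0//.
  by have := ler_norm C'; lra.
by apply: le_trans (IH m z mN Az) _; rewrite ler_wpM2r ?powR_ge0// lerDl.
Qed.

(** A derivative of order m costs t^-m, and the decay exponent alpha - m returns (r / t)^-m = t^m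
    r^-m. This is the use of the extra power of decay that T0 asks for each derivative. *)
Lemma rescaled_tail_bound phi N (r : R) : T0 phi -> 0 < r ->
  exists (alpha C d0 : R), [/\ alpha < -1, 0 <= C, 0 < d0 &
    forall m x y t, (m <= N)%N -> 0 < t -> t < d0 -> r <= `|y - x| ->
      `|derive1n m (fun z => phi ((z - x) / t)) y| <= C * (r / t) `^ alpha].
Proof.
move=> T0phi r0; have [alpha [C [A [a1 C0 A1 HCA]]]] := T0_decay N T0phi.
have A0 : 0 < A by lra.
exists alpha, (C * (1 + r^-1) ^+ N), (r / A); split=> //.
- by rewrite mulr_ge0// exprn_ge0// addr_ge0// invr_ge0 ltW.
- by rewrite divr_gt0.
move=> m x y t mN t0 tA yr; have [sphi _ _ _] := T0phi.
rewrite derive1n_rescale// normrM normrX gtr0_norm ?invr_gt0//.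
pose z := `|(y - x) / t|.
have rz : r / t <= z by rewrite /z normrM normfV (gtr0_norm t0) ler_pM2r// invr_gt0.
have Art : A <= r / t by rewrite ler_pdivlMr// mulrC -ler_pdivlMr// ltW.
have rt0 : 0 < r / t by rewrite divr_gt0.
apply: (@le_trans _ _ (t^-1 ^+ m * (C * (r / t) `^ (alpha - m%:R)))).
  rewrite ler_wpM2l ?exprn_ge0// ?invr_ge0 ?(ltW t0)//.
  apply: le_trans (HCA m _ mN (le_trans Art rz)) _; rewrite ler_wpM2l//.
  apply: le0_powR rt0 rz; have : 0 <= m%:R :> R by rewrite ler0n.
  by lra.
have -> : (r / t) `^ (alpha - m%:R) = (r / t) `^ alpha * (t ^+ m * r^-1 ^+ m).
  rewrite powRB; last by rewrite (gt_eqF rt0) implybT.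
  rewrite (powR_mulrn _ (ltW rt0)).
  by congr (_ * _); rewrite -exprVn invf_div exprMn.
have -> : t^-1 ^+ m * (C * ((r / t) `^ alpha * (t ^+ m * r^-1 ^+ m))) =
   (t^-1 * t) ^+ m * (C * r^-1 ^+ m * (r / t) `^ alpha) by rewrite exprMn; ring.
rewrite mulVf ?gt_eqF// expr1n mul1r ler_wpM2r ?powR_ge0// ler_wpM2l//.
have r1 : 0 <= r^-1 by rewrite invr_ge0 ltW.
apply: (@le_trans _ _ ((1 + r^-1) ^+ m)); first by rewrite lerXn2r ?nnegrE ?addr_ge0// lerDr.
by rewrite ler_weXn2l// lerDl.
Qed.

(** As u vanishes near x, only the values of phi at distance at least r / (2 t) from 0 matter. With
    the factor t^-1 they contribute at most a multiple of (r / (2 t))^(1 + alpha), and 1 + alpha <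
    0. *)
Lemma rescaled_tail u x (r : R) phi : compact_distribution u -> 0 < r ->
  (forall psi, supported (x - r) (x + r) psi -> u psi = 0) -> T0 phi ->
  forall eta : R, 0 < eta -> exists2 d : R, 0 < d & forall t, 0 < t -> t < d ->
    `|rescaled u x t phi| <= eta.
Proof.
move=> [lu [K [C [N [cK bu]]]]] r0 u0 T0phi eta eta0.
have [sphi _ _ _] := T0phi.
have r20 : 0 < r / 2 by lra.
have [alpha [C1 [d0 [a1 C10 d00 H]]]] := rescaled_tail_bound N T0phi r20.
pose chi := plateau (x - r) (x + r / 2) (r / 2).
have schi : supported (x - r) (x + r) chi.
  have -> : x + r = x + r / 2 + r / 2 by field.
  by apply: supported_plateau => //; lra.
have s1chi : smooth (fun y => 1 - chi y) by exact (smoothB (@smooth_cst R 1) (proj1 schi)).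
have [S S0 bS] : exists2 S : R, 0 < S & dbound N (fun y => 1 - chi y) S.
  have [M M0 HM] := supported_bounded N schi; exists (1 + M); first by rewrite addr_gt0.
  move=> n y nN; rewrite (derive1nB n y (@smooth_cst R 1) (proj1 schi)).
  apply: le_trans (ler_normB _ _) _; apply: lerD; last exact: HM.
  by case: n nN => [|n] nN; [rewrite /= normr1|rewrite derive1n_cst// normr0].
pose D := `|C| * (2 ^+ N * S * C1) * (2 / r).
have D0 : 0 <= D by rewrite /D !mulr_ge0 ?exprn_ge0 ?invr_ge0// ltW.
have a10 : 1 + alpha < 0 by lra.
have eD0 : 0 < eta / (D + 1) by rewrite divr_gt0// ltr_wpDl.
have [A A0 HA] := powR_small a10 eD0.
exists (Num.min d0 (r / 2 / A)) => [|t t0]; first by rewrite lt_min d00 divr_gt0.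
rewrite lt_min => /andP[td0 tA].
set phit := fun y => phi ((y - x) / t).
have sphit : smooth phit.
  have := smooth_affine (k := t^-1) (c := - (x / t)) sphi.
  by congr smooth; apply/funext => y; rewrite /phit mulrBl mulrC.
have z0 : 0 < r / 2 / t by rewrite divr_gt0.
have split_u : u phit = u (fun y => (1 - chi y) * phit y).
  have -> : phit = fun y => 1 * (chi y * phit y) + (1 - chi y) * phit y.
    by apply/funext => y; ring.
  rewrite lu; [|exact (smoothM (proj1 schi) sphit)|exact (smoothM s1chi sphit)].
  rewrite (u0 _ (supportedMr sphit schi)) mulr0 add0r.
  by congr u; apply/funext => y; ring.
rewrite rescaledE// -/phit split_u normrM (gtr0_norm (x := t^-1)) ?invr_gt0//.
have b : `|u (fun y => (1 - chi y) * phit y)| <= `|C| * (2 ^+ N * S * (C1 * (r / 2 / t) `^ alpha)).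
  have M0 : 0 <= 2 ^+ N * S * (C1 * (r / 2 / t) `^ alpha).
    by rewrite !mulr_ge0 ?exprn_ge0 ?powR_ge0// ltW.
  apply: le_trans (bu _ _ (smoothM s1chi sphit) M0 _) _; last by rewrite ler_wpM2r// ler_norm.
  move=> n y nN _; have [yx|yx] := ltrP `|y - x| (r / 2).
    rewrite (@derive1n_eq0 _ n _ y (r / 2 - `|y - x|)) ?normr0 ?subr_gt0//.
    move=> z zy; have zx : `|z - x| < r / 2.
      have := ler_normD (z - y) (y - x); rewrite addrA subrK; lra.
    move: zx; rewrite ltr_norml => /andP[? ?].
    by rewrite /chi plateau_eq1 ?subrr ?mul0r//; apply/andP; split; lra.
  apply: (derive1nM_bound s1chi sphit _ _ nN) => m mN; [exact: bS|exact: H].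
apply: le_trans (ler_wpM2l _ b) _; first by rewrite invr_ge0 ltW.
have -> : t^-1 * (`|C| * (2 ^+ N * S * (C1 * (r / 2 / t) `^ alpha))) =
    D * ((r / 2 / t) * (r / 2 / t) `^ alpha).
  by rewrite /D; field; rewrite !gt_eqF.
have -> : r / 2 / t * (r / 2 / t) `^ alpha = (r / 2 / t) `^ (1 + alpha).
  by rewrite powRD; [rewrite powRr1 ?(ltW z0)|rewrite (gt_eqF z0) implybT].
have Az : A <= r / 2 / t by rewrite ler_pdivlMr// mulrC -ler_pdivlMr// ltW.
apply: le_trans (ler_wpM2l D0 (HA _ Az)) _.
rewrite mulrA ler_pdivrMr ?ltr_wpDl// mulrC ler_wpM2l// ?(ltW eta0)//; lra.
Qed.

Lemma compact_distribution_sub u1 u2 : compact_distribution u1 -> compact_distribution u2 ->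
  compact_distribution (fun phi => -1 * u1 phi + u2 phi).
Proof.
move=> [l1 [K1 [C1 [N1 [cK1 b1]]]]] [l2 [K2 [C2 [N2 [cK2 b2]]]]]; split.
  by move=> k phi psi sphi spsi; rewrite l1// l2//; ring.
exists (K1 `|` K2), (C1 + C2), (maxn N1 N2); split; first exact: compactU.
move=> phi M sphi M0 H; apply: le_trans (ler_normD _ _) _.
rewrite normrM normrN1 mul1r mulrDl; apply: lerD.
- apply: b1 => // n x nN Kx; apply: H; first exact: leq_trans (leq_maxl _ _).
  by left.
- apply: b2 => // n x nN Kx; apply: H; first exact: leq_trans (leq_maxr _ _).
  by right.
Qed.

Lemma einf_le_approx (F G : R -> R) :
  (forall eta : R, 0 < eta -> exists2 d : R, 0 < d & forall t, 0 < t -> t < d -> F t <= G t + eta) ->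
  (limf_einf (fun t : R => (F t)%:E) (0 : R)^'+ <= limf_einf (fun t : R => (G t)%:E) (0 : R)^'+)%E.
Proof.
move=> H; apply/lee_addgt0Pr => eta eta0; rewrite !limf_einfE.
apply: ge_ereal_sup => _ [V FV <-].
have [d d0 Hd] := H eta eta0.
pose V' := V `&` [set t | 0 < t /\ t < d].
have FV' : ((0 : R)^'+) V'.
  apply: filterI => //; near=> t; split; first by near: t; exact: nbhs_right_gt.
  by near: t; exact: nbhs_right_lt.
apply: (@le_trans _ _ (ereal_inf [set (G t)%:E | t in V'] + eta%:E)%E); last first.
  by rewrite leeD2r//; apply: ereal_sup_ubound; exists V'.
rewrite -leeBlDr//; apply: le_ereal_inf_tmp => _ [t [Vt [t0 td]] <-].
rewrite leeBlDr//; apply: (@le_trans _ _ (F t)%:E).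
  by apply: ereal_inf_lbound; exists t.
by rewrite -EFinD lee_fin; exact: Hd.
Unshelve. all: by end_near. Qed.

(** The difference of the two distributions vanishes near x, so its rescalings tend to 0. This is
    what allows major pairs to be cut and glued although T0 contains functions without compact
    support. *)
Lemma lower_phi_local u1 u2 x (r : R) phi : compact_distribution u1 -> compact_distribution u2 ->
  0 < r -> (forall psi, supported (x - r) (x + r) psi -> u1 psi = u2 psi) -> T0 phi ->
  lower_phi u1 phi x = lower_phi u2 phi x.
Proof.
move=> c1 c2 r0 E T0phi.
suff le v1 v2 : compact_distribution v1 -> compact_distribution v2 ->
    (forall psi, supported (x - r) (x + r) psi -> v1 psi = v2 psi) ->
    (lower_phi v1 phi x <= lower_phi v2 phi x)%E.
  apply/eqP; rewrite eq_le !le//; by move=> psi /E.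
move=> d1 d2 E'; apply: einf_le_approx => eta eta0.
have [|d d0 Hd] := rescaled_tail (compact_distribution_sub d1 d2) r0 _ T0phi eta0 (x := x).
  by move=> psi /E' ->; rewrite mulN1r addNr.
exists d => // t t0 td; have := Hd t t0 td; rewrite !rescaledE//.
by rewrite mulrDr mulrCA mulN1r ler_norml => /andP[]; lra.
Qed.

Definition deriv_near U u x := exists2 r : R, 0 < r &
  forall phi, supported (x - r) (x + r) phi -> u phi = - U (derive1 phi).

(* The pointwise conditions on a major pair, for whatever compactly supported distribution
   coincides with the derivative of [U] near the given point. *)
Definition loc_major (Omega : set R) f U := exists E Z : set R,
  [/\ countable E, (@lebesgue_measure R).-negligible Z &
    forall x u, Omega x -> compact_distribution u -> deriv_near U u x ->
      (~ Z x -> forall phi, T0 phi -> (f x <= lower_phi u phi x)%E) /\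
      (~ E x -> forall phi, T1 phi -> (-oo < lower_phi u phi x)%E)].

(** A constant added to U is invisible, because the derivative of a test function has integral 0. *)
Lemma loc_major_local (Omega Omega' : set R) f U1 U2 : loc_major Omega f U1 -> Omega' `<=` Omega ->
  (forall x, Omega' x -> exists2 r : R, 0 < r & exists k : R, forall phi,
      supported (x - r) (x + r) phi -> U1 phi = U2 phi + k * J phi) ->
  loc_major Omega' f U2.
Proof.
move=> [E [Z [cE nZ H]]] sub loc; exists E, Z; split=> // x u Ox cu [r r0 Hr].
have [r' r'0 [k Hk]] := loc x Ox.
apply: H => //; first exact: sub.
exists (Num.min r r') => [|phi sphi]; first by rewrite lt_min r0.
have mr : Num.min r r' <= r by rewrite ge_min lexx.
have mr' : Num.min r r' <= r' by rewrite ge_min lexx orbT.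
rewrite Hr; last by apply: supportedW sphi; lra.
rewrite Hk ?(J_derive1 sphi) ?mulr0 ?addr0//.
by apply: supported_derive1; apply: supportedW sphi; lra.
Qed.

(** A singleton is countable and null, so it can serve as both exceptional sets. Gluing points and
    endpoints are absorbed in this way. *)
Lemma loc_major_set1 x f U : loc_major [set x] f U.
Proof.
exists [set x], [set x]; split; first exact: countable1.
  apply/negligibleP; first exact: measurable_set1.
  exact: lebesgue_measure_set1.
by move=> y u -> _ _; split=> H; exfalso; exact: H.
Qed.

Lemma loc_major_bigcup (Omega : nat -> set R) f U : (forall n, loc_major (Omega n) f U) ->
  loc_major (\bigcup_n Omega n) f U.
Proof.
move=> H; have /choice[E HE] : forall n, exists EZ : set R * set R,
  [/\ countable EZ.1, (@lebesgue_measure R).-negligible EZ.2 &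
    forall x u, Omega n x -> compact_distribution u -> deriv_near U u x ->
      (~ EZ.2 x -> forall phi, T0 phi -> (f x <= lower_phi u phi x)%E) /\
      (~ EZ.1 x -> forall phi, T1 phi -> (-oo < lower_phi u phi x)%E)].
  by move=> n; have [E [Z HEZ]] := H n; exists (E, Z).
exists (\bigcup_n (E n).1), (\bigcup_n (E n).2); split.
- by apply: bigcup_countable => // n _; have [] := HE n.
- by apply: negligible_bigcup => n; have [] := HE n.
move=> x u [n _ On] cu du; have [_ _ HEn] := HE n; have [h1 h2] := HEn x u On cu du.
split=> nx; [apply: h1|apply: h2] => Ex; apply: nx; by exists n.
Qed.

Lemma loc_majorU (A B : set R) f U : loc_major A f U -> loc_major B f U -> loc_major (A `|` B) f U.
Proof.
move=> mA mB; rewrite -bigcup2E; apply: loc_major_bigcup => -[|[|n]] //=.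
by exists set0, set0; split; [exact: countable0|exact: negligible_set0|].
Qed.

Lemma loc_majorS (A B : set R) f U : A `<=` B -> loc_major B f U -> loc_major A f U.
Proof.
by move=> AB [E [Z [cE nZ H]]]; exists E, Z; split=> // x u /AB; exact: H.
Qed.

(** A major pair in terms of U alone: the vanishing of U' outside [a, b] replaces the support
    condition on u, and the open interval suffices because the endpoints can be put into the
    exceptional sets. *)
Definition majorant a b f U := [/\ distr setT U, forall x, exists c, has_point_value U x c,
  has_point_value U a 0,
  forall p q phi, (q < a) || (b < p) -> supported p q phi -> U (derive1 phi) = 0 &
  loc_major `]a, b[ f U].

Lemma major_pair_majorant a b f u U : major_pair a b f u U -> majorant a b f U.
Proof.
move=> [[cu u0] [dU pU] du pa [E [Z [cE nZ H1 H2]]]]; split=> //.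
- exact: distribution_distr.
- by move=> x; exact: pU.
- move=> p q phi out sphi.
  have tphi : test_function (~` `[a, b]) phi.
    apply: supported_test sphi _ => x /andP[px xq]; rewrite /= in_itv /= => /andP[ax xb].
    by case/orP: out => h; lra.
  have := du phi (supported_testT sphi); rewrite u0//.
  by move=> /eqP; rewrite eq_sym oppr_eq0 => /eqP.
- exists E, Z; split=> // x v; rewrite /= in_itv /= => /andP[ax xb] cv [r r0 Hr].
  have xab : `[a, b]%classic x by rewrite /= in_itv /= !ltW.
  have uv psi : supported (x - r) (x + r) psi -> u psi = v psi.
    by move=> spsi; rewrite Hr// du//; exact: (supported_testT spsi).
  split=> nx phi Tphi.
  + by rewrite -(lower_phi_local cu cv r0 uv Tphi); apply: H1.
  + by rewrite -(lower_phi_local cu cv r0 uv (proj1 Tphi)); apply: H2.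
Qed.

Lemma majorant_major_pair a b f U : a < b -> majorant a b f U -> exists u, major_pair a b f u U.
Proof.
move=> ab [dU pU pa out locU].
pose chi := plateau (a - 2) (b + 1) (1 : R).
have schi : supported (a - 2) (b + 2) chi.
  have -> : b + 2 = b + 1 + 1 by ring.
  by apply: supported_plateau; lra.
have chi1 x : a - 1 <= x <= b + 1 -> chi x = 1.
  move=> /andP[? ?]; apply: plateau_eq1; first exact: ltr01.
  by apply/andP; split; lra.
(* The derivative of U, multiplied by chi so that it acts on all smooth functions; nothing is lost,
   since chi is 1 near [a, b] and the derivative vanishes elsewhere. *)
pose u phi := - U (derive1 (fun x => chi x * phi x)).
have cU : cdist (a - 2) (b + 2) U by apply: dU.
have s2 phi : smooth phi -> supported (a - 2) (b + 2) (fun x => chi x * phi x).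
  by move=> sphi; exact: (supportedMr sphi schi).
(* Such a phi is split by a smooth function rising from 0 at a to 1 at b into a part before a and a
   part after b, where U has zero derivative. *)
have out0 p q phi : supported p q phi -> (forall x, a <= x <= b -> phi x = 0) ->
    (exists2 r : R, 0 < r & forall x, `|x - a| < r -> phi x = 0) ->
    (exists2 r : R, 0 < r & forall x, `|x - b| < r -> phi x = 0) -> U (derive1 phi) = 0.
  move=> sphi phi0 [r r0 Hr] [r' r'0 Hr'].
  pose s := ramp a (b - a).
  have ba : 0 < b - a by lra.
  have ss : smooth s by exact: smooth_ramp.
  have s1 : supported p (a - r / 2) (fun x => (1 - s x) * phi x).
    split; first exact: (smoothM (smoothB (@smooth_cst R 1) ss) (proj1 sphi)).
    move=> x; rewrite mulf_eq0 negb_or => /andP[sx px].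
    have /andP[-> _] := proj2 sphi x px; rewrite /= leNgt; apply/negP => ax.
    have [xa|ax'] := ltrP x a.
      by move/eqP: px; apply; apply: Hr; rewrite ltr_norml; apply/andP; split; lra.
    have [xb|bx] := lerP x b; first by move/eqP: px; apply; apply: phi0; rewrite ax'.
    by move/eqP: sx; apply; rewrite /s ramp_eq1 ?subrr//; lra.
  have s3 : supported (b + r' / 2) q (fun x => s x * phi x).
    split; first exact: (smoothM ss (proj1 sphi)).
    move=> x; rewrite mulf_eq0 negb_or => /andP[sx px].
    have /andP[_ ->] := proj2 sphi x px; rewrite andbT leNgt; apply/negP => xb.
    have [bx|xb'] := ltrP b x.
      by move/eqP: px; apply; apply: Hr'; rewrite ltr_norml; apply/andP; split; lra.
    have [ax|xa] := lerP a x; first by move/eqP: px; apply; apply: phi0; rewrite ax.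
    by move/eqP: sx; apply; rewrite /s ramp_eq0//; lra.
  have U1 : U (derive1 (fun x => (1 - s x) * phi x)) = 0.
    by apply: out s1; apply/orP; left; lra.
  have U3 : U (derive1 (fun x => s x * phi x)) = 0.
    by apply: out s3; apply/orP; right; lra.
  pose P := Num.min p (b + r' / 2); pose Q := Num.max q (a - r / 2).
  have s1' : supported P Q (fun x => (1 - s x) * phi x).
    by apply: supportedW s1; rewrite ?ge_min ?le_max lexx ?orbT.
  have s3' : supported P Q (fun x => s x * phi x).
    by apply: supportedW s3; rewrite ?ge_min ?le_max lexx ?orbT.
  have E : derive1 phi = fun x => derive1 (fun x => (1 - s x) * phi x) x + derive1 (fun x => s x * phi x) x.
    apply/funext => x; rewrite -!derive1n1 -derive1nD; [|exact: (proj1 s1)|exact: (proj1 s3)].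
    by congr (derive1n 1 _ _); apply/funext => y; ring.
  have cPQ : cdist P Q U by apply: dU.
  by rewrite E (cdistD cPQ (supported_derive1 s1') (supported_derive1 s3')) U1 U3 addr0.
have cu : compact_distribution u.
  have [lU [C [N [C0 bU]]]] := cU; split.
    move=> k phi psi sphi spsi; rewrite /u.
    have E : derive1 (fun x => chi x * (k * phi x + psi x)) =
        fun x => k * derive1 (fun x => chi x * phi x) x + derive1 (fun x => chi x * psi x) x.
      apply/funext => x; rewrite -!derive1n1.
      rewrite -(derive1nZ 1 k x (proj1 (s2 _ sphi))).
      rewrite -(derive1nD 1 x (smoothZ (c := k) (proj1 (s2 _ sphi))) (proj1 (s2 _ spsi))).
      by congr (derive1n 1 _ _); apply/funext => y; ring.
    rewrite E lU; [ring|exact: (supported_derive1 (s2 _ sphi))|exact: (supported_derive1 (s2 _ spsi))].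
  have [S S0 bS] := supported_bounded N.+1 schi.
  exists `[(a - 2), (b + 2)]%classic, (C * (2 ^+ N.+1 * S)), N.+1; split; first exact: segment_compact.
  move=> phi M sphi M0 bphi; rewrite /u normrN -mulrA; apply: bU.
    exact: (supported_derive1 (s2 _ sphi)).
  apply: dbound_derive1 => n x nN; have [xin|xout] := boolP (a - 2 <= x <= b + 2).
    apply: (derive1nM_bound (proj1 schi) sphi _ _ nN).
      by move=> m mN; exact: bS.
    by move=> m mN; apply: bphi => //=; rewrite in_itv.
  rewrite (derive1n_out _ (s2 _ sphi)).
    by rewrite normr0 !mulr_ge0 ?exprn_ge0// ltW.
  by move: xout; rewrite negb_and -!ltNge.
have du : dist_derivative U u.
  move=> phi /testT_supported[p [q [pq sphi]]]; rewrite /u; congr (- _).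
  pose P := Num.min p (a - 2); pose Q := Num.max q (b + 2).
  have t1 : supported P Q (fun x => chi x * phi x).
    by apply: supportedW (s2 _ (proj1 sphi)); rewrite ?ge_min ?le_max lexx ?orbT.
  have t2 : supported P Q phi.
    by apply: supportedW sphi; rewrite ?ge_min ?le_max lexx ?orbT.
  have cPQ : cdist P Q U by apply: dU.
  have s3 := supportedB t2 t1.
  apply/eqP; rewrite eq_sym -subr_eq0 -(cdistB cPQ (supported_derive1 t2) (supported_derive1 t1)).
  have E : derive1 (fun x => phi x - chi x * phi x) =
      fun x => derive1 phi x - derive1 (fun x => chi x * phi x) x.
    apply/funext => x; rewrite -!derive1n1.
    by rewrite (derive1nB 1 x (proj1 t2) (proj1 t1)).
  rewrite -E; apply/eqP; apply: (out0 _ _ _ s3).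
  - by move=> x /andP[? ?]; rewrite chi1 ?mul1r ?subrr//; apply/andP; split; lra.
  - exists 1 => // x; rewrite ltr_norml => /andP[? ?].
    by rewrite chi1 ?mul1r ?subrr//; apply/andP; split; lra.
  - exists 1 => // x; rewrite ltr_norml => /andP[? ?].
    by rewrite chi1 ?mul1r ?subrr//; apply/andP; split; lra.
exists u; split=> //.
- split=> // phi tphi; have [p [q [pq sphi H]]] := test_supported tphi.
  rewrite (du phi (supported_testT sphi)) (out0 _ _ _ sphi) ?oppr0//.
  + move=> x xab; apply/eqP/negPn/negP => /H; apply; by rewrite /= in_itv.
  + apply: fsupp_notin; case: tphi => _ _ sub /sub; apply; rewrite /= in_itv /= lexx ltW//.
  + apply: fsupp_notin; case: tphi => _ _ sub /sub; apply; rewrite /= in_itv /= lexx ltW//.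
- split; first exact: distr_distributionT.
  by move=> x _; exact: pU.
- have mU : loc_major `[a, b] f U.
    apply: loc_majorS (loc_majorU (loc_majorU locU (loc_major_set1 a f U)) (loc_major_set1 b f U)).
    move=> x; rewrite /= in_itv /= => /andP[ax xb].
    have [->|xa] := eqVneq x a; first by left; right.
    have [->|xb'] := eqVneq x b; first by right.
    by left; left; rewrite /= in_itv /= !lt_neqAle ax xb (eq_sym a) xa xb'.
  have [E [Z [cE nZ H]]] := mU; exists E, Z; split=> //.
  + move=> x phi [xab nZx] Tphi; have [|h _] := H x u xab cu; last exact: h.
    by exists 1 => // psi spsi; apply: du; exact: (supported_testT spsi).
  + move=> x phi [xab nEx] Tphi; have [|_ h] := H x u xab cu; last exact: h.
    by exists 1 => // psi spsi; apply: du; exact: (supported_testT spsi).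
Qed.

End Locality.

(** * Majorants *)

Section Majorants.
Context {R : realType}.
Implicit Types (phi psi chi : R -> R) (a b c d x y p q : R) (k n N : nat)
  (g u U F : (R -> R) -> R) (f : R -> \bar R).

(** The case c = d is included: with U2 = 0 it extends a distribution controlled only before c to a
    majorant that is constant after c. *)
Lemma glue_majorant a c d f U1 U2 l1 l2 : a < c -> c <= d ->
  distr `]-oo, c[ U1 -> (forall x, x < c -> exists v, has_point_value U1 x v) ->
  left_dist_limit U1 c l1 -> has_point_value U1 a 0 ->
  (forall p q phi, q < a -> supported p q phi -> U1 (derive1 phi) = 0) ->
  loc_major `]a, c[ f U1 ->
  distr setT U2 -> (forall x, c < x -> exists v, has_point_value U2 x v) ->
  has_point_value U2 c l2 ->
  (forall p q phi, d < p -> supported p q phi -> U2 (derive1 phi) = 0) ->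
  loc_major `]c, d[ f U2 ->
  exists U, [/\ majorant a d f U,
    forall p q phi, q < c -> supported p q phi -> U phi = U1 phi,
    has_point_value U c l1 &
    forall x v, c < x -> has_point_value U2 x v -> has_point_value U x (v + (l1 - l2))].
Proof.
move=> ac cd dU1 pU1 lim1 pa out1 loc1 dU2 pU2 p2 out2 loc2.
have [U [dU EL ER pc]] := glue dU1 lim1 dU2 p2.
have pL x v : x < c -> has_point_value U1 x v -> has_point_value U x v.
  move=> xc; have r0 : 0 < (c - x) / 2 by lra.
  by apply: (point_value_local r0) => phi sphi; rewrite (EL _ _ _ _ sphi)//; lra.
have pR x v : c < x -> has_point_value U2 x v -> has_point_value U x (v + (l1 - l2)).
  move=> cx pv; have r0 : 0 < (x - c) / 2 by lra.
  have := @point_value_lin R _ _ x 1 _ _ pv (@point_value_constd R x (l1 - l2)); rewrite mul1r.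
  by apply: (point_value_local r0) => phi sphi; rewrite (ER _ _ _ _ sphi) ?mul1r//; lra.
exists U; split=> //; split=> //.
- move=> x; case: (ltgtP x c) => [xc|cx|->].
  + by have [v /(pL x v xc)] := pU1 x xc; exists v.
  + by have [v /(pR x v cx)] := pU2 x cx; exists (v + (l1 - l2)).
  + by exists l1.
- exact: pL.
- move=> p q phi /orP[qa|dp] sphi; have sphi' := supported_derive1 sphi.
  + by rewrite (EL _ _ _ _ sphi') ?(out1 p q)//; lra.
  + by rewrite (ER _ _ _ _ sphi') ?(out2 p q)// ?(J_derive1 sphi) ?mulr0 ?addr0//; lra.
- have locL : loc_major `]a, c[ f U.
    apply: (loc_major_local loc1) => // x; rewrite /= in_itv /= => /andP[ax xc].
    exists ((c - x) / 2); first lra.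
    by exists 0 => phi sphi; rewrite mul0r addr0 (EL _ _ _ _ sphi)//; lra.
  have locR : loc_major `]c, d[ f U.
    apply: (loc_major_local loc2) => // x; rewrite /= in_itv /= => /andP[cx xd].
    exists ((x - c) / 2); first lra.
    exists (l2 - l1) => phi sphi; rewrite (ER _ _ _ _ sphi); last lra.
    by rewrite -[l2 - l1]opprB mulNr addrK.
  apply: loc_majorS (loc_majorU (loc_majorU locL (loc_major_set1 c f U)) locR) => x.
  rewrite /= in_itv /= => /andP[ax xd]; case: (ltgtP x c) => [xc|cx|->].
  + by left; left; rewrite /= in_itv /= ax xc.
  + by right; rewrite /= in_itv /= cx xd.
  + by left; right.
Qed.

Lemma majorant_join a c d f U1 U2 l1 l2 : a < c -> c < d ->
  majorant a c f U1 -> has_point_value U1 c l1 ->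
  majorant a d f U2 -> has_point_value U2 c l2 ->
  exists U, [/\ majorant a d f U,
    forall p q phi, q < c -> supported p q phi -> U phi = U1 phi,
    has_point_value U c l1 &
    forall x v, c < x -> has_point_value U2 x v -> has_point_value U x (v + (l1 - l2))].
Proof.
move=> ac cd [dU1 pU1 pa1 out1 loc1] p1 [dU2 pU2 pa2 out2 loc2] p2.
apply: (glue_majorant (U1 := U1) (U2 := U2)) => //.
- exact: ltW.
- exact: distrW dU1.
- exact: point_value_left.
- by move=> p q phi qa; apply: out1; rewrite qa.
- by move=> p q phi dp; apply: out2; rewrite dp orbT.
- apply: loc_majorS loc2 => x; rewrite /= !in_itv /= => /andP[cx ->].
  by rewrite (lt_trans ac cx).
Qed.

Lemma majorant_extend a c f U1 l1 : a < c ->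
  distr `]-oo, c[ U1 -> (forall x, x < c -> exists v, has_point_value U1 x v) ->
  left_dist_limit U1 c l1 -> has_point_value U1 a 0 ->
  (forall p q phi, q < a -> supported p q phi -> U1 (derive1 phi) = 0) ->
  loc_major `]a, c[ f U1 ->
  exists U, [/\ majorant a c f U,
    forall p q phi, q < c -> supported p q phi -> U phi = U1 phi & has_point_value U c l1].
Proof.
move=> ac dU1 pU1 lim1 pa out1 loc1.
have [|||||U [h1 h2 h3 _]] := glue_majorant (U2 := constd 0) (d := c) (l2 := 0) ac (lexx c) dU1 pU1 lim1 pa out1 loc1.
- exact: distr_constd.
- by move=> x _; exists 0; exact: point_value_constd.
- exact: point_value_constd.
- by move=> p q phi _ _; rewrite /constd mul0r.
- apply: loc_majorS (loc_major_set1 c f _) => x; rewrite /= in_itv /= => /andP[cx xc].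
  by have := lt_trans cx xc; rewrite ltxx.
by exists U.
Qed.

Lemma majorant_restrict a b c f U v : a < c -> c < b -> majorant a b f U -> has_point_value U c v ->
  exists U', [/\ majorant a c f U',
    forall p q phi, q < c -> supported p q phi -> U' phi = U phi & has_point_value U' c v].
Proof.
move=> ac cb [dU pU pa out loc] pc; apply: majorant_extend => //.
- exact: distrW dU.
- exact: point_value_left.
- by move=> p q phi qa; apply: out; rewrite qa.
- by apply: loc_majorS loc => x; rewrite /= !in_itv /= => /andP[-> xc]; exact: lt_trans cb.
Qed.

Lemma left_limit_nonneg g b s l : s < b ->
  (forall p q phi, s < p -> p < q -> q < b -> supported p q phi -> (forall y, 0 <= phi y) -> 0 <= g phi) ->
  left_dist_limit g b l -> 0 <= l.
Proof.
move=> sb g0 lim; pose psi := plateau (-4) (-2) (1 : R).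
have s1 : supported (-4) (-1) psi.
  have := @supported_plateau R (-4) (-2) 1 ltr01 ltac:(lra).
  by have -> : -2 + 1 = -1 :> R by lra.
have J0 : 0 < J psi by apply: J_plateau_gt0; lra.
have psi0 y : 0 <= psi y by apply: plateau_ge0; lra.
rewrite leNgt; apply/negP => l0.
have eta0 : 0 < - (l * J psi) / 2 by rewrite divr_gt0// oppr_gt0 nmulr_rlt0.
have [|d d0 Hd] := left_limit_eps lim s1 _ eta0; first lra.
pose e := Num.min d ((b - s) / 4) / 2.
have m0 : 0 < Num.min d ((b - s) / 4) by rewrite lt_min d0; lra.
have m1 : Num.min d ((b - s) / 4) <= d by rewrite ge_min lexx.
have m2 : Num.min d ((b - s) / 4) <= (b - s) / 4 by rewrite ge_min lexx orbT.
have e0 : 0 < e by rewrite /e; lra.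
have := Hd e e0 ltac:(rewrite /e; lra); rewrite rescaledE//.
have : 0 <= e^-1 * g (fun y => psi ((y - b) / e)).
  rewrite mulr_ge0 ?invr_ge0 ?(ltW e0)//.
  have sre := supported_rescale b e0 s1.
  by apply: (g0 _ _ _ _ _ _ sre) => //; rewrite /e; lra.
by rewrite ler_norml => ? /andP[? ?]; lra.
Qed.

(** Beyond a point x0 where W exceeds l - del, the constants l - del and l bound g as a
    distribution, by [nonneg_of_point_values]. This settles nonnegative test functions; a general
    psi is written as phi1 - B chi with both terms nonnegative. *)
Lemma left_limit_monotone g (W : R -> R) a b l : a < b -> distr `]a, b[ g ->
  (forall x, a < x < b -> has_point_value g x (W x)) ->
  (forall x y, a < x -> x < y -> y < b -> W x <= W y) ->
  (forall x, a < x < b -> W x <= l) ->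
  (forall e : R, 0 < e -> exists2 x, a < x < b & l - e < W x) ->
  left_dist_limit g b l.
Proof.
move=> ab dg pg mono ubW adh; apply: left_limit_intro => p q psi eta pq q0 spsi eta0.
have [B B0 HB] := supported_bounded 0 spsi.
pose chi := plateau (p - 1) q (Num.min 1 (- q / 2)).
have w0 : 0 < Num.min 1 (- q / 2) by rewrite lt_min ltr01; lra.
have w1 : Num.min 1 (- q / 2) <= 1 by rewrite ge_min lexx.
have w2 : Num.min 1 (- q / 2) <= - q / 2 by rewrite ge_min lexx orbT.
have schi : supported (p - 1) (q / 2) chi.
  apply: (@supportedW R (p - 1) (q + Num.min 1 (- q / 2))) => //; first lra.
  by apply: supported_plateau => //; lra.
have spsi' : supported (p - 1) (q / 2) psi by apply: supportedW spsi; lra.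
have chi0 y : 0 <= chi y by apply: plateau_ge0; lra.
have s1 : supported (p - 1) (q / 2) (fun y => B * chi y + psi y).
  exact: (supportedD (supportedZ B schi) spsi').
have s10 y : 0 <= B * chi y + psi y.
  have [yin|yout] := boolP (p <= y <= q).
    rewrite /chi plateau_eq1 ?mulr1//; last by move: yin => /andP[? ?]; apply/andP; split; lra.
    by have := HB 0%N y isT; rewrite /= ler_norml => /andP[? _]; lra.
  rewrite (supported_out spsi) ?addr0 ?mulr_ge0 ?(ltW B0)//.
  by move: yout; rewrite negb_and -!ltNge.
pose phi1 y := B * chi y + psi y.
(* Total mass of the two nonnegative functions into which psi is split; del is chosen so that del Q
   <= eta. *)
pose Q := J phi1 + B * J chi.
have Q0 : 0 <= Q by rewrite /Q addr_ge0 ?mulr_ge0 ?(ltW B0)//; exact: J_ge0.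
have del0 : 0 < eta / (Q + 1) by rewrite divr_gt0// ltr_wpDl.
have [x0 /andP[ax0 x0b] Wx0] := adh _ del0.
set del := eta / (Q + 1) in del0 Wx0.
have dg0 : distr `]x0, b[ g.
  by apply: distrW dg => y; rewrite /= !in_itv /= => /andP[? ?]; apply/andP; split; lra.
have upper s t phi : x0 < s -> s < t -> t < b -> supported s t phi -> (forall y, 0 <= phi y) ->
    (l - del) * J phi <= g phi <= l * J phi.
  move=> xs st tb sphi phi0; apply/andP; split.
  - have H : 0 <= -1 * constd (l - del) phi + g phi.
      apply: (@nonneg_of_point_values R x0 b (fun phi => -1 * constd (l - del) phi + g phi)
        _ _ s t phi xs st tb sphi phi0).
        by apply: distr_lin; [exact: distr_constd|exact: dg0].
      move=> x /andP[x0x xb]; exists (-1 * (l - del) + W x).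
        by have := mono x0 x ax0 x0x xb; lra.
      apply: point_value_lin; first exact: point_value_constd.
      by apply: pg; rewrite xb (lt_trans ax0).
    by move: H; rewrite /constd; lra.
  - have H : 0 <= -1 * g phi + constd l phi.
      apply: (@nonneg_of_point_values R x0 b (fun phi => -1 * g phi + constd l phi)
        _ _ s t phi xs st tb sphi phi0).
        by apply: distr_lin; [exact: dg0|exact: distr_constd].
      move=> x /andP[x0x xb]; exists (-1 * W x + l).
        by have := ubW x; rewrite xb (lt_trans ax0 x0x) => /(_ isT); lra.
      apply: point_value_lin; last exact: point_value_constd.
      by apply: pg; rewrite xb (lt_trans ax0).
    by move: H; rewrite /constd; lra.
(* For e < d the rescaled supports stay to the right of x0. *)
pose d := (b - x0) / (1 - p).
have p1 : 0 < 1 - p by lra.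
exists d => [|e e0 ed]; first by rewrite divr_gt0//; lra.
rewrite /d ltr_pdivlMr// in ed.
have resc phi : supported (p - 1) (q / 2) phi -> (forall y, 0 <= phi y) ->
    `|e^-1 * g (fun y => phi ((y - b) / e)) - l * J phi| <= del * J phi.
  move=> sphi phi0; have sre := supported_rescale b e0 sphi.
  have q20 : e * (q / 2) < 0 by rewrite pmulr_rlt0//; lra.
  have pq2 : p - 1 < q / 2 by lra.
  have epq : e * (p - 1) < e * (q / 2) by rewrite ltr_pM2l.
  have := upper _ _ _ _ _ _ sre (fun y => phi0 _); rewrite (J_rescale b pq2 e0 sphi).
  move=> /(_ _ _ _)/andP[]; [lra|lra|lra|] => h1 h2.
  have ei : 0 < e^-1 by rewrite invr_gt0.
  have {}h1 := ler_wpM2l (ltW ei) h1; have {}h2 := ler_wpM2l (ltW ei) h2.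
  have E1 : e^-1 * ((l - del) * (e * J phi)) = (l - del) * J phi by field; rewrite gt_eqF.
  have E2 : e^-1 * (l * (e * J phi)) = l * J phi by field; rewrite gt_eqF.
  rewrite E1 in h1; rewrite E2 in h2.
  have := mulr_ge0 (ltW del0) (J_ge0 phi0).
  by rewrite ler_norml => ?; apply/andP; split; lra.
have r1 := resc phi1 s1 s10; have r2 := resc chi schi chi0.
rewrite rescaledE//.
have Jphi1 : J phi1 = B * J chi + J psi by rewrite /phi1 (J_lin B schi spsi').
have cge : cdist (b + e * (p - 1)) (b + e * (q / 2)) g.
  have q20 : e * (q / 2) < 0 by rewrite pmulr_rlt0//; lra.
  by apply: dg => y /andP[? ?]; rewrite /= in_itv /=; apply/andP; split; lra.
have E : g (fun y => phi1 ((y - b) / e)) = B * g (fun y => chi ((y - b) / e)) + g (fun y => psi ((y - b) / e)).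
  have [lg _] := cge.
  exact: (lg B _ _ (supported_rescale b e0 schi) (supported_rescale b e0 spsi')).
rewrite E Jphi1 in r1.
have Qdel : del * Q <= eta.
  by rewrite /del mulrAC ler_pdivrMr ?ltr_wpDl// ler_pM2l// lerDl.
set g1 := g (fun y => psi _) in r1 *; set g2 := g (fun y => chi _) in r1 r2.
have r2' : `|B * (e^-1 * g2 - l * J chi)| <= B * (del * J chi).
  by rewrite normrM (gtr0_norm B0) ler_wpM2l// ltW.
have -> : e^-1 * g1 - l * J psi =
    (e^-1 * (B * g2 + g1) - l * (B * J chi + J psi)) - B * (e^-1 * g2 - l * J chi) by ring.
apply: le_trans (ler_normB _ _) _; apply: le_trans (lerD r1 r2') _.
by move: Qdel; rewrite /Q Jphi1; lra.
Qed.

(** * Hake's theorem for majorants *)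

Section Hake.
Variables (a b : R) (f : R -> \bar R) (F : (R -> R) -> R) (L : R) (Fp : R -> R).
Hypothesis ab : a < b.
(** With [Fp_adh], this makes Fp c the infimum of the values at c of the majorants on [a, c].
    Minorants are left out, so that the section applies both to f with F and to - f with - F. *)
Hypothesis Fp_le : forall c U v, a < c -> c < b -> majorant a c f U -> has_point_value U c v -> Fp c <= v.
Hypothesis Fp_adh : forall c (e : R), a < c -> c < b -> 0 < e ->
  exists U v, [/\ majorant a c f U, has_point_value U c v & v <= Fp c + e].
Hypothesis dF : distr `]-oo, b[ F.
Hypothesis pF : forall x, a < x -> x < b -> has_point_value F x (Fp x).
Hypothesis limF : left_dist_limit F b L.

(** As Fp c need not converge, the inequality between point values is first turned into one between
    distributions, which passes to left limits. *)
Lemma majorant_ge_limit U v : majorant a b f U -> has_point_value U b v -> L <= v.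
Proof.
move=> mU pU; have [dU pvU _ _ _] := mU.
pose g phi := -1 * F phi + U phi.
have dg : distr `]a, b[ g.
  apply: distr_lin; last exact: distrW dU.
  by apply: distrW dF => x; rewrite /= !in_itv /= => /andP[].
suff : 0 <= -1 * L + v by lra.
apply: (@left_limit_nonneg g b a) => //; last first.
  by apply: left_limit_lin => //; exact: point_value_left.
apply: (nonneg_of_point_values dg) => x /andP[ax xb]; have [vx pvx] := pvU x.
exists (-1 * Fp x + vx); last by apply: point_value_lin => //; exact: pF.
have [U' [mU' _ pU']] := majorant_restrict ax xb mU pvx.
by have := Fp_le ax xb mU' pU'; lra.
Qed.

(** Continuing an almost optimal majorant on [a, x] by the increments of U gives a majorant on
    [a, y] whose value at y is at most Fp x + e + vy - vx. *)
Lemma majorant_increment d U x y vx vy : a < x -> x < y -> y <= d -> y < b ->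
  majorant a d f U -> has_point_value U x vx -> has_point_value U y vy ->
  Fp y - Fp x <= vy - vx.
Proof.
move=> ax xy yd yb mU px py; have ay := lt_trans ax xy; have xb := lt_trans xy yb.
have [U' [mU' px' py']] : exists U', [/\ majorant a y f U', has_point_value U' x vx & has_point_value U' y vy].
  have [E|yd'] := eqVneq y d; first by exists U; split=> //; rewrite E.
  have {}yd : y < d by rewrite lt_neqAle yd'.
  have [U' [h1 h2 h3]] := majorant_restrict ay yd mU py; exists U'; split=> //.
  have r0 : 0 < (y - x) / 2 by lra.
  by apply: (point_value_local r0) px => phi sphi; rewrite (h2 _ _ _ _ sphi)//; lra.
suff : Fp y <= vy - vx + Fp x by lra.
apply/ler_addgt0Pr => e e0; have [U1 [v1 [mU1 p1 v1e]]] := Fp_adh ax xb e0.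
have [U2 [mU2 _ _ H]] := majorant_join ax xy mU1 p1 mU' px'.
by have := Fp_le ay yb mU2 (H y vy xy py'); lra.
Qed.

Lemma majorant_adh_limit (eta : R) : 0 < eta ->
  exists U v, [/\ majorant a b f U, has_point_value U b v & v <= L + eta].
Proof.
(* The denominator n + 2 rather than n + 1 keeps [c 0] to the right of a. *)
move=> eta0; pose c n : R := b - (b - a) / n.+2%:R.
have ba : 0 < b - a by rewrite subr_gt0.
have n2 n : 0 < n.+2%:R :> R by rewrite ltr0n.
have cb n : c n < b by rewrite /c gtrBl divr_gt0.
have ac n : a < c n.
  rewrite /c ltrBrDl -ltrBrDr ltr_pdivrMr// ltr_pMr// ltr1n//.
have cS n : c n < c n.+1.
  by rewrite /c ltrD2l ltrN2 ltr_pM2l// ltf_pV2 ?posrE// ltr_nat.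
have cmono m n : (m <= n)%N -> c m <= c n.
  by apply: (homo_leq (r := fun x y : R => x <= y)) => [x|y x z|i]; [exact: lexx|exact: le_trans|exact: ltW].
have cex x : x < b -> exists n, x < c n.
  move=> xb; have [n0 Hn0] := inv_natS_small (d := (b - x) / (b - a)) ltac:(by rewrite divr_gt0//; lra).
  exists n0; have := Hn0 n0.+1 (leqnSn _); rewrite ltr_pdivlMr// => h.
  have E : (b - a) / n0.+2%:R = n0.+2%:R^-1 * (b - a) by rewrite mulrC.
  by rewrite /c E; set A := _ * (b - a) in h *; lra.
(* The excess allowed at stage n is eta (1 - 2^-(n+1)); passing from [c n] to [c n.+1] adds at most
   eta 2^-(n+2), so the total stays below eta. *)
pose inv (s : nat * ((R -> R) -> R) * R) := [/\ majorant a (c s.1.1) f s.1.2,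
  has_point_value s.1.2 (c s.1.1) s.2 & s.2 <= Fp (c s.1.1) + eta * (1 - 2^-1 ^+ s.1.1.+1)].
pose rel (i : nat) (s s' : nat * ((R -> R) -> R) * R) := s'.1.1 = s.1.1.+1 /\
  forall p q phi, q < c s.1.1 -> supported p q phi -> s'.1.2 phi = s.1.2 phi.
have [U0 [v0 [mU0 pU0 v0e]]] := Fp_adh (ac 0%N) (cb 0%N) (divr_gt0 eta0 (@ltr0n R 2)).
have [||st [st0 inv_st rel_st]] := @dependent_choice_inv _ inv rel (0%N, U0, v0).
- by split=> //=; rewrite expr1; lra.
- move=> i [[n G] v] [/= mG pG vG].
  have e0 : 0 < eta * 2^-1 ^+ n.+2 by rewrite mulr_gt0// halfX_gt0.
  have [U2 [v2 [mU2 p2 v2e]]] := Fp_adh (ac n.+1) (cb n.+1) e0.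
  have [_ /(_ (c n))[l2 pl2] _ _ _] := mU2.
  have [U [mU EU _ HU]] := majorant_join (ac n) (cS n) mG pG mU2 pl2.
  have [U2' [mU2' _ pU2']] := majorant_restrict (ac n) (cS n) mU2 pl2.
  have l2F := Fp_le (ac n) (cb n) mU2' pU2'.
  exists (n.+1, U, v2 + (v - l2)); rewrite /inv /rel /=; last by split.
  split=> //; first exact: HU.
  have E : 2^-1 ^+ n.+2 = 2^-1 * 2^-1 ^+ n.+1 :> R by rewrite exprS.
  by rewrite E in v2e *; lra.
pose G n := (st n).1.2; pose v n := (st n).2.
have stn n : (st n).1.1 = n.
  by elim: n => [|n IH]; [rewrite st0|have [-> _] := rel_st n; rewrite IH].
have mG n : majorant a (c n) f (G n) by have [] := inv_st n; rewrite stn.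
have pG n : has_point_value (G n) (c n) (v n) by have [] := inv_st n; rewrite stn.
have vG n : v n <= Fp (c n) + eta.
  have [_ _] := inv_st n; rewrite stn -/(v n).
  by have := mulr_gt0 eta0 (@halfX_gt0 R n.+1); lra.
have coh n m p q phi : (n <= m)%N -> q < c n -> supported p q phi -> G m phi = G n phi.
  move=> /subnKC <- qc sphi; elim: (m - n)%N => [|j IH]; first by rewrite addn0.
  rewrite addnS -IH; have [_ H] := rel_st (n + j)%N; apply: (H p q) => //.
  by rewrite stn (lt_le_trans qc)// cmono// leq_addr.
(* A test function supported before b is supported before some [c n], and later stages agree with
   stage n there; any other argument gets the default value 0. *)
have /choice[U HU] : forall phi, exists w, forall n p q, q < c n -> supported p q phi -> w = G n phi.
  move=> phi; have [[n [p [q [qc sphi]]]]|no] := pselect (exists n p q, q < c n /\ supported p q phi); last first.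
    by exists 0 => n p q qc sphi; case: no; exists n, p, q.
  exists (G n phi) => n' p' q' qc' sphi'; have [nn|/ltnW nn] := leqP n n'.
    by rewrite (coh n n' p q).
  by rewrite (coh n' n p' q').
have dU : distr `]-oo, b[ U.
  move=> p q pqb.
  (* [distr] also speaks of empty intervals, for which q may exceed b; then phi is 0 and any right
     end will do. *)
  have [q' [n [qn sub]]] : exists q' n, q' < c n /\ forall phi, supported p q phi -> supported p q' phi.
    have [pq|qp] := lerP p q.
      have [|n qn] := cex q; last by exists q, n.
      by have := pqb q (introT andP (conj pq (lexx q))); rewrite /= in_itv.
    exists (c 0%N - 1), 0%N; split; first lra.
    move=> phi [sphi H]; split; first exact: sphi.
    by move=> x /H/andP[px xq]; lra.
  have [dG _ _ _ _] := mG n; have [lG [C [N [C0 bG]]]] := dG p q' (fun _ _ => I); split.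
    move=> k phi psi s1 s2; have s3 := supportedD (supportedZ k s1) s2.
    rewrite (HU _ n p q' qn (sub _ s1)) (HU _ n p q' qn (sub _ s2)) (HU _ n p q' qn (sub _ s3)).
    by apply: lG; exact: sub.
  exists C, N; split=> // phi M s1 bM; rewrite (HU _ n p q' qn (sub _ s1)).
  by apply: bG => //; exact: sub.
have UG n x : x < c n -> exists2 r : R, 0 < r & forall phi, supported (x - r) (x + r) phi -> G n phi = U phi.
  move=> xc; exists ((c n - x) / 2); first lra.
  by move=> phi sphi; apply/esym; apply: HU sphi; lra.
have pU x n w : x < c n -> has_point_value (G n) x w -> has_point_value U x w.
  by move=> /UG[r r0 Hr]; exact: point_value_local r0 Hr.
have pvG n x : exists w, has_point_value (G n) x w by have [_ + _ _ _] := mG n; apply.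
have /choice[w Hw] : forall x, exists w, x < b -> has_point_value U x w.
  move=> x; have [xb|] := ltrP x b; last by exists 0.
  by have [n xn] := cex x xb; have [w pw] := pvG n x; exists w => _; exact: pU pw.
have wG n x : x < c n -> has_point_value (G n) x (w x).
  move=> xn; have [w' pw'] := pvG n x.
  by rewrite (point_value_unique (Hw x (lt_trans xn (cb n))) (pU x n w' xn pw')).
(* The excess of U over F. Increments of a majorant dominate those of Fp, so W is nondecreasing, and
   the error budget bounds it by eta. *)
pose W x := -1 * Fp x + w x.
have W_mono x y : a < x -> x < y -> y < b -> W x <= W y.
  move=> ax xy yb; have [n yn] := cex y yb.
  have := majorant_increment ax xy (ltW yn) yb (mG n) (wG n x (lt_trans xy yn)) (wG n y yn).
  by rewrite /W; lra.
have W_le x : a < x < b -> W x <= eta.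
  move=> /andP[ax xb]; have [n xn] := cex x xb.
  have := majorant_increment ax xn (lexx _) (cb n) (mG n) (wG n x xn) (pG n).
  by have := vG n; rewrite /W; lra.
pose S := [set W x | x in [set x | a < x < b]].
have hS : has_sup S.
  split; first by exists (W (c 0%N)); exists (c 0%N) => //=; rewrite ac cb.
  by exists eta => _ [x xab <-]; exact: W_le.
have lS : sup S <= eta by apply: ge_sup; [exact: hS.1|move=> _ [x xab <-]; exact: W_le].
pose g phi := -1 * F phi + U phi.
have dg : distr `]-oo, b[ g by exact: distr_lin.
have limg : left_dist_limit g b (sup S).
  apply: (@left_limit_monotone g W a b) => //.
  - by apply: distrW dg => x; rewrite /= !in_itv /= => /andP[].
  - by move=> x /andP[ax xb]; apply: point_value_lin; [exact: pF|exact: Hw].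
  - by move=> x xab; apply: ub_le_sup; [exact: hS.2|exists x].
  - by move=> e e0; have [_ [x xab <-] h] := sup_adherent e0 hS; exists x.
(* U is the sum of F, whose left limit is a hypothesis, and of the excess, whose left limit comes
   from monotonicity. *)
have limU : left_dist_limit U b (1 * L + sup S).
  rewrite (_ : U = fun phi => 1 * F phi + g phi); first exact: left_limit_lin.
  by apply/funext => phi; rewrite /g; ring.
have [||||U' [mU' _ pU']] := majorant_extend (f := f) ab dU _ limU.
- by move=> x xb; exists (w x); exact: Hw.
- by apply: (pU a 0%N) => //; have [] := mG 0%N.
- move=> p q phi qa sphi; rewrite (HU _ 0%N p q _ (supported_derive1 sphi)); last exact: lt_trans (ac _).
  by have [_ _ _ H _] := mG 0%N; apply: H sphi; rewrite qa.
- apply: loc_majorS (loc_major_bigcup (Omega := fun n => `]a, (c n)[%classic) (f := f) (U := U) _).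
    move=> x; rewrite /= in_itv /= => /andP[ax xb]; have [n xn] := cex x xb.
    by exists n => //=; rewrite in_itv /= ax xn.
  move=> n; have [_ _ _ _ lG] := mG n; apply: (loc_major_local lG) => // x.
  rewrite /= in_itv /= => /andP[ax xn]; have [r r0 Hr] := UG n x xn; exists r => //.
  by exists 0 => phi /Hr ->; rewrite mul0r addr0.
by exists U', (1 * L + sup S); split=> //; lra.
Qed.

End Hake.
End Majorants.

(** * The integral *)

Section Symmetry.
Context {R : realType}.
Implicit Types (a b c : R) (u v U V F : (R -> R) -> R) (f : R -> \bar R).

Lemma rescaledN g (x t : R) phi : rescaled (fun psi => - g psi) x t phi = - rescaled g x t phi :> R.
Proof. by rewrite /rescaled mulrN. Qed.

Lemma lower_phiN u (phi : R -> R) x : lower_phi (fun psi => - u psi) phi x = (- upper_phi u phi x)%E.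
Proof.
rewrite /lower_phi /upper_phi -limf_einfN; congr limf_einf.
by apply/funext => t; rewrite rescaledN.
Qed.

Lemma upper_phiN u (phi : R -> R) x : upper_phi (fun psi => - u psi) phi x = (- lower_phi u phi x)%E.
Proof.
rewrite /lower_phi /upper_phi -limf_esupN; congr limf_esup.
by apply/funext => t; rewrite rescaledN.
Qed.

Lemma has_point_valueN U x (c : R) : has_point_value U x c -> has_point_value (fun phi => - U phi) x (- c).
Proof.
move=> H phi /H; under [in X in _ -> X]eq_fun do rewrite rescaledN.
by rewrite mulNr; exact: cvgN.
Qed.

Lemma left_dist_limitN U x (c : R) : left_dist_limit U x c -> left_dist_limit (fun phi => - U phi) x (- c).
Proof.
move=> H phi /H; under [in X in _ -> X]eq_fun do rewrite rescaledN.
by rewrite mulNr; exact: cvgN.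
Qed.

Lemma linear_onN (S : set (R -> R)) U : linear_on S U -> linear_on S (fun phi => - U phi).
Proof. by move=> lU k phi psi s1 s2; rewrite lU// opprD mulrN. Qed.

Lemma distributionN (Omega : set R) U : Defs.distribution Omega U ->
  Defs.distribution Omega (fun phi => - U phi).
Proof.
move=> [lU bU]; split; first exact: linear_onN.
move=> K cK KO; have [C [N H]] := bU K cK KO; exists C, N => phi M *.
by rewrite normrN; exact: H.
Qed.

Lemma pair_structureN a b u U :
  [/\ distribution_on_itv a b u, lojasiewicz setT U, dist_derivative U u & has_point_value U a 0] ->
  [/\ distribution_on_itv a b (fun phi => - u phi), lojasiewicz setT (fun phi => - U phi),
      dist_derivative (fun phi => - U phi) (fun phi => - u phi) &
      has_point_value (fun phi => - U phi) a 0].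
Proof.
move=> [[[lu [K [C [N [cK bu]]]]] u0] [dU pU] du pa]; split.
- split; last by move=> phi /u0 ->; rewrite oppr0.
  split; first exact: linear_onN.
  by exists K, C, N; split=> // phi M *; rewrite normrN; exact: bu.
- split; first exact: distributionN.
  by move=> x /pU[c pc]; exists (- c); exact: has_point_valueN.
- by move=> phi /du ->.
- by rewrite -oppr0; exact: has_point_valueN.
Qed.

Lemma minor_major a b f v V : minor_pair a b f v V ->
  major_pair a b (fun x => - f x)%E (fun phi => - v phi) (fun phi => - V phi).
Proof.
move=> [h1 h2 h3 h4 [E [Z [cE nZ H1 H2]]]].
have [k1 k2 k3 k4] := pair_structureN (And4 h1 h2 h3 h4); split=> //.
exists E, Z; split=> // x phi xE Tphi; rewrite lower_phiN.
- by rewrite leeN2; exact: H1.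
- by rewrite lteNr; exact: H2.
Qed.

Lemma major_minor a b f v V : major_pair a b (fun x => - f x)%E v V ->
  minor_pair a b f (fun phi => - v phi) (fun phi => - V phi).
Proof.
move=> [h1 h2 h3 h4 [E [Z [cE nZ H1 H2]]]].
have [k1 k2 k3 k4] := pair_structureN (And4 h1 h2 h3 h4); split=> //.
exists E, Z; split=> // x phi xE Tphi; rewrite upper_phiN.
- by rewrite leeNl; exact: H1.
- by rewrite lteNl; exact: H2.
Qed.

Lemma major_valuesP a b f (v : R) : a < b -> major_values a b f v%:E <->
  exists2 U, majorant a b f U & has_point_value U b v.
Proof.
move=> ab; split.
- by move=> [w [u [U [mU pU]]] [<-]]; exists U => //; exact: major_pair_majorant mU.
- move=> [U mU pU]; have [u mu] := majorant_major_pair ab mU.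
  by exists v => //; exists u, U.
Qed.

Lemma minor_valuesP a b f (v : R) : a < b -> minor_values a b f v%:E <->
  exists2 U, majorant a b (fun x => - f x)%E U & has_point_value U b (- v).
Proof.
move=> ab; split.
- move=> [w [u [U [mU pU]]] [<-]]; exists (fun phi => - U phi); last exact: has_point_valueN.
  exact: major_pair_majorant (minor_major mU).
- move=> [U mU pU]; have [u mu] := majorant_major_pair ab mU.
  exists v => //; exists (fun phi => - u phi), (fun phi => - U phi); split.
    exact: major_minor.
  by rewrite -[v]opprK; exact: has_point_valueN.
Qed.

(** One major and one minor pair bound the common value from both sides, so it is finite and [fine]
    loses nothing. *)
Lemma dist_integrable_value a c f : a < c -> dist_integrable a c f ->
  ereal_inf (major_values a c f) = (fine (dist_integral a c f))%:E /\
  ereal_sup (minor_values a c f) = (fine (dist_integral a c f))%:E.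
Proof.
move=> ac [[u [U mU]] [v [V mV]] E].
have [_ [_ pvU] _ _ _] := mU; have [_ [_ pvV] _ _ _] := mV.
have [x px] := pvU c I; have [y py] := pvV c I.
have le1 : (ereal_inf (major_values a c f) <= x%:E)%E.
  by apply: ereal_inf_lbound; exists x => //; exists u, U.
have le2 : (y%:E <= ereal_inf (major_values a c f))%E.
  by rewrite -E; apply: ereal_sup_ubound; exists y => //; exists v, V.
have fin : ereal_inf (major_values a c f) \is a fin_num.
  by rewrite fin_numE -ltNye -ltey (lt_le_trans (ltNyr y) le2) (le_lt_trans le1 (ltry x)).
by rewrite E /dist_integral fineK.
Qed.

End Symmetry.

Theorem theorem8p1 (R : realType) (a b : R) (f : R -> \bar R)
    (F : (R -> R) -> R) (L : R) :
  a < b ->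
  (forall c : R, a < c -> c < b -> dist_integrable a c f) ->
  lojasiewicz_assoc `]-oo, b[ (indefinite_integral a f) F ->
  left_dist_limit F b L ->
  dist_integrable a b f /\ dist_integral a b f = L%:E.
Proof.
move=> ab intf [dF pF] limF; pose Fp x := indefinite_integral a f x.
have FpE c : a < c -> c < b -> ereal_inf (major_values a c f) = (Fp c)%:E /\
    ereal_sup (minor_values a c f) = (Fp c)%:E.
  move=> ac cb; rewrite /Fp /indefinite_integral leNgt ac /=.
  exact: dist_integrable_value ac (intf c ac cb).
have pvF x : a < x -> x < b -> has_point_value F x (Fp x).
  by move=> _ xb; apply: pF; rewrite /= in_itv.
have d1 := distribution_distr dF; have d2 := distribution_distr (distributionN dF).
have le1 c U v : a < c -> c < b -> majorant a c f U -> has_point_value U c v -> Fp c <= v.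
  move=> ac cb mU pU; rewrite -lee_fin -(FpE c ac cb).1; apply: ereal_inf_lbound.
  by apply/major_valuesP => //; exists U.
have adh1 c (e : R) : a < c -> c < b -> 0 < e ->
    exists U v, [/\ majorant a c f U, has_point_value U c v & v <= Fp c + e].
  move=> ac cb e0; have [E _] := FpE c ac cb.
  have fin : ereal_inf (major_values a c f) \is a fin_num by rewrite E.
  have [x Sx] := lb_ereal_inf_adherent e0 fin; have [v _ vx] := Sx.
  rewrite -vx in Sx *; rewrite E -EFinD lte_fin => ve.
  by have [U mU pU] := (major_valuesP f v ac).1 Sx; exists U, v; split=> //; exact: ltW.
(* The same data for - f and - F, read off from the supremum over minor pairs. *)
have le2 c U v : a < c -> c < b -> majorant a c (fun x => - f x)%E U -> has_point_value U c v ->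
    - Fp c <= v.
  move=> ac cb mU pU; rewrite lerNl -lee_fin -(FpE c ac cb).2; apply: ereal_sup_ubound.
  by apply/minor_valuesP => //; exists U => //; rewrite opprK.
have adh2 c (e : R) : a < c -> c < b -> 0 < e -> exists U v,
    [/\ majorant a c (fun x => - f x)%E U, has_point_value U c v & v <= - Fp c + e].
  move=> ac cb e0; have [_ E] := FpE c ac cb.
  have fin : ereal_sup (minor_values a c f) \is a fin_num by rewrite E.
  have [x Sx] := ub_ereal_sup_adherent e0 fin; have [v _ vx] := Sx.
  rewrite -vx in Sx *; rewrite E -EFinB lte_fin => ve.
  have [U mU pU] := (minor_valuesP f v ac).1 Sx; exists U, (- v); split=> //.
  by rewrite lerNl opprD opprK; exact: ltW.
have inf_L : ereal_inf (major_values a b f) = L%:E.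
  apply/eqP; rewrite eq_le; apply/andP; split.
  - apply/lee_addgt0Pr => e e0.
    have [U [v [mU pU ve]]] := majorant_adh_limit ab le1 adh1 d1 pvF limF e0.
    rewrite -EFinD; apply: (@le_trans _ _ v%:E); last by rewrite lee_fin.
    by apply: ereal_inf_lbound; apply/major_valuesP => //; exists U.
  - apply: le_ereal_inf_tmp => x Sx; have [v _ vx] := Sx; rewrite -vx lee_fin in Sx *.
    have [U mU pU] := (major_valuesP f v ab).1 Sx.
    exact: (majorant_ge_limit ab le1 d1 pvF limF mU pU).
have pvN x : a < x -> x < b -> has_point_value (fun phi => - F phi) x (- Fp x).
  by move=> ax xb; apply: has_point_valueN; exact: pvF.
have limN := left_dist_limitN limF.
have sup_L : ereal_sup (minor_values a b f) = L%:E.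
  apply/eqP; rewrite eq_le; apply/andP; split.
  - apply: ge_ereal_sup => x Sx; have [v _ vx] := Sx; rewrite -vx lee_fin in Sx *.
    have [U mU pU] := (minor_valuesP f v ab).1 Sx.
    by have := majorant_ge_limit ab le2 d2 pvN limN mU pU; rewrite lerN2.
  - apply/lee_subgt0Pr => e e0.
    have [U [v [mU pU ve]]] := majorant_adh_limit ab le2 adh2 d2 pvN limN e0.
    rewrite -EFinB; apply: (@le_trans _ _ (- v)%:E); first by rewrite lee_fin; lra.
    by apply: ereal_sup_ubound; apply/minor_valuesP => //; exists U => //; rewrite opprK.
split; last exact: inf_L.
(* Any positive tolerance serves here: only the existence of both kinds of pairs is at stake. *)
have [U [v [mU pU _]]] := majorant_adh_limit ab le1 adh1 d1 pvF limF ltr01.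
have [V [w [mV pV _]]] := majorant_adh_limit ab le2 adh2 d2 pvN limN ltr01.
split; last by rewrite inf_L sup_L.
- by have [u mu] := majorant_major_pair ab mU; exists u, U.
- have [u mu] := majorant_major_pair ab mV.
  by exists (fun phi => - u phi), (fun phi => - V phi); exact: major_minor.
Qed.
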